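(* There is a universal constant $C$ (independent of the dimension $n$ and of $\mu$) such that the following holds. Let $\mu = e^{-V}dx$ be a probability measure on $\mathbb{R}^n$ with $\operatorname{Hess} V \geq \mathrm{I}_n$. Then there are a direction $\sigma \in \mathbb{S}^{n-1}$ and a vector $p \in \operatorname{Span}(\sigma)$ such that $$W_1(\mu, \gamma_{p,\sigma} \otimes \bar{\mu}) \leq C \sqrt{C_P(\mu)^{-1} - 1},$$ where $\gamma_{p,\sigma}$ is the standard Gaussian measure on $\operatorname{Span}(\sigma)$ with barycenter $p$, and $\bar{\mu}$ is the marginal distribution of $\mu$ on $\operatorname{Span}(\sigma)^{\perp}$.
   Context: $C_P(\mu)$ denotes the Poincaré constant of $\mu$: the smallest $C$ such that $\operatorname{Var}_\mu(f) \leq C \int |\nabla f|^2 d\mu$ for all smooth test functions $f$; under the hypothesis $\operatorname{Hess} V \ge \mathrm{I}_n$ it is known that $C_P(\mu) \leq 1$. $W_1$ is the $L^1$ Kantorovich-Wasserstein distance (Euclidean cost). The standard Gaussian measure on the line $\operatorname{Span}(\sigma)$ with barycenter $p$ has mean $p$ and unit variance. The product $\gamma_{p,\sigma} \otimes \bar{\mu}$ is viewed as a measure on $\mathbb{R}^n = \operatorname{Span}(\sigma) \oplus \operatorname{Span}(\sigma)^{\perp}$. *)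

(* Defs.v *)
From HB Require Import structures.
From mathcomp Require Import all_boot all_order all_algebra.
From mathcomp Require Import all_classical all_reals all_analysis.
From mathcomp Require Import measurable_realfun.

Set Implicit Arguments.
Unset Strict Implicit.
Unset Printing Implicit Defensive.

Import Order.TTheory GRing.Theory Num.Theory.
Import numFieldNormedType.Exports.

Local Open Scope classical_set_scope.
Local Open Scope ring_scope.

(* Borel sigma-algebra; R^n is 'rV[R]_n. *)
HB.instance Definition _ (R : realType) (m n : nat) :=
  @isMeasurable.Build (sigma_display (@open 'M[R]_(m, n))) 'M[R]_(m, n)
    <<s @open 'M[R]_(m, n) >> (@sigma_algebra0 _ setT _)
    (@sigma_algebraC _ _) (@sigma_algebra_bigcup _ setT _).

Section borel_matrix.
Context (R : realType) (m n : nat).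

Lemma open_measurable_mx (U : set 'M[R]_(m, n)) : open U -> measurable U.
Proof. exact: sub_sigma_algebra. Qed.

Lemma measurable_fun_mx_open d (T : measurableType d) (f : T -> 'M[R]_(m, n)) :
  (forall U, open U -> measurable (f @^-1` U)) -> measurable_fun setT f.
Proof.
move=> fU; apply: (measurability (@open 'M[R]_(m, n))) => //.
by move=> _ [U oU <-]; rewrite setTI; exact: fU.
Qed.

Lemma measurable_coord_mx i j :
  measurable_fun setT (fun x : 'M[R]_(m, n) => x i j).
Proof.
apply: (measurability _ (RGenOpens.measurableE R)) => _ [_ [a [b ->] <-]].
rewrite setTI; apply: open_measurable_mx.
by apply: open_comp => [x _|]; [exact: coord_continuous|exact: interval_open].
Qed.

Lemma measurable_fun_mxP d (T : measurableType d) (f : T -> 'M[R]_(m, n)) :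
  (forall i j, measurable_fun setT (fun t => f t i j)) -> measurable_fun setT f.
Proof.
move=> mf; apply: measurable_fun_mx_open => U oU.
pose B (q : 'M[rat]_(m, n) * nat) : set 'M[R]_(m, n) :=
  ball (map_mx ratr q.1 : 'M[R]_(m, n)) (q.2.+1%:R^-1 : R).
have -> : U = \bigcup_(q in [set q | B q `<=` U]) B q.
  apply/seteqP; split=> [x Ux|x [q /= qU /qU //]].
  have [e /= e0 xe] := (nbhs_ballP _ _).1 (open_nbhs_nbhs (conj oU Ux)).
  have [k ke] : exists k, k.+1%:R^-1 < e / 2.
    exists (Num.truncn (e / 2)^-1).
    rewrite invf_plt ?posrE ?divr_gt0//.
    exact: truncnS_gt.
  have k0 : 0 < k.+1%:R^-1 :> R by rewrite invr_gt0.
  have qx i j : exists q : rat, x i j - k.+1%:R^-1 < ratr q < x i j + k.+1%:R^-1.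
    have /rat_in_itvoo[q] : x i j - k.+1%:R^-1 < x i j + k.+1%:R^-1.
      by rewrite ltrD2l gtrN.
    by rewrite in_itv/=; exists q.
  pose q := \matrix_(i, j) xget 0 [set q | x i j - k.+1%:R^-1 < ratr q < x i j + k.+1%:R^-1].
  have xq i j : `|x i j - ratr (q i j)| < k.+1%:R^-1.
    rewrite mxE; have /= h := xgetPex 0 (qx i j).
    by rewrite distrC ltr_distl.
  exists (q, k); last first.
    by split=> // i j; rewrite mxE /ball/= distrC; exact: xq.
  move=> y /= [_ qy]; apply: xe; split=> // i j.
  have := qy i j; rewrite mxE /ball/= => qyij.
  rewrite (splitr e) -[x i j](subrK (ratr (q i j))) -addrA.
  by rewrite (le_lt_trans (ler_normD _ _))// ltrD// (lt_trans _ ke).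
rewrite preimage_bigcup bigcup_mkcond; apply: countable_bigcupT_measurable => // q.
case: ifP => // _.
have -> : f @^-1` B q = \bigcap_(ij in [set: 'I_m * 'I_n])
    ((fun t => f t ij.1 ij.2) @^-1` ball (ratr (q.1 ij.1 ij.2) : R) q.2.+1%:R^-1).
  apply/seteqP; split=> [t [_ h] [i j] _|t h] /=.
    by have := h i j; rewrite mxE.
  split=> [|i j]; first by rewrite invr_gt0.
  by have := h (i, j) I; rewrite mxE.
apply: fin_bigcap_measurable => // -[i j] _ /=.
rewrite -[X in measurable X]setTI; apply: mf => //.
by apply: open_measurable; exact: ball_open.
Qed.

End borel_matrix.

Section lebesgue_measure_rV.
Context (R : realType).

Definition cons_rV n (p : measurableTypeR R * 'rV[R]_n) : 'rV[R]_n.+1 :=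
  \row_i if unlift ord0 i is Some j then p.2 0 j else p.1.

Lemma measurable_cons_rV n : measurable_fun setT (@cons_rV n).
Proof.
apply: measurable_fun_mxP => i j; under eq_fun do rewrite mxE.
case: unliftP => [k _|_]; last exact: measurable_fst.
exact: measurableT_comp (measurable_coord_mx 0 k) measurable_snd.
Qed.

(* Lebesgue measure on R x R^n, transported to R^(n+1). *)
Definition cons_lebesgue n (l : set 'rV[R]_n -> \bar R) :
    set 'rV[R]_n.+1 -> \bar R :=
  pushforward (@lebesgue_measure R \x l)%E (@cons_rV n).

Section cons_lebesgue.
Context n (l : {sigma_finite_measure set 'rV[R]_n -> \bar R}).

Let mu : {measure set (measurableTypeR R * 'rV[R]_n)%type -> \bar R} :=
  (@lebesgue_measure R \x l)%E.

Let cons_lebesgue0 : cons_lebesgue l set0 = 0%E.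
Proof. by rewrite /cons_lebesgue /pushforward preimage_set0 (measure0 mu). Qed.

Let cons_lebesgue_ge0 A : (0 <= cons_lebesgue l A)%E.
Proof. exact: (measure_ge0 mu). Qed.

Let cons_lebesgue_sigma_additive : semi_sigma_additive (cons_lebesgue l).
Proof.
have mpre A : measurable A -> measurable (@cons_rV n @^-1` A).
  by move=> mA; rewrite -[X in measurable X]setTI; exact: measurable_cons_rV.
move=> F mF tF mUF; rewrite /cons_lebesgue /pushforward preimage_bigcup.
apply: (@measure_semi_sigma_additive _ _ _ mu) => [k||]; first exact: mpre.
  apply/trivIsetP => /= i j _ _ ij; rewrite -preimage_setI.
  by move/trivIsetP : tF => /(_ _ _ _ _ ij) ->//; rewrite preimage_set0.
by rewrite -preimage_bigcup; exact: mpre.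
Qed.

HB.instance Definition _ := isMeasure.Build _ _ _ (cons_lebesgue l)
  cons_lebesgue0 cons_lebesgue_ge0 cons_lebesgue_sigma_additive.

Let cons_lebesgue_sigma_finite : sigma_finite setT (cons_lebesgue l).
Proof.
have /sigma_finiteP[F [TF ndF Foo]] := sigma_finiteT (@lebesgue_measure R).
have /sigma_finiteP[G [TG ndG Goo]] := sigma_finiteT l.
pose uncons (x : 'rV[R]_n.+1) : measurableTypeR R * 'rV[R]_n :=
  (x 0 ord0, \row_j x 0 (lift ord0 j)).
have unconsK p : uncons (cons_rV p) = p.
  case: p => t x; congr pair; first by rewrite mxE unlift_none.
  by apply/rowP => j; rewrite !mxE liftK.
have muncons : measurable_fun setT uncons.
  apply/measurable_fun_pairP; split; first exact: measurable_coord_mx.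
  apply: measurable_fun_mxP => i j; under eq_fun do rewrite mxE.
  exact: measurable_coord_mx.
exists (fun k => uncons @^-1` (F k `*` G k)).
  apply/esym; rewrite -subTset => x _.
  have [i _ Fi] : (\bigcup_i F i) (uncons x).1 by rewrite -TF.
  have [j _ Gj] : (\bigcup_j G j) (uncons x).2 by rewrite -TG.
  exists (maxn i j) => //; split.
    by move: Fi; exact/subsetPset/ndF/leq_maxl.
  by move: Gj; exact/subsetPset/ndG/leq_maxr.
move=> k; have [mF Flty] := Foo k; have [mG Glty] := Goo k; split.
  by rewrite -[X in measurable X]setTI; apply: muncons => //; exact: measurableX.
rewrite /cons_lebesgue /pushforward (_ : _ @^-1` _ = F k `*` G k).
  by rewrite product_measure1E// lte_mul_pinfty// ge0_fin_numE.
by apply/funext => p; rewrite /preimage /mkset unconsK.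
Qed.

HB.instance Definition _ := Measure_isSigmaFinite.Build _ _ _ (cons_lebesgue l)
  cons_lebesgue_sigma_finite.

End cons_lebesgue.

Fixpoint lebesgue_rV n : {sigma_finite_measure set 'rV[R]_n -> \bar R} :=
  if n is n'.+1 then cons_lebesgue (lebesgue_rV n') else \d_(0 : 'rV[R]_0).

End lebesgue_measure_rV.

Section euclidean.
Context (R : realType) (n : nat).
Implicit Types (u v x : 'rV[R]_n) (A B : 'M[R]_n) (f V : 'rV[R]_n -> R).

Definition dotp u v : R := \sum_i u 0 i * v 0 i.

(* `|u| is the sup norm on 'rV[R]_n. *)
Definition enorm u : R := Num.sqrt (dotp u u).

Definition gradient f x : 'rV[R]_n := \row_i 'D_(delta_mx 0 i) f x.

Definition hessian f x : 'M[R]_n := jacobian (gradient f) x.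

Definition twice_differentiable f :=
  (forall x, differentiable f x) /\ (forall x, differentiable (gradient f) x).

Definition loewner_le A B := forall v, 0 <= dotp (v *m (B - A)) v.

Definition iter_partial (s : seq 'I_n) f : 'rV[R]_n -> R :=
  foldr (fun i g => 'D_(delta_mx 0 i) g) f s.

(* C^infinity: every iterated partial derivative is differentiable. *)
Definition smooth f :=
  forall (s : seq 'I_n) x, differentiable (iter_partial s f) x.

Definition test_function f :=
  smooth f /\ compact (closure [set x | f x != 0]).

End euclidean.

Section poincare_wasserstein.
Context (R : realType) (n : nat).
Local Open Scope ereal_scope.
Implicit Types (mu nu : probability 'rV[R]_n R).

Definition poincare_inequality mu (c : R) :=
  forall f, test_function f ->
    'V_mu[f] <= c%:E * \int[mu]_x (enorm (gradient f x) ^+ 2)%:E.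

Definition poincare_constant mu : \bar R :=
  ereal_inf [set c%:E | c in [set c : R | (0 <= c)%R /\ poincare_inequality mu c]].

Definition coupling mu nu (pi : probability ('rV[R]_n * 'rV[R]_n)%type R) :=
  (forall A, measurable A -> pi (A `*` setT) = mu A) /\
  (forall A, measurable A -> pi (setT `*` A) = nu A).

Definition wasserstein1 mu nu : \bar R :=
  ereal_inf [set \int[pi]_z (enorm (z.1 - z.2))%:E | pi in coupling mu nu].

End poincare_wasserstein.

Section gaussian_product.
Context (R : realType) (n : nat).
Implicit Types (p sigma x : 'rV[R]_n) (mu nu : probability 'rV[R]_n R).

Definition line_param p sigma (t : measurableTypeR R) : 'rV[R]_n :=
  p + t *: sigma.

Definition orth_proj sigma x : 'rV[R]_n := x - dotp x sigma *: sigma.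

Definition direct_sum (z : 'rV[R]_n * 'rV[R]_n) : 'rV[R]_n := z.1 + z.2.

Lemma measurable_line_param p sigma : measurable_fun setT (line_param p sigma).
Proof.
apply: measurable_fun_mxP => i j; under eq_fun do rewrite !mxE.
by apply: measurable_funD => //; exact: measurable_funM.
Qed.

HB.instance Definition _ p sigma := isMeasurableFun.Build _ _ _ _
  (line_param p sigma) (measurable_line_param p sigma).

Lemma measurable_orth_proj sigma : measurable_fun setT (orth_proj sigma).
Proof.
apply: measurable_fun_mxP => i j; under eq_fun do rewrite !mxE.
apply: measurable_funB; first exact: measurable_coord_mx.
apply: measurable_funM => //; apply: measurable_sum => k.
by apply: measurable_funM => //; exact: measurable_coord_mx.
Qed.

HB.instance Definition _ sigma := isMeasurableFun.Build _ _ _ _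
  (orth_proj sigma) (measurable_orth_proj sigma).

Lemma measurable_direct_sum : measurable_fun setT direct_sum.
Proof.
apply: measurable_fun_mxP => i j; under eq_fun do rewrite mxE.
apply: measurable_funD.
  exact: measurableT_comp (measurable_coord_mx i j) measurable_fst.
exact: measurableT_comp (measurable_coord_mx i j) measurable_snd.
Qed.

HB.instance Definition _ := isMeasurableFun.Build _ _ _ _
  direct_sum measurable_direct_sum.

(* gamma_{p,sigma}, seen as a measure on R^n carried by Span(sigma), when
   sigma is a unit vector and p lies on Span(sigma). *)
Definition gaussian_line p sigma : probability 'rV[R]_n R :=
  distribution (normal_prob 0 1) (line_param p sigma).

(* Marginal on the orthogonal complement of the unit vector sigma. *)
Definition orth_marginal sigma mu : probability 'rV[R]_n R :=
  distribution mu (orth_proj sigma).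

(* Product of measures carried by complementary subspaces, on R^n. *)
Definition prod_direct_sum mu nu : probability 'rV[R]_n R :=
  distribution (mu \x nu)%E direct_sum.

End gaussian_product.

(* Main.v *)
(* Write dvar f for the double integral of (f x - f y)^2 under mu \x mu, twice
   the variance. Gluing Knothe's rearrangements gives a Prekopa-Leindler
   inequality and, expanding it around exp(- V), the Poincare inequality with
   constant 1 for V, with constant 1/2 for the potential
   d |-> V(m + d) + V(m - d). The latter improves the Poincare inequality to
   2 dvar g <= int int |G x + G y|^2 with G the gradient of g. So if
   dvar g >= 2 c int |G|^2 with c close to 1, then G is close to a constant
   vector v in L^2, and the Poincare inequality for 2 g - <., v> forces
   dvar <., s> >= 2 - 80 (1 - c) for s = v / |v|. By compactness one unit
   vector s serves for c = C_P(mu).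

   Fix this s and put e = 80 (1 - C_P(mu)). The marginal along s is exp(- v)
   with v'' >= 1 and its quantile function X is a contraction of that of the
   standard Gaussian, G; comparing variances, X - G is within L^2-distance
   sqrt e of a constant m. Let u, t be independent and uniform on ]0, 1[ and
   let one Knothe randomness w drive all the fibres orthogonal to s. Then
   (X u, w) has law mu, ((m + G u) s, orthogonal part of (X t, w)) has the law
   of the product, and the mean squared distance between the orthogonal parts
   at X u and X t is at most 8 times the midpoint defect of v - t^2 / 2, whose
   mean is controlled by 2 - dvar <., s> <= e. *)
Require Import Defs.
From HB Require Import structures.
From mathcomp Require Import all_boot all_order all_algebra.
From mathcomp Require Import all_classical all_reals all_analysis.
From mathcomp Require Import measurable_realfun gauss_integral ring lra.

Set Implicit Arguments.
Unset Strict Implicit.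
Unset Printing Implicit Defensive.

Import Order.TTheory GRing.Theory Num.Theory.
Import numFieldNormedType.Exports.

Local Open Scope classical_set_scope.
Local Open Scope ring_scope.

(** * Integration on row vectors *)

(** No extremal function for the Poincare inequality is assumed to exist; an almost extremal test
    function [g] takes its place. Rigidity comes from the parallelogram identity: the integrals of
    |G x + G y|^2 and |G x - G y|^2 add up to 4 int |G|^2, so when 2 dvar g almost fills the first,
    little is left for the second. The sum G x + G y arises by fixing a midpoint m: d |-> g(m + d) -
    g(m - d) is odd for an even measure, hence centred, and its gradient is G(m + d) + G(m - d).

    Knothe's maps replace optimal ones because they are made of quantile functions, hence depend
    measurably on parameters, as the gluing of fibres requires. Of their Jacobians only the
    comparison of geometric and arithmetic means matters, so no map is differentiated. The
    regularity of V and g is likewise reduced to convexity and midpoint inequalities, which are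
    stable under the symmetrisation about m.

    The final constant is sqrt(3 * 80): the factor 3 is one e for the marginal along s and two e for
    the orthogonal parts. *)

Section integral_density.
Local Open Scope ereal_scope.
Context d (T : measurableType d) (R : realType).
Variables mu nu : {measure set T -> \bar R}.
Variable f : T -> R.
Hypotheses (mf : measurable_fun setT f) (f0 : forall x, (0 <= f x)%R).
Hypothesis nuE : forall A, measurable A -> nu A = \int[mu]_(x in A) (f x)%:E.

Import HBNNSimple.

Let integral_density_nnsfun (h : {nnsfun T >-> R}) :
  \int[nu]_x (h x)%:E = \int[mu]_x ((h x)%:E * (f x)%:E).
Proof.
have mf' : measurable_fun setT (EFin \o f) by exact/measurable_EFinP.
under [LHS]eq_integral do rewrite fimfunE -fsumEFin//.
rewrite [LHS]ge0_integral_fsum//; last 2 first.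
  - by move=> r; exact/measurable_EFinP/measurableT_comp.
  - by move=> n x _; rewrite EFinM nnfun_muleindic_ge0.
under [RHS]eq_integral.
  move=> x _; rewrite fimfunE -fsumEFin// ge0_mule_fsuml; last first.
    by move=> r; rewrite EFinM nnfun_muleindic_ge0.
  over.
rewrite [RHS]ge0_integral_fsum//; last 2 first.
  - move=> r; apply: emeasurable_funM => //.
    by apply/measurable_EFinP; do 2 apply/measurableT_comp => //.
  - by move=> n x _; apply: mule_ge0; [rewrite EFinM nnfun_muleindic_ge0|rewrite lee_fin].
apply: eq_fsbigr => r _.
have [r0|r0] := ltP r 0%R.
  rewrite preimage_nnfun0//; under eq_integral do rewrite indic0 mulr0.
  by under [RHS]eq_integral do rewrite indic0 mulr0 mul0e; rewrite !integral0.
under eq_integral do rewrite EFinM.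
rewrite ge0_integralZl//; last exact/measurable_EFinP/measurable_indic.
rewrite integral_indic// setIT nuE//.
under [RHS]eq_integral do rewrite EFinM -muleA.
rewrite ge0_integralZl//; last 2 first.
  - by apply: emeasurable_funM => //; exact/measurable_EFinP/measurable_indic.
  - by move=> x _; apply: mule_ge0; rewrite lee_fin.
congr (_ * _); rewrite integral_mkcond; apply: eq_integral => x _.
rewrite patchE indicE; case: ifPn => xh; first by rewrite mul1e.
by rewrite mul0e.
Qed.

(** The density is known only through its values on measurable sets, so simple functions come first
    and monotone convergence does the rest. Serves both [mu] and the normal law. *)
Lemma integral_density (g : T -> \bar R) :
  measurable_fun setT g -> (forall x, 0 <= g x) ->
  \int[nu]_x g x = \int[mu]_x (g x * (f x)%:E).
Proof.
have mf' : measurable_fun setT (EFin \o f) by exact/measurable_EFinP.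
move=> mg g0; pose g_ := nnsfun_approx measurableT mg.
have gE x : ((g_ n x)%:E @[n --> \oo]) --> g x.
  by apply: cvg_nnsfun_approx.
transitivity (limn (fun n => \int[nu]_x (g_ n x)%:E)).
  rewrite -monotone_convergence//=.
  - by apply: eq_integral => x _; apply/esym/cvg_lim => //; exact: gE.
  - by move=> n; exact/measurable_EFinP/measurable_funTS.
  - by move=> n x _; rewrite lee_fin.
  - by move=> x _ a b ab; rewrite lee_fin; exact/lefP/nd_nnsfun_approx.
transitivity (limn (fun n => \int[mu]_x ((g_ n x)%:E * (f x)%:E))).
  by apply: congr_lim; apply/funext => n; exact: integral_density_nnsfun.
rewrite -monotone_convergence//=.
- apply: eq_integral => x _; apply/cvg_lim => //.
  by apply: cvgeZr => //; exact: gE.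
- move=> n; apply: emeasurable_funM => //.
  exact/measurable_EFinP/measurable_funTS.
- by move=> n x _; rewrite mule_ge0// lee_fin.
- move=> x _ a b ab; rewrite lee_wpmul2r// ?lee_fin//.
  exact/lefP/nd_nnsfun_approx.
Qed.

End integral_density.

(** A nonnegative function of zero integral vanishes almost everywhere; here that would make [D]
    negligible. *)
Lemma integral_gt0 d (T : measurableType d) (R : realType)
    (mu : {measure set T -> \bar R}) (D : set T) (f : T -> \bar R) :
  measurable D -> measurable_fun D f -> (forall x, D x -> 0 < f x)%E ->
  (0 < mu D)%E -> (0 < \int[mu]_(x in D) f x)%E.
Proof.
move=> mD mf f0 muD; rewrite lt0e integral_ge0 ?andbT; last by move=> x /f0/ltW.
apply/negP => /eqP h.
have : ae_eq mu D f (cst 0%E).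
  apply: (ae_eq_integral_abs _ mD mf).1.
  by rewrite -h; apply: eq_integral => x /set_mem/f0/ltW/gee0_abs.
move=> [N [mN N0 DN]]; have : (mu D <= mu N)%E.
  apply: le_measure; rewrite ?inE// => x Dx; apply: DN => /= /(_ Dx) fx.
  by have := f0 x Dx; rewrite fx ltxx.
by rewrite N0 leNgt muD.
Qed.

Section integral_real_line.
Local Open Scope ereal_scope.
Context (R : realType).
Local Notation leb := (@lebesgue_measure R).
Implicit Type f : measurableTypeR R -> \bar R.

Let measurable_affine (a b : R) :
  measurable_fun setT (fun x : measurableTypeR R => (a * x + b)%R : measurableTypeR R).
Proof. by apply: measurable_funD => //; exact: measurable_funM. Qed.

Let ge0_integral_affine_pos f (a b : R) : (0 < a)%R ->
  measurable_fun setT f -> (forall x, 0 <= f x) ->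
  \int[leb]_x f (a * x + b)%R = a^-1%:E * \int[leb]_x f x.
Proof.
move=> a0 mf f0; pose phi (x : measurableTypeR R) : measurableTypeR R := (a * x + b)%R.
have mphi : measurable_fun setT phi by exact: measurable_affine.
rewrite -[LHS]/(\int[leb]_(x in phi @^-1` setT) (f \o phi) x).
rewrite -ge0_integral_pushforward//.
pose aN := NngNum (ltW a0).
(* By uniqueness of Lebesgue measure it suffices to compare half-open intervals, whose preimages
   under [phi] are shorter by the factor [a]. *)
have lebE A : measurable A -> leb A = mscale aN (pushforward leb phi) A.
  apply: lebesgue_measure_unique => _ [[l r]] _ <-.
  rewrite [RHS](_ : _ = a%:E * leb (phi @^-1` `]l, r]%classic))//.
  rewrite (_ : phi @^-1` _ = `](a^-1 * (l - b))%R, (a^-1 * (r - b))%R]%classic); last first.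
    apply/seteqP; split=> x; rewrite /= !in_itv/= /phi.
      by rewrite -ltrBlDr -lerBrDr ltr_pdivrMl// ler_pdivlMl.
    by rewrite ltr_pdivrMl// ler_pdivlMl// ltrBlDr lerBrDr.
  rewrite !lebesgue_measure_itv/= !lte_fin ltr_pM2l ?invr_gt0// ltrD2r.
  case: ifPn => _; last by rewrite mule0.
  rewrite -!EFinB -EFinM; congr EFin.
  by field; exact: lt0r_neq0.
rewrite [in RHS](eq_measure_integral (mscale aN (pushforward leb phi))); last first.
  by move=> A mA _; exact: lebE.
rewrite ge0_integral_mscale//= muleA -EFinM mulVf ?mul1e//; exact: lt0r_neq0.
Qed.

Lemma ge0_integral_lebN f : measurable_fun setT f -> (forall x, 0 <= f x) ->
  \int[leb]_x f (- x)%R = \int[leb]_x f x.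
Proof.
move=> mf f0; pose phi (x : measurableTypeR R) : measurableTypeR R := (- x)%R.
have mphi : measurable_fun setT phi by exact: measurable_funN.
rewrite -[LHS]/(\int[leb]_(x in phi @^-1` setT) (f \o phi) x).
rewrite -ge0_integral_pushforward//.
by apply: eq_measure_integral => A mA _; exact: lebesgue_measureN.
Qed.

Lemma ge0_integral_affine f (a b : R) : a != 0%R ->
  measurable_fun setT f -> (forall x, 0 <= f x) ->
  \int[leb]_x f (a * x + b)%R = `|a|^-1%:E * \int[leb]_x f x.
Proof.
move=> + mf f0; case: ltgtP => // a0 _.
  transitivity (\int[leb]_x (f (- a * x + b)%R)).
    rewrite -ge0_integral_lebN//; last first.
      by apply: measurableT_comp mf _; exact: measurable_affine.
    by apply: eq_integral => x _; congr f; rewrite mulrN mulNr.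
  by rewrite ge0_integral_affine_pos ?oppr_gt0// ltr0_norm.
by rewrite ge0_integral_affine_pos// gtr0_norm.
Qed.

End integral_real_line.

Section measurable_rV.
Context (R : realType) (n : nat) d (T : measurableType d).
Implicit Types f g : T -> 'rV[R]_n.

Lemma measurable_rV f :
  (forall j, measurable_fun setT (fun t => f t 0 j)) -> measurable_fun setT f.
Proof. by move=> mf; apply: measurable_fun_mxP => i j; rewrite ord1. Qed.

Lemma measurable_rV_coord f j :
  measurable_fun setT f -> measurable_fun setT (fun t => f t 0 j).
Proof. by move=> mf; exact: measurableT_comp (measurable_coord_mx 0 j) mf. Qed.

Lemma measurable_rVD f g : measurable_fun setT f -> measurable_fun setT g ->
  measurable_fun setT (fun t => f t + g t).
Proof.
move=> mf mg; apply: measurable_rV => j; under eq_fun do rewrite mxE.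
by apply: measurable_funD; exact: measurable_rV_coord.
Qed.

Lemma measurable_rVN f : measurable_fun setT f ->
  measurable_fun setT (fun t => - f t).
Proof.
move=> mf; apply: measurable_rV => j; under eq_fun do rewrite mxE.
by apply: measurableT_comp => //; exact: measurable_rV_coord.
Qed.

Lemma measurable_rVB f g : measurable_fun setT f -> measurable_fun setT g ->
  measurable_fun setT (fun t => f t - g t).
Proof. by move=> mf mg; apply: measurable_rVD => //; exact: measurable_rVN. Qed.

Lemma measurable_rVZ (a : T -> R) f : measurable_fun setT a ->
  measurable_fun setT f -> measurable_fun setT (fun t => a t *: f t).
Proof.
move=> ma mf; apply: measurable_rV => j; under eq_fun do rewrite mxE.
by apply: measurable_funM => //; exact: measurable_rV_coord.
Qed.

Lemma measurable_dotp f g : measurable_fun setT f -> measurable_fun setT g ->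
  measurable_fun setT (fun t => dotp (f t) (g t)).
Proof.
move=> mf mg; apply: measurable_sum => k.
by apply: measurable_funM; exact: measurable_rV_coord.
Qed.

Lemma measurable_enorm f : measurable_fun setT f ->
  measurable_fun setT (fun t => enorm (f t)).
Proof.
move=> mf; rewrite /enorm.
apply: (@measurableT_comp _ _ _ _ _ _ (@Num.sqrt R)); last exact: measurable_dotp.
exact: (continuous_measurable_fun (@sqrt_continuous R)).
Qed.

End measurable_rV.

Lemma measurable_cons_rV_fun (R : realType) n d (T : measurableType d)
    (a : T -> R) (f : T -> 'rV[R]_n) : measurable_fun setT a -> measurable_fun setT f ->
  measurable_fun setT (fun t => cons_rV (a t, f t)).
Proof.
move=> ma mf; apply: (measurableT_comp (@measurable_cons_rV R n)).
exact/measurable_fun_pairP.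
Qed.

Lemma continuous_measurable_rV (R : realType) n (f : 'rV[R]_n -> R) :
  continuous f -> measurable_fun setT f.
Proof.
move=> cf; apply: (measurability _ (RGenOpens.measurableE R)) => _ [_ [a [b ->] <-]].
rewrite setTI; apply: open_measurable_mx.
by apply: open_comp => [x _|]; [exact: cf|exact: interval_open].
Qed.

Section cons_rV.
Context (R : realType) (n : nat).
Implicit Types (a b : R) (x y : 'rV[R]_n).

Lemma cons_rV0 a x : cons_rV (a, x) 0 ord0 = a.
Proof. by rewrite mxE unlift_none. Qed.

Lemma cons_rVS a x i : cons_rV (a, x) 0 (lift ord0 i) = x 0 i.
Proof. by rewrite mxE liftK. Qed.

Lemma cons_rVD a b x y : cons_rV (a, x) + cons_rV (b, y) = cons_rV (a + b, x + y).
Proof. by apply/rowP => i; rewrite !mxE; case: unliftP => //= j _; rewrite mxE. Qed.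

Lemma cons_rVN a x : - cons_rV (a, x) = cons_rV (- a, - x).
Proof. by apply/rowP => i; rewrite !mxE; case: unliftP => //= j _; rewrite mxE. Qed.

Lemma cons_rVZ k a x : k *: cons_rV (a, x) = cons_rV (k * a, k *: x).
Proof. by apply/rowP => i; rewrite !mxE; case: unliftP => //= j _; rewrite mxE. Qed.

Lemma cons_rV_eta (v : 'rV[R]_n.+1) :
  v = cons_rV (v 0 ord0, \row_j v 0 (lift ord0 j)).
Proof. by apply/rowP => i; rewrite mxE; case: unliftP => [j ->|->] //; rewrite mxE. Qed.

Lemma dotp_cons a b x y : dotp (cons_rV (a, x)) (cons_rV (b, y)) = a * b + dotp x y.
Proof.
rewrite /dotp big_ord_recl !cons_rV0; congr (_ + _).
by apply: eq_bigr => i _; rewrite !cons_rVS.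
Qed.

End cons_rV.

Section integral_rV.
Local Open Scope ereal_scope.
Context (R : realType).

Lemma integral_rV0 (h : 'rV[R]_0 -> \bar R) : measurable_fun setT h ->
  \int[@lebesgue_rV R 0]_x h x = h 0%R.
Proof. by move=> mh; rewrite integral_dirac// diracT mul1e. Qed.

(** The recursion behind every induction on the dimension: Lebesgue measure on rows is by
    construction the image of a product. *)
Lemma integral_rVS n (h : 'rV[R]_n.+1 -> \bar R) : measurable_fun setT h ->
  (forall x, 0 <= h x) ->
  \int[@lebesgue_rV R n.+1]_x h x =
  \int[@lebesgue_measure R]_s \int[@lebesgue_rV R n]_y h (cons_rV (s, y)).
Proof.
move=> mh h0.
have -> : \int[@lebesgue_rV R n.+1]_x h x =
    \int[(@lebesgue_measure R \x @lebesgue_rV R n)]_(z in @cons_rV R n @^-1` setT)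
      (h \o @cons_rV R n) z.
  by rewrite -(ge0_integral_pushforward (@measurable_cons_rV R n)).
rewrite preimage_setT fubini_tonelli1//; last by move=> x; exact: h0.
by apply: measurableT_comp => //; exact: measurable_cons_rV.
Qed.

Lemma measurable_slice n (h : 'rV[R]_n.+1 -> \bar R) : measurable_fun setT h ->
  (forall x, 0 <= h x) ->
  measurable_fun setT (fun s => \int[@lebesgue_rV R n]_y h (cons_rV (s, y))).
Proof.
move=> mh h0.
apply: (measurable_fun_fubini_tonelli_F (h \o @cons_rV R n)) => //; last first.
  by move=> x; exact: h0.
by apply: measurableT_comp => //; exact: measurable_cons_rV.
Qed.

Lemma integral_rV_shift n (h : 'rV[R]_n -> \bar R) v : measurable_fun setT h ->
  (forall x, 0 <= h x) ->
  \int[@lebesgue_rV R n]_x h (x + v)%R = \int[@lebesgue_rV R n]_x h x.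
Proof.
elim: n h v => [|n IH] h v mh h0.
  rewrite !integral_rV0//; first by rewrite [v]thinmx0 addr0.
  by apply: measurableT_comp => //; exact: measurable_rVD.
have mhc (a : R) : measurable_fun setT
   (fun y : 'rV[R]_n => h (cons_rV (a, y))).
  apply: (measurableT_comp mh); exact: measurable_cons_rV_fun.
rewrite !integral_rVS//; last first.
  by apply: measurableT_comp => //; exact: measurable_rVD.
rewrite [in LHS](cons_rV_eta v); set a := v 0%R ord0; set w := \row_j _.
under eq_integral do (under eq_integral do rewrite cons_rVD; rewrite (IH (fun y => h (cons_rV (_, y))))//).
have mI := measurable_slice mh h0.
have I0 s : 0 <= \int[@lebesgue_rV R n]_y h (cons_rV (s, y)) by exact: integral_ge0.
have := @ge0_integral_affine R _ 1 a (oner_neq0 _) mI I0.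
rewrite normr1 invr1 mul1e => <-.
by apply: eq_integral => s _; rewrite mul1r.
Qed.

Lemma integral_rVN n (h : 'rV[R]_n -> \bar R) : measurable_fun setT h ->
  (forall x, 0 <= h x) ->
  \int[@lebesgue_rV R n]_x h (- x)%R = \int[@lebesgue_rV R n]_x h x.
Proof.
elim: n h => [|n IH] h mh h0.
  rewrite !integral_rV0//; first by rewrite oppr0.
  by apply: measurableT_comp => //; exact: measurable_rVN.
have mhc (a : R) : measurable_fun setT
   (fun y : 'rV[R]_n => h (cons_rV (a, y))).
  apply: (measurableT_comp mh); exact: measurable_cons_rV_fun.
rewrite !integral_rVS//; last first.
  by apply: measurableT_comp => //; exact: measurable_rVN.
under eq_integral do (under eq_integral do rewrite cons_rVN; rewrite (IH (fun y => h (cons_rV (_, y))))//).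
rewrite -ge0_integral_lebN//; last 2 first.
- exact: (measurable_slice mh).
- by move=> x; exact: integral_ge0.
Qed.

Let integral_rVZ n (h : 'rV[R]_n -> \bar R) (a : R) : a != 0%R ->
  measurable_fun setT h -> (forall x, 0 <= h x) ->
  \int[@lebesgue_rV R n]_x h (a *: x)%R =
  (`|a| ^- n)%:E * \int[@lebesgue_rV R n]_x h x.
Proof.
move=> a0; elim: n h => [|n IH] h mh h0.
  rewrite !integral_rV0//; first by rewrite expr0 invr1 mul1e scaler0.
  by apply: measurableT_comp => //; exact: measurable_rVZ.
have mhc (b : R) : measurable_fun setT
   (fun y : 'rV[R]_n => h (cons_rV (b, y))).
  apply: (measurableT_comp mh); exact: measurable_cons_rV_fun.
rewrite !integral_rVS//; last first.
  by apply: measurableT_comp => //; exact: measurable_rVZ.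
under eq_integral do (under eq_integral do rewrite cons_rVZ; rewrite (IH (fun y => h (cons_rV (_, y))))//).
have mI := measurable_slice mh h0.
have I0 s : 0 <= \int[@lebesgue_rV R n]_y h (cons_rV (s, y)) by exact: integral_ge0.
rewrite ge0_integralZl//; last first.
  have ma : measurable_fun setT (fun s : measurableTypeR R => (a * s)%R : measurableTypeR R).
    exact: measurable_funM.
  exact: (measurableT_comp mI ma).
have -> : \int[@lebesgue_measure R]_s \int[@lebesgue_rV R n]_y h (cons_rV ((a * s)%R, y)) =
   `|a|^-1%:E * \int[@lebesgue_measure R]_s \int[@lebesgue_rV R n]_y h (cons_rV (s, y)).
  rewrite -(@ge0_integral_affine R _ a 0 a0 mI I0).
  by apply: eq_integral => s _; rewrite addr0.
by rewrite muleA -EFinM exprS invfM mulrC.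
Qed.

Lemma integral_rV_affine n (h : 'rV[R]_n -> \bar R) (a : R) v : a != 0%R ->
  measurable_fun setT h -> (forall x, 0 <= h x) ->
  \int[@lebesgue_rV R n]_x h (a *: x + v)%R =
  (`|a| ^- n)%:E * \int[@lebesgue_rV R n]_x h x.
Proof.
move=> a0 mh h0; rewrite -(integral_rV_shift v mh h0).
apply: (@integral_rVZ n (fun x => h (x + v)%R)) => //.
by apply: measurableT_comp => //; exact: measurable_rVD.
Qed.

End integral_rV.

(** * Quantile functions *)

(** Weighted average of the tangent-line inequality at the barycentre [m]. *)
Lemma expR_conv (R : realType) (l x y : R) : 0 <= l -> l <= 1 ->
  expR ((1 - l) * x + l * y) <= (1 - l) * expR x + l * expR y.
Proof.
move=> l0 l1; set m := (1 - l) * x + l * y.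
have h z : expR m * (1 + (z - m)) <= expR z.
  have -> : expR z = expR m * expR (z - m) by rewrite -expRD; congr expR; ring.
  by rewrite ler_pM2l ?expR_gt0// expR_ge1Dx.
have l1' : 0 <= 1 - l by rewrite subr_ge0.
rewrite (le_trans _ (lerD (ler_wpM2l l1' (h x)) (ler_wpM2l l0 (h y))))//.
by rewrite le_eqVlt; apply/orP; left; apply/eqP; rewrite /m; ring.
Qed.

Section density_measure.
Local Open Scope ereal_scope.
Context d (T : measurableType d) (R : realType) (mu : {measure set T -> \bar R}).
Variable f : T -> R.
Hypotheses (mf : measurable_fun setT f) (f0 : forall x, (0 <= f x)%R).

(** The hypotheses on [f] are arguments, so that the measure structure can be declared canonically
    for every such [f]. *)
Definition dens_measure of measurable_fun setT f & (forall x, (0 <= f x)%R) :=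
  fun A : set T => \int[mu]_(x in A) (f x)%:E.

Local Notation nu := (dens_measure mf f0).

Let dens0 : nu set0 = 0. Proof. exact: integral_set0. Qed.

Let dens_ge0 A : 0 <= nu A.
Proof. by apply: integral_ge0 => x _; rewrite lee_fin. Qed.

Let dens_sigma_additive : semi_sigma_additive nu.
Proof.
move=> /= F mF tF mUF; rewrite /dens_measure; apply: cvg_toP.
  apply: ereal_nondecreasing_is_cvgn => m n mn.
  apply: lee_sum_nneg_natr => // k _ _.
  by apply: integral_ge0 => /= x Fkx; rewrite lee_fin.
rewrite ge0_integral_bigcup//=.
- by apply: measurable_funTS; exact/measurable_EFinP.
- by move=> x _; rewrite lee_fin.
Qed.

HB.instance Definition _ := isMeasure.Build _ _ _ nu
  dens0 dens_ge0 dens_sigma_additive.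

Lemma integral_dens (g : T -> \bar R) : measurable_fun setT g ->
  (forall x, 0 <= g x) -> \int[nu]_x g x = \int[mu]_x (g x * (f x)%:E).
Proof. by move=> mg g0; apply: integral_density. Qed.

End density_measure.

Section density_probability.
Local Open Scope ereal_scope.
Context d (T : measurableType d) (R : realType) (mu : {measure set T -> \bar R}).
Variable f : T -> R.
Hypotheses (mf : measurable_fun setT f) (f0 : forall x, (0 <= f x)%R).
Hypothesis f1 : \int[mu]_x (f x)%:E = 1.

Definition dens of \int[mu]_x (f x)%:E = 1 := dens_measure mu mf f0.

Let P := dens f1.

HB.instance Definition _ := Measure.on P.

Let P1 : P setT = 1. Proof. exact: f1. Qed.

HB.instance Definition _ := @Measure_isProbability.Build _ _ R P P1.
End density_probability.

Section uniform.
Local Open Scope ereal_scope.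
Context (R : realType).
Local Notation leb := (@lebesgue_measure R).

Let u01 (x : measurableTypeR R) : R := \1_(`]0%R, 1%R[%classic : set R) x.

Let mu01 : measurable_fun setT u01. Proof. exact: measurable_indic. Qed.
Let u010 x : (0 <= u01 x)%R. Proof. by rewrite /u01 indicE. Qed.
Let u011 : \int[leb]_x (u01 x)%:E = 1.
Proof.
rewrite integral_indic// setIT; have := @lebesgue_measure_itv R `]0%R, 1%R[.
by rewrite /= lte_fin ltr01 -EFinB subr0.
Qed.

Definition unif : probability (measurableTypeR R) R := dens mu01 u010 u011.

Lemma integral_unif (g : R -> \bar R) : measurable_fun setT g ->
  (forall x, 0 <= g x) -> \int[unif]_x g x = \int[leb]_(x in `]0%R, 1%R[) g x.
Proof.
move=> mg g0; rewrite [LHS]integral_dens// [RHS]integral_mkcond.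
apply: eq_integral => x _; rewrite patchE /u01 indicE.
by case: ifPn => _; rewrite ?mule1 ?mule0.
Qed.

Lemma unifE (A : set R) : measurable A -> unif A = leb (`]0%R, 1%R[ `&` A).
Proof.
move=> mA; rewrite -[LHS]mul1e -integral_cst// integral_mkcond.
rewrite integral_unif; [|exact/(measurable_restrictT _ mA)|by move=> x; rewrite patchE; case: ifP].
rewrite -integral_mkcondr; under eq_integral do rewrite -[1]/(1%:E).
by rewrite integral_cst ?mul1e//; exact: measurableI.
Qed.

Lemma le_integral_unif (g h : R -> \bar R) :
  measurable_fun setT g -> measurable_fun setT h ->
  (forall x, 0 <= g x) -> (forall x, 0 <= h x) ->
  (forall x, (0 < x < 1)%R -> g x <= h x) -> \int[unif]_x g x <= \int[unif]_x h x.
Proof.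
move=> mg mh g0 h0 gh; rewrite !integral_unif//; apply: ge0_le_integral => //.
- exact: measurable_funTS.
- exact: measurable_funTS.
Qed.

End uniform.

Section quantile.
Local Open Scope ereal_scope.
Context (R : realType).
Local Notation leb := (@lebesgue_measure R).

(* Probability densities that are everywhere positive: their distribution
   functions are increasing bijections onto the open unit interval. *)
Definition pdensity (f : measurableTypeR R -> R) := [/\ measurable_fun setT f,
  (forall x, (0 < f x)%R) & \int[leb]_x (f x)%:E = 1].

Definition cdfd (f : measurableTypeR R -> R) (s : R) : R := fine (\int[leb]_(x in `]-oo, s]) (f x)%:E).

(** The value 0 off the open unit interval is arbitrary: it keeps the function total and measurable,
    and the uniform law does not see it. *)
Definition quantile (f : measurableTypeR R -> R) (u : R) : R :=
  if (0 < u < 1)%R then inf [set s | (u <= cdfd f s)%R] else 0%R.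

Section one_density.
Variable f : measurableTypeR R -> R.
Hypothesis pf : pdensity f.

Let mf : measurable_fun setT f. Proof. by case: pf. Qed.
Let f0 x : (0 < f x)%R. Proof. by case: pf. Qed.
Let f0' x : (0 <= f x)%R. Proof. exact: ltW. Qed.
Let f1 : \int[leb]_x (f x)%:E = 1. Proof. by case: pf. Qed.
Let mf' : measurable_fun setT (EFin \o f). Proof. exact/measurable_EFinP. Qed.
Let P : probability (measurableTypeR R) R := dens mf f0' f1.

Let idTR : measurableTypeR R -> R := idfun.

#[local] HB.instance Definition _ :=
  @isMeasurableFun.Build _ _ _ _ idTR (@measurable_id _ _ setT).

Let X : {RV P >-> R} := idTR.

Let cdfE s : cdf X s = P `]-oo, s]%classic. Proof. by []. Qed.

Lemma cdfdE s : (cdfd f s)%:E = \int[leb]_(x in `]-oo, s]) (f x)%:E.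
Proof.
rewrite /cdfd fineK//.
by rewrite -[X in X \is a _]/(P `]-oo, s]%classic); exact: fin_num_measure.
Qed.

Lemma cdfd_lt s t : (s < t)%R -> (cdfd f s < cdfd f t)%R.
Proof.
move=> st; rewrite -lte_fin !cdfdE.
rewrite (_ : `]-oo, t]%classic = `]-oo, s] `|` `]s, t]); last first.
  apply/seteqP; split=> x /=; rewrite !in_itv/=.
    by case: (leP x s) => _ xt; [left|right].
  by move=> [xs|/andP[//]]; exact: le_trans xs (ltW st).
rewrite ge0_integral_setU//; last 3 first.
- exact: measurable_funTS.
- by move=> x _; rewrite lee_fin.
- by apply/disj_setPS => x []; rewrite /= !in_itv/= => xs /andP[/(le_lt_trans xs)]; rewrite ltxx.
rewrite -[ltLHS]adde0 lteD2lE; last by rewrite -cdfdE.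
apply: integral_gt0 => //; first exact: measurable_funTS.
- by move=> x _; rewrite lte_fin.
- have := @lebesgue_measure_itv R `]s, t]; rewrite /= lte_fin st => ->.
  by rewrite -EFinB lte_fin subr_gt0.
Qed.

Lemma cdfd_le s t : (s <= t)%R -> (cdfd f s <= cdfd f t)%R.
Proof. by rewrite le_eqVlt => /predU1P[->//|/cdfd_lt/ltW]. Qed.

Let cdfdP s : cdf X s = (cdfd f s)%:E. Proof. by rewrite cdfE cdfdE. Qed.

(** The infimum runs over a nonempty set bounded below because distribution functions tend to 1 and
    0, and it is attained because they are right continuous. Monotonicity, measurability and law of
    the quantiles are all read off this Galois connection. *)
Lemma quantile_le u s : (0 < u < 1)%R -> (quantile f u <= s)%R = (u <= cdfd f s)%R.
Proof.
move=> u01; rewrite /quantile u01; case/andP: u01 => u0 u1.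
set A := [set s | _].
have A0 : A !=set0.
  have /fine_cvgP[_] := cvg_cdfy1 X.
  move=> /cvgrPdist_lt /(_ (1 - u)%R); rewrite subr_gt0 => /(_ u1) [M [_ /(_ (M + 1)%R)]].
  rewrite ltrDl ltr01 => /(_ isT) h.
  have {}h : (`|1 - fine (cdf X (M + 1)%R)| < 1 - u)%R by exact: h.
  rewrite cdfdP/= in h; exists (M + 1)%R; rewrite /A/=.
  by have [] := ltr_normlP _ _ h; lra.
have hlA : has_lbound A.
  have /fine_cvgP[_] := cvg_cdfNy0 X.
  move=> /cvgrPdist_lt /(_ u u0) [M [_ /(_ (M - 1)%R)]].
  rewrite gtrBl ltr01 => /(_ isT) h.
  have {}h : (`|0 - fine (cdf X (M - 1)%R)| < u)%R by exact: h.
  rewrite cdfdP/= in h; exists (M - 1)%R => t At.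
  rewrite leNgt; apply/negP => /cdfd_lt; have [] := ltr_normlP _ _ h; move: At; rewrite /A/=; lra.
apply/idP/idP => [|us]; last exact: ge_inf.
move=> infs; rewrite -lee_fin -cdfdP.
have rc : cdf X t @[t --> s^'+] --> cdf X s by exact: cdf_right_continuous.
apply: (cvge_ge _ rc).
near=> t; rewrite cdfdP lee_fin.
have [a Aa at_] : exists2 a, A a & (a < t)%R.
  by apply: inf_lt => //; apply: le_lt_trans infs _.
by rewrite (le_trans Aa)// cdfd_le// ltW.
Unshelve. all: by end_near. Qed.

Lemma quantile_homo u v : (0 < u < 1)%R -> (0 < v < 1)%R -> (u <= v)%R ->
  (quantile f u <= quantile f v)%R.
Proof.
by move=> u01 v01 uv; rewrite quantile_le// (le_trans uv)// -quantile_le.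
Qed.

Lemma cdfd_gt0 s : (0 < cdfd f s)%R.
Proof.
rewrite -lte_fin cdfdE; apply: integral_gt0 => //; first exact: measurable_funTS.
  by move=> x _; rewrite lte_fin.
by have := @lebesgue_measure_itv R `]-oo, s]; rewrite /= ltNyr => ->; rewrite ltry.
Qed.

Lemma cdfd_lt1 s : (cdfd f s < 1)%R.
Proof.
rewrite (lt_le_trans (cdfd_lt (_ : s < s + 1)%R)) ?ltrDl//.
by rewrite -lee_fin cdfdE; exact: (@probability_le1 _ _ _ P).
Qed.

End one_density.

Section family.
Context d (T : measurableType d) (f : T -> measurableTypeR R -> R).
Hypothesis mf : measurable_fun setT (fun p : T * measurableTypeR R => f p.1 p.2).
Hypothesis pf : forall t, pdensity (f t).

Lemma measurable_cdfd s : measurable_fun setT (fun t => cdfd (f t) s).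
Proof.
apply/measurable_EFinP; rewrite (_ : _ \o _ = fubini_F leb
    (fun p => (f p.1 p.2)%:E * (\1_(`]-oo, s]%classic : set R) p.2)%:E)); last first.
  apply/funext => t; rewrite /= cdfdE// /fubini_F/= integral_mkcond.
  apply: eq_integral => x _; rewrite patchE indicE.
  by case: ifPn => _; rewrite ?mule1 ?mule0.
apply: measurable_fun_fubini_tonelli_F => [|p]; last first.
  by rewrite mule_ge0// lee_fin; case: (pf p.1) => _ /(_ p.2)/ltW.
apply: emeasurable_funM; first exact/measurable_EFinP.
apply/measurable_EFinP.
exact: (measurableT_comp (measurable_indic (measurable_itv _)) measurable_snd).
Qed.

(** Joint measurability in the parameter and the level. By the Galois connection a superlevel set is
    a comparison of the distribution function at [s] with the level, apart from the arbitrary values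
    off ]0, 1[. *)
Lemma measurable_quantile :
  measurable_fun setT (fun p : T * measurableTypeR R => quantile (f p.1) p.2).
Proof.
pose q0 (p : T * measurableTypeR R) := (0 < p.2 < 1)%R.
have mq0 : measurable_fun setT q0.
  by apply: measurable_and; apply: measurable_fun_ltr.
apply: (measurability _ (RGenOInfty.measurableE R)) => //= _ [_ [s ->] <-].
rewrite setTI (_ : _ @^-1` _ = ([set p | q0 p] `&` [set p | (cdfd (f p.1) s < p.2)%R])
    `|` (~` [set p | q0 p] `&` [set p | (s < 0)%R])); last first.
  apply/seteqP; split=> p; rewrite /= in_itv/= andbT /q0; case: (boolP (0 < p.2 < 1)%R) => p01.
  - by rewrite ltNge quantile_le// -ltNge => h; left.
  - by rewrite /quantile (negbTE p01) => h; right.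
  - by move=> [[_]|[]//]; rewrite ltNge -quantile_le// -ltNge.
  - by move=> [[]//|[_]]; rewrite /quantile (negbTE p01).
have mQ : measurable [set p | q0 p].
  by rewrite -[X in measurable X]setTI; exact: (mq0 measurableT [set true]).
apply: measurableU; apply: measurableI => //.
- rewrite -[X in measurable X]setTI.
  apply: (_ : measurable_fun setT (fun p : T * measurableTypeR R => (cdfd (f p.1) s < p.2)%R)) => //.
  apply: measurable_fun_ltr => //.
  exact: (measurableT_comp (measurable_cdfd s) measurable_fst).
- exact: measurableC.
- by case: (s < 0)%R; [rewrite (_ : [set _ | _] = setT)|rewrite (_ : [set _ | _] = set0)] => //; apply/seteqP; split.
Qed.

End family.

End quantile.

Lemma measurable_inv_pos d (T : measurableType d) (R : realType) (f : T -> R) :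
  measurable_fun setT f -> (forall x, 0 < f x) ->
  measurable_fun setT (fun x => (f x)^-1).
Proof.
move=> mf f0; rewrite (_ : (fun _ => _) = fun x => expR (- ln (f x))).
  apply: measurableT_comp => //; apply: measurableT_comp => //.
  exact: measurableT_comp (@measurable_ln R) mf.
by apply/funext => x; rewrite expRN lnK// posrE.
Qed.

Section quantile_law.
Local Open Scope ereal_scope.
Context (R : realType).
Local Notation leb := (@lebesgue_measure R).

(** The rays are stable under intersection and generate the Borel sets; those starting at the
    nonpositive integers exhaust the line with finite measure. *)
Lemma eq_measure_itvoy (m1 m2 : {measure set (measurableTypeR R) -> \bar R}) :
  (forall s, m1 `]s, +oo[%classic < +oo) ->
  (forall s, m1 `]s, +oo[%classic = m2 `]s, +oo[%classic) ->
  forall A, measurable A -> m1 A = m2 A.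
Proof.
move=> m1oo m12 A mA.
apply: (@measure_unique _ R (measurableTypeR R) (@RGenOInfty.G R)
  (fun k : nat => `](- k%:R)%R, +oo[%classic)) => //.
- exact: RGenOInfty.measurableE.
- move=> _ _ [x ->] [y ->]; exists (Num.max x y); apply/seteqP.
  by split=> z; rewrite /= !in_itv/= !andbT gt_max; [move=> [-> ->]|move=> /andP[]].
- by move=> k; exists (- k%:R)%R.
- rewrite -subTset => x _; exists (Num.truncn `|x|).+1 => //=.
  by rewrite in_itv/= andbT ltrNl (le_lt_trans (ler_norm _))// normrN truncnS_gt.
- by move=> _ [s ->].
Qed.

Variable f : measurableTypeR R -> R.
Hypothesis pf : pdensity f.

Let mf : measurable_fun setT f. Proof. by case: pf. Qed.
Let f0 x : (0 < f x)%R. Proof. by case: pf. Qed.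
Let f0' x : (0 <= f x)%R. Proof. exact: ltW. Qed.
Let f1 : \int[leb]_x (f x)%:E = 1. Proof. by case: pf. Qed.

Lemma measurable_quantile1 : measurable_fun setT (quantile f).
Proof.
(* A single density is a family indexed by a point. *)
have mf2 : measurable_fun setT (fun p : unit * measurableTypeR R => (fun _ : unit => f) p.1 p.2).
  exact: (measurableT_comp mf measurable_snd).
have := measurable_quantile mf2 (fun=> pf) => mq.
have mp : measurable_fun setT (fun u : measurableTypeR R => (tt, u)).
  exact: pair1_measurable.
exact: (measurableT_comp mq mp).
Qed.

(** The levels whose quantile lies beyond [s] are those between [cdfd f s] and 1, so the image of
    the uniform law and the measure of density [f] agree on every ray. *)
Lemma integral_quantile (h : R -> \bar R) :
  measurable_fun setT h -> (forall x, 0 <= h x) ->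
  \int[@unif R]_u h (quantile f u) = \int[leb]_s (h s * (f s)%:E).
Proof.
move=> mh h0; rewrite -(integral_dens leb mf f0')//.
pose mQ := isMeasurableFun.Build _ _ (measurableTypeR R) (measurableTypeR R) _ measurable_quantile1.
pose Q : {mfun measurableTypeR R >-> measurableTypeR R} := HB.pack (quantile f) mQ.
rewrite -[LHS]/(\int[@unif R]_u (h \o Q) u) -ge0_integral_distribution//.
apply: eq_measure_integral => A mA _; apply: eq_measure_itvoy => // s.
  by apply: (le_lt_trans (probability_le1 _ _)) => //; rewrite ltry.
rewrite /distribution/= /pushforward unifE; last first.
  rewrite -[X in measurable X]setTI.
  exact: (measurable_quantile1 measurableT (measurable_itv `]s, +oo[)).
rewrite (_ : _ `&` _ = `](cdfd f s), 1%R[%classic); last first.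
  apply/seteqP; split=> u /=; rewrite !in_itv/= andbT.
    by move=> [u01]; rewrite ltNge quantile_le// -ltNge => ->; case/andP: u01.
  move=> /andP[su u1]; have u01 : (0 < u < 1)%R by rewrite u1 (lt_trans (cdfd_gt0 pf s)).
  by rewrite u01; split=> //; rewrite ltNge quantile_le// -ltNge.
have := @lebesgue_measure_itv R `](cdfd f s), 1%R[.
rewrite /= lte_fin cdfd_lt1// => ->.
transitivity (dens mf f0' f1 `]s, +oo[%classic) => //.
rewrite -setCitvl probability_setC// EFinN; congr (1 - _); exact: cdfdE.
Qed.

(** [(f (quantile f u))^-1] stands for the derivative of the quantile function, so its integral over
    [J] is a length inside [a, b]. Passing to the law of density [f] cancels the factor and spares
    any differentiation. *)
Lemma integral_inv_quantile (J : set R) (a b : R) : measurable J ->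
  J `<=` `]0%R, 1%R[ -> (a <= b)%R ->
  (forall u, J u -> (a <= quantile f u <= b)%R) ->
  \int[@unif R]_u ((\1_J u)%:E * ((f (quantile f u))^-1)%:E) <= (b - a)%:E.
Proof.
move=> mJ J01 ab JQ.
pose h (s : measurableTypeR R) := (\1_(`[a, b]%classic : set R) s)%:E * ((f s)^-1)%:E.
have mI : measurable_fun setT (fun s : measurableTypeR R => (f s)^-1%R) by exact: measurable_inv_pos.
have mh : measurable_fun setT h.
  by apply: emeasurable_funM; apply/measurable_EFinP => //; exact: measurable_indic.
have h0 s : 0 <= h s by rewrite mule_ge0// lee_fin invr_ge0.
apply: (@le_trans _ _ (\int[@unif R]_u h (quantile f u))).
  apply: ge0_le_integral => //.
  - by move=> u _; rewrite mule_ge0// lee_fin invr_ge0.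
  - apply: emeasurable_funM; apply/measurable_EFinP; first exact: measurable_indic.
    exact: (measurableT_comp mI measurable_quantile1).
  - exact: (measurableT_comp mh measurable_quantile1).
  - move=> u _; rewrite /h lee_pmul2r ?lte_fin ?invr_gt0// lee_fin !indicE.
    have [uJ|] := boolP (u \in J); last by rewrite ler_nat.
    by rewrite mem_set//= in_itv/= JQ// -inE.
rewrite integral_quantile//.
rewrite [leLHS](_ : _ = \int[leb]_s (\1_(`[a, b]%classic : set R) s)%:E); last first.
  by apply: eq_integral => s _; rewrite /h -!EFinM -mulrA mulVf ?mulr1// gt_eqF.
rewrite integral_indic// setIT.
have := @lebesgue_measure_itv R `[a, b]; rewrite /= => ->.
by rewrite lte_fin; case: ifPn => // _; rewrite lee_fin subr_ge0.
Qed.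

End quantile_law.

Section convex_combination.
Context (R : realFieldType).
Implicit Types l x y c e : R.

Lemma ler_conv_sub l x y x' y' (X Y X' Y' : R) : 0 < l -> l < 1 ->
  x <= X -> y <= Y -> X' <= x' -> Y' <= y' ->
  (1 - l) * (x - x') + l * (y - y') <= ((1 - l) * X + l * Y) - ((1 - l) * X' + l * Y').
Proof.
move=> l0 l1 xX yY xX' yY'; have l1' : 0 <= 1 - l by rewrite subr_ge0 ltW.
have h1 := ler_wpM2l l1' xX; have h2 := ler_wpM2l (ltW l0) yY.
have h3 := ler_wpM2l l1' xX'; have h4 := ler_wpM2l (ltW l0) yY'.
lra.
Qed.

Lemma ler_sub_div k x y c : 0 < k -> k * (x - y) <= c -> x <= c / k + y.
Proof. by move=> k0 h; rewrite -lerBlDr ler_pdivlMr// mulrC. Qed.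

(** Meant for suprema [a], [b] and infima [a'], [b'] that are approached but perhaps not
    attained. *)
Lemma ler_conv_approx l c (a b a' b' : R) : 0 < l -> l < 1 ->
  (forall e, 0 < e -> exists x x' y y', [/\ a - e < x, x' < a' + e, b - e < y,
    y' < b' + e & (1 - l) * (x - x') + l * (y - y') <= c]) ->
  (1 - l) * (a - a') + l * (b - b') <= c.
Proof.
move=> l0 l1 h; apply/ler_addgt0Pr => e e0.
have [x [x' [y [y' [ax xa by_ yb xy]]]]] := h _ (divr_gt0 e0 (ltr0Sn _ 1)).
have := @ler_conv_sub l (a - e / 2) (b - e / 2) (a' + e / 2) (b' + e / 2) x y x' y'
  l0 l1 (ltW ax) (ltW by_) (ltW xa) (ltW yb).
lra.
Qed.

End convex_combination.

(** * Monotone transport on the line *)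

Section monotone_transport.
Local Open Scope ereal_scope.
Context (R : realType).
Local Notation leb := (@lebesgue_measure R).

(** Lebesgue measure is an infimum over countable covers by half-open intervals, so comparing
    intervals is enough. *)
Lemma le_lebesgue_measure (m : {measure set (measurableTypeR R) -> \bar R}) :
  (forall a b, (a <= b)%R -> m `]a, b]%classic <= (b - a)%:E) ->
  forall A, measurable A -> m A <= leb A.
Proof.
move=> mab A mA; apply: le_ereal_inf_tmp => _ [F [mF AF] <-].
apply: (@le_trans _ _ (\sum_(k <oo) m (F k))).
  apply: measure_sigma_subadditive => // k.
  by apply: sub_sigma_algebra; exact: mF.
apply: lee_nneseries => [k _//|k _].
have [[a b] _ <-] := mF k.
have [ab|ba] := leP a b; last by rewrite set_itv_ge ?measure0// bnd_simp -leNgt ltW.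
by rewrite /= wlength_itv_bnd//= mab.
Qed.

Variables (f g : measurableTypeR R -> R) (l : R).
Hypotheses (pf : pdensity f) (pg : pdensity g) (l0 : (0 < l)%R) (l1 : (l < 1)%R).

Let T u : R := ((1 - l) * quantile f u + l * quantile g u)%R.
(** Weighted geometric mean of the formal derivatives of the two quantile functions. That of [T] is
    their arithmetic mean, hence larger. *)
Let w u : R := expR (- ((1 - l) * ln (f (quantile f u)) + l * ln (g (quantile g u)))).

Let mqf := measurable_quantile1 pf.
Let mqg := measurable_quantile1 pg.

Let mT : measurable_fun setT (T : measurableTypeR R -> measurableTypeR R).
Proof. by apply: measurable_funD; exact: measurable_funM. Qed.

Let mw : measurable_fun setT (w : measurableTypeR R -> R).
Proof.
have [mf _ _] := pf; have [mg _ _] := pg.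
apply: measurableT_comp => //; apply: measurableT_comp => //.
apply: measurable_funD; apply: measurable_funM => //.
- exact: measurableT_comp (@measurable_ln R) (measurableT_comp mf mqf).
- exact: measurableT_comp (@measurable_ln R) (measurableT_comp mg mqg).
Qed.

Let w0 u : (0 <= w u)%R. Proof. exact: expR_ge0. Qed.

Let w_le u : (w u <= (1 - l) * (f (quantile f u))^-1 + l * (g (quantile g u))^-1)%R.
Proof.
have [_ f0 _] := pf; have [_ g0 _] := pg.
rewrite /w opprD -!mulrN (le_trans (expR_conv _ _ (ltW l0) (ltW l1)))//.
by rewrite !expRN !lnK ?posrE.
Qed.

(** If [T] were differentiable this would follow from w <= T'. Instead, the images of [J] under the
    two quantile functions are measured: their lengths, averaged with weights 1 - l and l, fit
    within b - a. *)
Let transport_itv a b : (a <= b)%R ->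
  \int[@unif R]_u ((\1_(`]0%R, 1%R[ `&` T @^-1` `]a, b]) u)%:E * (w u)%:E) <= (b - a)%:E.
Proof.
move=> ab; set J := _ `&` _.
have mJ : measurable J.
  apply: measurableI => //; rewrite -[X in measurable X]setTI.
  exact: (mT measurableT (measurable_itv `]a, b])).
have [->|/set0P[u0 Ju0]] := eqVneq J set0.
  rewrite integral0_eq ?lee_fin ?subr_ge0// => u _.
  by rewrite indic0 mul0e.
have J01 u : J u -> (0 < u < 1)%R by move=> [].
have Jab u v : J u -> J v -> (T u - T v <= b - a)%R.
  by move=> [_ /=]; rewrite in_itv/= => /andP[_ ub] [_ /=]; rewrite in_itv/= => /andP[av _]; rewrite lerB// ltW.
(* Four unrelated points reduce to two: both quantile functions are nondecreasing, and maxima and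
   minima of points of [J] stay in [J]. Hence the two oscillations are controlled jointly although
   their extrema are taken separately. *)
have Jcross u u' v v' : J u -> J u' -> J v -> J v' ->
  ((1 - l) * (quantile f u - quantile f u') + l * (quantile g v - quantile g v') <= b - a)%R.
  move=> Ju Ju' Jv Jv'.
  pose M := Num.max u v; pose m := Num.min u' v'.
  have JM : J M by rewrite /M; case: leP.
  have Jm : J m by rewrite /m; case: leP.
  apply: le_trans (Jab _ _ JM Jm).
  have hM1 : (quantile f u <= quantile f M)%R by rewrite quantile_homo ?J01// le_max lexx.
  have hM2 : (quantile g v <= quantile g M)%R by rewrite quantile_homo ?J01// le_max lexx orbT.
  have hm1 : (quantile f m <= quantile f u')%R by rewrite quantile_homo ?J01// ge_min lexx.
  have hm2 : (quantile g m <= quantile g v')%R by rewrite quantile_homo ?J01// ge_min lexx orbT.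
  exact: ler_conv_sub.
pose F := quantile f @` J; pose G := quantile g @` J.
have Fne : F !=set0 by exists (quantile f u0), u0.
have Gne : G !=set0 by exists (quantile g u0), u0.
have l1' : (0 < 1 - l)%R by rewrite subr_gt0.
have ubF : has_ubound F.
  exists ((b - a) / (1 - l) + quantile f u0)%R => _ [u Ju <-].
  apply: ler_sub_div => //; have := Jcross _ _ _ _ Ju Ju0 Ju0 Ju0.
  by rewrite (subrr (quantile g u0)) mulr0 addr0.
have lbF : has_lbound F.
  exists (quantile f u0 - (b - a) / (1 - l))%R => _ [u Ju <-].
  rewrite lerBlDl; apply: ler_sub_div => //; have := Jcross _ _ _ _ Ju0 Ju Ju0 Ju0.
  by rewrite (subrr (quantile g u0)) mulr0 addr0.
have ubG : has_ubound G.
  exists ((b - a) / l + quantile g u0)%R => _ [u Ju <-].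
  apply: ler_sub_div => //; have := Jcross _ _ _ _ Ju0 Ju0 Ju Ju0.
  by rewrite (subrr (quantile f u0)) mulr0 add0r.
have lbG : has_lbound G.
  exists (quantile g u0 - (b - a) / l)%R => _ [u Ju <-].
  rewrite lerBlDl; apply: ler_sub_div => //; have := Jcross _ _ _ _ Ju0 Ju0 Ju0 Ju.
  by rewrite (subrr (quantile f u0)) mulr0 add0r.
have supinf : ((1 - l) * (sup F - inf F) + l * (sup G - inf G) <= b - a)%R.
  apply: ler_conv_approx => // e e0.
  have [_ [u Ju <-] hu] := sup_adherent e0 (conj Fne ubF).
  have [_ [u' Ju' <-] hu'] := inf_adherent e0 (conj Fne lbF).
  have [_ [v Jv <-] hv] := sup_adherent e0 (conj Gne ubG).
  have [_ [v' Jv' <-] hv'] := inf_adherent e0 (conj Gne lbG).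
  exists (quantile f u), (quantile f u'), (quantile g v), (quantile g v').
  by split; [exact: hu|exact: hu'|exact: hv|exact: hv'|exact: Jcross].
have [mf f0 _] := pf; have [mg g0 _] := pg.
have mfI : measurable_fun setT (fun u : measurableTypeR R => (f (quantile f u))^-1%R).
  by apply: measurable_inv_pos => //; exact: measurableT_comp mf mqf.
have mgI : measurable_fun setT (fun u : measurableTypeR R => (g (quantile g u))^-1%R).
  by apply: measurable_inv_pos => //; exact: measurableT_comp mg mqg.
have m1J : measurable_fun setT (fun u : measurableTypeR R => (\1_J u)%:E : \bar R).
  by apply/measurable_EFinP; exact: measurable_indic.
have m1 : measurable_fun setT (fun u : measurableTypeR R => (\1_J u)%:E * ((f (quantile f u))^-1)%:E).
  by apply: emeasurable_funM => //; exact/measurable_EFinP.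
have m2 : measurable_fun setT (fun u : measurableTypeR R => (\1_J u)%:E * ((g (quantile g u))^-1)%:E).
  by apply: emeasurable_funM => //; exact/measurable_EFinP.
have p1 u : 0 <= (\1_J u)%:E * ((f (quantile f u))^-1)%:E.
  by rewrite mule_ge0// lee_fin invr_ge0 ltW.
have p2 u : 0 <= (\1_J u)%:E * ((g (quantile g u))^-1)%:E.
  by rewrite mule_ge0// lee_fin invr_ge0 ltW.
apply: (@le_trans _ _ (\int[@unif R]_u ((1 - l)%:E * ((\1_J u)%:E * ((f (quantile f u))^-1)%:E)
   + l%:E * ((\1_J u)%:E * ((g (quantile g u))^-1)%:E)))).
  apply: ge0_le_integral => //.
  - by move=> u _; rewrite mule_ge0// lee_fin.
  - by apply: emeasurable_funM => //; exact/measurable_EFinP.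
  - by apply: emeasurable_funD; exact: measurable_funeM.
  - move=> u _; rewrite -!EFinM -EFinD lee_fin.
    rewrite mulrCA [X in (_ <= _ + X)%R]mulrCA -mulrDr ler_wpM2l//.
rewrite ge0_integralD//; last 4 first.
- by move=> u _; rewrite mule_ge0// lee_fin ltW.
- exact: measurable_funeM.
- by move=> u _; rewrite mule_ge0// lee_fin ltW.
- exact: measurable_funeM.
rewrite ge0_integralZl_EFin//; last exact: ltW.
rewrite ge0_integralZl_EFin//; last exact: ltW.
apply: (@le_trans _ _ ((1 - l)%:E * (sup F - inf F)%:E + l%:E * (sup G - inf G)%:E)); last first.
  by rewrite -!EFinM -EFinD lee_fin.
apply: leeD; rewrite lee_pmul2l ?lte_fin//; apply: integral_inv_quantile => //.
- by apply: (@le_trans _ _ (quantile f u0)); [apply: ge_inf => //; exists u0|apply: ub_le_sup => //; exists u0].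
- by move=> u Ju; apply/andP; split; [apply: ge_inf => //; exists u|apply: ub_le_sup => //; exists u].
- by apply: (@le_trans _ _ (quantile g u0)); [apply: ge_inf => //; exists u0|apply: ub_le_sup => //; exists u0].
- by move=> u Ju; apply/andP; split; [apply: ge_inf => //; exists u|apply: ub_le_sup => //; exists u].
Qed.

(* The weight dominates the inverse of the derivative of the map T *)
Lemma monotone_transport_le (h : R -> \bar R) :
  measurable_fun setT h -> (forall x, 0 <= h x) ->
  \int[@unif R]_u (h ((1 - l) * quantile f u + l * quantile g u)%R *
    (expR (- ((1 - l) * ln (f (quantile f u)) + l * ln (g (quantile g u)))))%:E) <=
  \int[leb]_x h x.
Proof.
move=> mh h0.
pose nu : {measure set (measurableTypeR R) -> \bar R} :=
  measure_function_pushforward__canonical__measure_function_Measure (dens_measure (@unif R) mw w0) mT.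
have -> : \int[@unif R]_u (h ((1 - l) * quantile f u + l * quantile g u)%R *
    (expR (- ((1 - l) * ln (f (quantile f u)) + l * ln (g (quantile g u)))))%:E) = \int[nu]_x h x.
  rewrite (ge0_integral_pushforward mT)//= preimage_setT.
  by rewrite (integral_dens (@unif R) mw w0)//; exact: (measurableT_comp mh mT).
apply: ge0_le_measure_integral => //; apply: le_lebesgue_measure => a b ab.
apply: le_trans (transport_itv ab).
have -> : nu `]a, b]%classic = \int[@unif R]_(x in T @^-1` `]a, b]) (w x)%:E by [].
rewrite [leLHS]integral_mkcond.
have mJ : measurable (T @^-1` `]a, b]).
  rewrite -[X in measurable X]setTI.
  exact: (mT measurableT (measurable_itv `]a, b])).
have mw' : measurable_fun setT (fun u : measurableTypeR R => (w u)%:E).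
  exact/measurable_EFinP.
apply: (@le_integral_unif R ((fun u => (w u)%:E) \_ (T @^-1` `]a, b]))
  (fun u => (\1_(`]0%R, 1%R[ `&` T @^-1` `]a, b]) u)%:E * (w u)%:E)).
- apply/(measurable_restrictT _ mJ); exact: (measurable_funTS mw').
- apply: emeasurable_funM; last exact: mw'.
  by apply/measurable_EFinP; apply: measurable_indic; exact: measurableI.
- by move=> x; rewrite patchE; case: ifP => // _; rewrite lee_fin.
- by move=> x; apply: mule_ge0; rewrite lee_fin.
- move=> x x01; rewrite patchE indicE in_setI.
  have -> : (x \in `]0%R, 1%R[%classic) by rewrite inE/= in_itv.
  by case: ifP => _; rewrite ?mul1e ?mul0e.
Qed.

End monotone_transport.

(** * Knothe's rearrangement *)

Section integral_scale.
Local Open Scope ereal_scope.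
Context d (T : measurableType d) (R : realType) (mu : {measure set T -> \bar R}).

Lemma integral_scalel (k : R) (f : T -> \bar R) : (0 <= k)%R ->
  measurable_fun setT f -> (forall x, 0 <= f x) ->
  \int[mu]_x (k%:E * f x) = k%:E * \int[mu]_x f x.
Proof. by move=> k0 mf f0; rewrite ge0_integralZl_EFin. Qed.

Lemma integral_scaler (k : R) (f : T -> \bar R) : (0 <= k)%R ->
  measurable_fun setT f -> (forall x, 0 <= f x) ->
  \int[mu]_x (f x * k%:E) = (\int[mu]_x f x) * k%:E.
Proof.
by move=> k0 mf f0; under eq_integral do rewrite muleC; rewrite integral_scalel// muleC.
Qed.

Lemma integral_le (f g : T -> \bar R) :
  measurable_fun setT f -> measurable_fun setT g -> (forall x, 0 <= f x) ->
  (forall x, f x <= g x) -> \int[mu]_x f x <= \int[mu]_x g x.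
Proof. by move=> mf mg f0 fg; apply: ge0_le_integral. Qed.

Lemma integral_add (f g : T -> \bar R) :
  measurable_fun setT f -> measurable_fun setT g -> (forall x, 0 <= f x) ->
  (forall x, 0 <= g x) -> \int[mu]_x (f x + g x) = \int[mu]_x f x + \int[mu]_x g x.
Proof. by move=> mf mg f0 g0; rewrite ge0_integralD. Qed.

End integral_scale.

Section gaussian_domination.
Local Open Scope ereal_scope.
Context (R : realType).
Local Notation leb := (@lebesgue_measure R).

Lemma expR_sqr_integral_lty (k : R) : (0 < k)%R ->
  \int[leb]_s (expR (- (k * (s * s))))%:E < +oo.
Proof.
move=> k0; pose s := Num.sqrt (2 * k)^-1.
have s0 : (s != 0)%R by rewrite gt_eqF// sqrtr_gt0 invr_gt0 mulr_gt0.
have s2 : (s ^+ 2 = (2 * k)^-1)%R by rewrite sqr_sqrtr// invr_ge0 mulr_ge0// ltW.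
have p0 := normal_peak_gt0 s0.
rewrite (_ : (fun _ => _) = fun x => ((normal_peak s)^-1)%:E * (normal_pdf 0 s x)%:E); last first.
  apply/funext => x; rewrite normal_pdfE// -EFinM mulKf ?gt_eqF//.
  rewrite /normal_fun subr0 s2; congr (expR _)%:E; field; exact: lt0r_neq0.
rewrite integral_scalel.
- by rewrite integral_normal_pdf// mule1 ltry.
- by rewrite invr_ge0 ltW.
- by apply/measurable_EFinP; exact: measurable_normal_pdf.
- by move=> x; rewrite lee_fin normal_pdf_ge0.
Qed.

Lemma measurable_gauss n (k : R) :
  measurable_fun setT (fun x : 'rV[R]_n => (expR (- (k * dotp x x)))%:E).
Proof.
apply/measurable_EFinP; apply: measurableT_comp => //; apply: measurableT_comp => //.
by apply: measurable_funM => //; exact: measurable_dotp.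
Qed.

Lemma integral_gauss_lty n (k : R) : (0 < k)%R ->
  \int[@lebesgue_rV R n]_x (expR (- (k * dotp x x)))%:E < +oo.
Proof.
move=> k0; elim: n => [|n IH].
  by rewrite integral_rV0 ?ltry//; exact: measurable_gauss.
rewrite integral_rVS; [|exact: measurable_gauss|by move=> x; rewrite lee_fin expR_ge0].
under eq_integral do (under eq_integral do rewrite dotp_cons mulrDr opprD expRD EFinM;
  rewrite integral_scalel; [|exact: expR_ge0|exact: measurable_gauss|by move=> y; rewrite lee_fin expR_ge0]).
rewrite ge0_integralZr//.
- have e0 : 0 <= \int[leb]_s (expR (- (k * (s * s))))%:E.
    by apply: integral_ge0 => s _; rewrite lee_fin expR_ge0.
  apply: lte_mul_pinfty; [exact: e0|by rewrite ge0_fin_numE// expR_sqr_integral_lty|exact: IH].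
- apply/measurable_EFinP; apply: measurableT_comp => //; apply: measurableT_comp => //.
  by apply: measurable_funM => //; exact: measurable_funM.
- by apply: integral_ge0 => y _; rewrite lee_fin expR_ge0.
Qed.

Lemma lebesgue_rV_gt0 n : 0 < @lebesgue_rV R n setT.
Proof.
have h (m : nat) : 0 < \int[@lebesgue_rV R m]_x (cst 1 x).
  elim: m => [|m IH]; first by rewrite integral_rV0.
  rewrite integral_rVS//; apply: integral_gt0 => //.
  - exact: (measurable_slice (h := cst 1)).
  - have h : leb [set: R] = +oo.
      by have := @lebesgue_measure_itv R `]-oo, +oo[; rewrite set_itvNyy.
    by have : 0 < leb [set: R] by rewrite h.
by have := h n; rewrite integral_cst// mul1e.
Qed.

(** Integrability would pass only to almost every slice. A Gaussian bound passes to all of them with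
    the same rate, so slice masses are finite everywhere and no exceptional sets appear. *)
Definition gauss_dominated n (f : 'rV[R]_n -> R) :=
  exists2 k : R, (0 < k)%R &
  exists C : R, forall x, (f x <= C * expR (- (k * dotp x x)))%R.

Lemma integral_gauss_dominated_lty n (f : 'rV[R]_n -> R) :
  measurable_fun setT f -> (forall x, (0 <= f x)%R) -> gauss_dominated f ->
  \int[@lebesgue_rV R n]_x (f x)%:E < +oo.
Proof.
move=> mf f0 [k k0 [C fC]].
have C0 : (0 <= C)%R.
  by have := le_trans (f0 0%R) (fC 0%R); rewrite pmulr_lge0// expR_gt0.
apply: (@le_lt_trans _ _ (\int[@lebesgue_rV R n]_x (C%:E * (expR (- (k * dotp x x)))%:E))).
  apply: ge0_le_integral => //.
  - by move=> x _; rewrite lee_fin.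
  - exact/measurable_EFinP.
  - by apply: emeasurable_funM => //; exact: measurable_gauss.
  - by move=> x _; rewrite -EFinM lee_fin.
rewrite integral_scalel; [|exact: C0|exact: measurable_gauss|by move=> x; rewrite lee_fin expR_ge0].
by rewrite lte_mul_pinfty// integral_gauss_lty.
Qed.

Lemma gauss_dominated_slice n (f : 'rV[R]_n.+1 -> R) s : gauss_dominated f ->
  gauss_dominated (fun y => f (cons_rV (s, y))).
Proof.
move=> [k k0 [C fC]]; exists k => //; exists (C * expR (- (k * (s * s))))%R => y.
by rewrite -mulrA -expRD -opprD -mulrDr -dotp_cons.
Qed.

Lemma integral_posf_gt0 n (f : 'rV[R]_n -> R) : measurable_fun setT f ->
  (forall x, (0 < f x)%R) -> 0 < \int[@lebesgue_rV R n]_x (f x)%:E.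
Proof.
move=> mf f0; apply: integral_gt0 => //; first exact/measurable_EFinP.
- by move=> x _; rewrite lte_fin.
- exact: lebesgue_rV_gt0.
Qed.

End gaussian_domination.

Section knothe.
Local Open Scope ereal_scope.
Context (R : realType).
Local Notation leb := (@lebesgue_measure R).
Local Notation lam := (@lebesgue_rV R).

Definition gdensity n (f : 'rV[R]_n -> R) := [/\ measurable_fun setT f,
  (forall x, (0 < f x)%R), gauss_dominated f & \int[lam n]_x (f x)%:E = 1].

(** The weighted geometric mean of the inverses of [a] and [b]. Being multiplicative, it splits
    along marginal and conditional densities. *)
Definition interp_weight (l a b : R) : R := expR (- ((1 - l) * ln a + l * ln b)).

Lemma interp_weightM l a b c e : (0 < a)%R -> (0 < b)%R -> (0 < c)%R -> (0 < e)%R ->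
  interp_weight l (a * b) (c * e) = (interp_weight l a c * interp_weight l b e)%R.
Proof.
move=> a0 b0 c0 e0; rewrite /interp_weight -expRD !lnM ?posrE//.
by congr expR; ring.
Qed.

Lemma interp_weight_ge0 l a b : (0 <= interp_weight l a b)%R.
Proof. exact: expR_ge0. Qed.

Lemma measurable_interp_weight d (T : measurableType d) l (a b : T -> R) :
  measurable_fun setT a -> measurable_fun setT b ->
  measurable_fun setT (fun t => interp_weight l (a t) (b t)).
Proof.
move=> ma mb; apply: measurableT_comp => //; apply: measurableT_comp => //.
by apply: measurable_funD; apply: measurable_funM => //;
  exact: measurableT_comp (@measurable_ln R) _.
Qed.

Definition slice_mass n (f : 'rV[R]_n.+1 -> R) (s : measurableTypeR R) : R :=
  fine (\int[lam n]_y (f (cons_rV (s, y)))%:E).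

Definition slice_cond n (f : 'rV[R]_n.+1 -> R) (s : R) (y : 'rV[R]_n) : R :=
  ((slice_mass f s)^-1 * f (cons_rV (s, y)))%R.

Section one_slice.
Variables (n : nat) (f : 'rV[R]_n.+1 -> R).
Hypotheses (mf : measurable_fun setT f) (f0 : forall x, (0 < f x)%R).
Hypothesis df : gauss_dominated f.

Let mfs s : measurable_fun setT (fun y : 'rV[R]_n => f (cons_rV (s, y))).
Proof. by apply: measurableT_comp => //; exact: measurable_cons_rV_fun. Qed.

Lemma slice_massE s :
  (slice_mass f s)%:E = \int[lam n]_y (f (cons_rV (s, y)))%:E.
Proof.
rewrite /slice_mass fineK// ge0_fin_numE; last first.
  by apply: integral_ge0 => y _; rewrite lee_fin ltW.
apply: integral_gauss_dominated_lty => [|y|]; [exact: mfs|exact: ltW|].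
exact: gauss_dominated_slice.
Qed.

Lemma slice_mass_gt0 s : (0 < slice_mass f s)%R.
Proof. by rewrite -lte_fin slice_massE integral_posf_gt0. Qed.

Lemma slice_condK s y : (slice_mass f s * slice_cond f s y)%R = f (cons_rV (s, y)).
Proof. by rewrite /slice_cond mulVKf// gt_eqF// slice_mass_gt0. Qed.

Lemma slice_cond_gdensity s : gdensity (slice_cond f s).
Proof.
have m0 := slice_mass_gt0 s; split.
- exact: measurable_funM.
- by move=> y; rewrite mulr_gt0// invr_gt0.
- have [k k0 [C fC]] := gauss_dominated_slice s df.
  exists k => //; exists ((slice_mass f s)^-1 * C)%R => y.
  by rewrite -mulrA ler_pM2l// invr_gt0.
- under eq_integral do rewrite EFinM.
  rewrite integral_scalel.
  + by rewrite -slice_massE -EFinM mulVf// gt_eqF.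
  + by rewrite invr_ge0 ltW.
  + by apply/measurable_EFinP; exact: mfs.
  + by move=> y; rewrite lee_fin ltW.
Qed.

Lemma integral_slice_mass : \int[leb]_s (slice_mass f s)%:E = \int[lam n.+1]_x (f x)%:E.
Proof.
rewrite integral_rVS; [|exact/measurable_EFinP|by move=> x; rewrite lee_fin ltW].
by apply: eq_integral => s _; rewrite slice_massE.
Qed.

End one_slice.

Lemma measurable_slice_mass n d (T : measurableType d) (f : T -> 'rV[R]_n.+1 -> R) :
  measurable_fun setT (fun p : T * 'rV[R]_n.+1 => f p.1 p.2) ->
  (forall t x, (0 < f t x)%R) -> (forall t, gauss_dominated (f t)) ->
  measurable_fun setT (fun p : T * measurableTypeR R => slice_mass (f p.1) p.2).
Proof.
move=> mf f0 df; apply/measurable_EFinP.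
have mft t : measurable_fun setT (f t).
  have mp : measurable_fun setT (fun y : 'rV[R]_n.+1 => (t, y)) by exact: pair1_measurable.
  exact: (measurableT_comp mf mp).
rewrite (_ : _ \o _ = fubini_F (lam n)
    (fun q : (T * measurableTypeR R) * 'rV[R]_n => (f q.1.1 (cons_rV (q.1.2, q.2)))%:E)); last first.
  by apply/funext => p; rewrite /= slice_massE.
apply: measurable_fun_fubini_tonelli_F => [|q]; last by rewrite lee_fin ltW.
apply/measurable_EFinP.
have m1 : measurable_fun setT (fun q : (T * measurableTypeR R) * 'rV[R]_n =>
    (q.1.1, cons_rV (q.1.2, q.2))).
  apply/measurable_fun_pairP; split.
    exact: (measurableT_comp measurable_fst measurable_fst).
  apply: measurable_cons_rV_fun; last exact: measurable_snd.
  exact: (measurableT_comp measurable_snd measurable_fst).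
exact: (measurableT_comp mf m1).
Qed.

(* Knothe's rearrangement, with all the densities of a measurable family driven
   by the same randomness. *)
Definition knothe_coupling n d (T : measurableType d) (f : T -> 'rV[R]_n -> R)
    d' (Om : measurableType d') (P : probability Om R) (Phi : T * Om -> 'rV[R]_n) :=
  [/\ measurable_fun setT Phi,
      (forall t (h : 'rV[R]_n -> \bar R), measurable_fun setT h -> (forall x, 0 <= h x) ->
        \int[P]_w h (Phi (t, w)) = \int[lam n]_x (h x * (f t x)%:E)) &
      (forall t t' l (h : 'rV[R]_n -> \bar R), (0 < l)%R -> (l < 1)%R ->
        measurable_fun setT h -> (forall x, 0 <= h x) ->
        \int[P]_w (h ((1 - l) *: Phi (t, w) + l *: Phi (t', w))%R *
          (interp_weight l (f t (Phi (t, w))) (f t' (Phi (t', w))))%:E) <=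
        \int[lam n]_x h x)].

(** Induction on the dimension. The first coordinate is the quantile of the marginal; the others
    come from the induction hypothesis for the conditional densities, indexed by the old parameter
    together with the first coordinate, which is why the statement is about measurable families. The
    last clause of [knothe_coupling] is a change of variables without Jacobian: for triangular
    monotone maps the determinant of a convex combination is at least the geometric mean of the
    determinants, diagonal entry by diagonal entry. *)
Theorem knothe n d (T : measurableType d) (f : T -> 'rV[R]_n -> R) :
  measurable_fun setT (fun p : T * 'rV[R]_n => f p.1 p.2) ->
  (forall t, gdensity (f t)) ->
  exists d' (Om : measurableType d') (P : probability Om R) (Phi : T * Om -> 'rV[R]_n),
    knothe_coupling f P Phi.
Proof.
elim: n d T f => [|n IH] d T f mf fd.
  exists _, (measurableTypeR R), (@unif R), (fun=> 0%R).
  (* On a one-point space a density is the constant 1, so any randomness will do. *)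
  have f1 t x : f t x = 1%R.
    rewrite [x]thinmx0; have [mft _ _] := fd t.
    by rewrite integral_rV0 => [[]|]//; exact/measurable_EFinP.
  split=> //.
  - move=> t h mh h0; rewrite integral_rV0; last first.
      apply: emeasurable_funM => //; have [mft _ _ _] := fd t; exact/measurable_EFinP.
    by rewrite f1 mule1 integral_cst//= probability_setT mule1.
  - move=> t t' l h l0 l1 mh h0; rewrite integral_rV0// !f1 /interp_weight ln1 !mulr0 addr0 oppr0 expR0.
    by under eq_integral do rewrite mule1 !scaler0 addr0; rewrite integral_cst//= probability_setT mule1.
pose f1 t := slice_mass (f t).
pose f2 (p : T * measurableTypeR R) := slice_cond (f p.1) p.2.
have mft t : measurable_fun setT (f t) by case: (fd t).
have f0 t x : (0 < f t x)%R by case: (fd t).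
have df t : gauss_dominated (f t) by case: (fd t).
have mf1 : measurable_fun setT (fun p : T * measurableTypeR R => f1 p.1 p.2).
  exact: measurable_slice_mass.
have f1_gt0 t s : (0 < f1 t s)%R by apply: slice_mass_gt0.
have pf1 t : pdensity (f1 t).
  split=> //; last by rewrite integral_slice_mass//; case: (fd t).
  have mp : measurable_fun setT (fun y : measurableTypeR R => (t, y)) by exact: pair1_measurable.
  exact: (measurableT_comp mf1 mp).
have mcons : measurable_fun setT (fun q : (T * measurableTypeR R) * 'rV[R]_n =>
    (q.1.1, cons_rV (q.1.2, q.2))).
  apply/measurable_fun_pairP; split.
    exact: (measurableT_comp measurable_fst measurable_fst).
  apply: measurable_cons_rV_fun; last exact: measurable_snd.
  exact: (measurableT_comp measurable_snd measurable_fst).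
have mf2 : measurable_fun setT (fun q : (T * measurableTypeR R) * 'rV[R]_n => f2 q.1 q.2).
  apply: measurable_funM; last exact: (measurableT_comp mf mcons).
  apply: measurable_inv_pos => [|q]; last exact: f1_gt0.
  exact: (measurableT_comp mf1 measurable_fst).
have f2d p : gdensity (f2 p) by exact: slice_cond_gdensity.
have [d' [Om [P [Phi [mPhi lawPhi knPhi]]]]] := IH _ _ f2 mf2 f2d.
pose Q t := quantile (f1 t).
have mQ : measurable_fun setT (fun p : T * measurableTypeR R => Q p.1 p.2).
  exact: measurable_quantile.
pose Psi (p : T * (measurableTypeR R * Om)) : 'rV[R]_n.+1 :=
  cons_rV (Q p.1 p.2.1, Phi ((p.1, Q p.1 p.2.1), p.2.2)).
have mQ' : measurable_fun setT (fun p : T * (measurableTypeR R * Om) => Q p.1 p.2.1).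
  have m1 : measurable_fun setT (fun p : T * (measurableTypeR R * Om) => (p.1, p.2.1)).
    apply/measurable_fun_pairP; split; first exact: measurable_fst.
    exact: (measurableT_comp measurable_fst measurable_snd).
  exact: (measurableT_comp mQ m1).
have mPsi : measurable_fun setT Psi.
  apply: measurable_cons_rV_fun => //.
  have m1 : measurable_fun setT (fun p : T * (measurableTypeR R * Om) =>
      ((p.1, Q p.1 p.2.1 : measurableTypeR R), p.2.2)).
    apply/measurable_fun_pairP; split; last exact: (measurableT_comp measurable_snd measurable_snd).
    by apply/measurable_fun_pairP; split; [exact: measurable_fst|exact: mQ'].
  exact: (measurableT_comp mPhi m1).
have mPsit t : measurable_fun setT (fun w => Psi (t, w)).
  have mp : measurable_fun setT (fun w : measurableTypeR R * Om => (t, w)) by exact: pair1_measurable.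
  exact: (measurableT_comp mPsi mp).
have mhs (h : 'rV[R]_n.+1 -> \bar R) s : measurable_fun setT h ->
    measurable_fun setT (fun y : 'rV[R]_n => h (cons_rV (s, y))).
  by move=> mh; apply: (measurableT_comp mh); exact: measurable_cons_rV_fun.
exists _, (measurableTypeR R * Om)%type, (@unif R \x P)%E, Psi; split=> //.
- move=> t h mh h0.
  pose hg x := h x * (f t x)%:E.
  have mhg : measurable_fun setT hg.
    by apply: emeasurable_funM => //; exact/measurable_EFinP.
  have hg0 x : 0 <= hg x by rewrite mule_ge0// lee_fin ltW.
  pose H (s : measurableTypeR R) := \int[lam n]_y (h (cons_rV (s, y)) * (f2 (t, s) y)%:E).
  (* Multiplying by the marginal removes the normalisation of the conditional density. *)
  have HE s : H s * (f1 t s)%:E = \int[lam n]_y hg (cons_rV (s, y)).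
    rewrite -integral_scaler.
    + apply: eq_integral => y _; rewrite /hg -(slice_condK (mft t) (f0 t) (df t)) EFinM.
      by rewrite -muleA [X in _ * X]muleC.
    + exact: ltW.
    + apply: emeasurable_funM; first exact: mhs.
      by apply/measurable_EFinP; case: (f2d (t, s)).
    + by move=> y; apply: mule_ge0 => //; rewrite lee_fin; have [_ /(_ y)/ltW] := f2d (t, s).
  have mH : measurable_fun setT H.
    rewrite (_ : H = fun s => (\int[lam n]_y hg (cons_rV (s, y))) * ((f1 t s)^-1)%:E).
      apply: emeasurable_funM; first exact: measurable_slice.
      apply/measurable_EFinP; apply: measurable_inv_pos => //; by case: (pf1 t).
    by apply/funext => s; rewrite -HE -muleA -EFinM mulfV ?mule1// gt_eqF.
  have H0 s : 0 <= H s.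
    apply: integral_ge0 => y _; apply: mule_ge0 => //; rewrite lee_fin.
    by have [_ /(_ y)/ltW] := f2d (t, s).
  rewrite fubini_tonelli1; [|exact: (measurableT_comp mh (mPsit t))|by move=> z; exact: h0].
  rewrite [RHS]integral_rVS//.
  under [RHS]eq_integral do rewrite -[X in integral _ _ X]/(fun y => hg (cons_rV (_, y))) -HE.
  rewrite -(integral_quantile (pf1 t) mH H0).
  apply: eq_integral => u _; rewrite /fubini_F /Psi/=.
  by rewrite (lawPhi (t, Q t u) (fun y => h (cons_rV (Q t u, y))))//; exact: mhs.
- move=> t t' l h l0 l1 mh h0.
  pose H (s : measurableTypeR R) := \int[lam n]_y h (cons_rV (s, y)).
  have mH : measurable_fun setT H by exact: measurable_slice.
  have H0 s : 0 <= H s by exact: integral_ge0.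
  pose W (p : measurableTypeR R * Om) := h ((1 - l) *: Psi (t, p) + l *: Psi (t', p))%R *
    (interp_weight l (f t (Psi (t, p))) (f t' (Psi (t', p))))%:E.
  have W0 p : 0 <= W p by rewrite mule_ge0// lee_fin interp_weight_ge0.
  have mlin : measurable_fun setT (fun p => ((1 - l) *: Psi (t, p) + l *: Psi (t', p))%R).
    apply: measurable_rVD; apply: measurable_rVZ.
    - exact: measurable_cst.
    - exact: mPsit.
    - exact: measurable_cst.
    - exact: mPsit.
  have mW : measurable_fun setT W.
    apply: emeasurable_funM; first exact: (measurableT_comp mh mlin).
    apply/measurable_EFinP; apply: measurable_interp_weight.
      exact: (measurableT_comp (mft t) (mPsit t)).
    exact: (measurableT_comp (mft t') (mPsit t')).
  rewrite -/W [leLHS](fubini_tonelli1 W mW W0).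
  rewrite [leRHS]integral_rVS//.
  (* The one-dimensional estimate handles the first coordinate, tested on the slice integral [H].
     What remains, for each level, is the induction hypothesis for the conditional densities at the
     two quantiles. *)
  apply: le_trans (monotone_transport_le (pf1 t) (pf1 t') l0 l1 mH H0).
  have mQt r : measurable_fun setT (Q r) by exact: measurable_quantile1.
  have mf1t r : measurable_fun setT (f1 r) by case: (pf1 r).
  apply: integral_le.
  + exact: (measurable_fun_fubini_tonelli_F W mW W0).
  + apply: emeasurable_funM.
      have mc : measurable_fun setT (fun u : measurableTypeR R =>
          ((1 - l) * Q t u + l * Q t' u)%R : measurableTypeR R).
        apply: measurable_funD; apply: measurable_funM.
        - exact: measurable_cst.
        - exact: mQt.
        - exact: measurable_cst.
        - exact: mQt.
      exact: (measurableT_comp mH mc).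
    apply/measurable_EFinP; apply: measurable_interp_weight.
      exact: (measurableT_comp (mf1t t) (mQt t)).
    exact: (measurableT_comp (mf1t t') (mQt t')).
  + by move=> u; exact: integral_ge0.
  + move=> u; rewrite /fubini_F; set s := Q t u; set s' := Q t' u.
    pose c := interp_weight l (f1 t s) (f1 t' s').
    pose hs y := h (cons_rV (((1 - l) * s + l * s')%R, y)).
    pose G w := hs ((1 - l) *: Phi ((t, s), w) + l *: Phi ((t', s'), w))%R *
      (interp_weight l (f2 (t, s) (Phi ((t, s), w))) (f2 (t', s') (Phi ((t', s'), w))))%:E.
    have mG : measurable_fun setT G.
      have mPhit p : measurable_fun setT (fun w => Phi (p, w)).
        have mp : measurable_fun setT (fun w : Om => (p, w)) by exact: pair1_measurable.
        exact: (measurableT_comp mPhi mp).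
      have mlin' : measurable_fun setT (fun w => ((1 - l) *: Phi ((t, s), w) + l *: Phi ((t', s'), w))%R).
        apply: measurable_rVD; apply: measurable_rVZ.
        - exact: measurable_cst.
        - exact: mPhit.
        - exact: measurable_cst.
        - exact: mPhit.
      apply: emeasurable_funM; first exact: (measurableT_comp (mhs h _ mh) mlin').
      have mf2p p : measurable_fun setT (f2 p) by case: (f2d p).
      apply/measurable_EFinP; apply: measurable_interp_weight.
        exact: (measurableT_comp (mf2p (t, s)) (mPhit (t, s))).
      exact: (measurableT_comp (mf2p (t', s')) (mPhit (t', s'))).
    have G0 w : 0 <= G w by rewrite mule_ge0// ?h0// lee_fin interp_weight_ge0.
    have -> : \int[P]_w W (u, w) = \int[P]_w (c%:E * G w).
      apply: eq_integral => w _; rewrite /W /G /Psi/= !cons_rVZ cons_rVD.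
      have f2_gt0 p y : (0 < f2 p y)%R by case: (f2d p).
      rewrite -!(slice_condK (mft _) (f0 _) (df _)) interp_weightM; last 4 first.
      - exact: (f1_gt0 t).
      - exact: (f2_gt0 (t, Q t u)).
      - exact: (f1_gt0 t').
      - exact: (f2_gt0 (t', Q t' u)).
      by rewrite EFinM muleCA.
    rewrite integral_scalel; [|exact: interp_weight_ge0|exact: mG|exact: G0].
    rewrite [leRHS]muleC lee_wpmul2l ?lee_fin ?interp_weight_ge0//.
    exact: (knPhi (t, s) (t', s') l hs l0 l1 (mhs h _ mh) (fun=> h0 _)).
Qed.

End knothe.

(** * Prekopa-Leindler inequality *)

Section dotp_theory.
Context (R : realType) (n : nat).
Implicit Types (u v w : 'rV[R]_n) (a : R).

Lemma dotpC u v : dotp u v = dotp v u.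
Proof. by apply: eq_bigr => i _; rewrite mulrC. Qed.

Lemma dotpDl u v w : dotp (u + v) w = dotp u w + dotp v w.
Proof. by rewrite /dotp -big_split/=; apply: eq_bigr => i _; rewrite mxE mulrDl. Qed.

Lemma dotpZl a u v : dotp (a *: u) v = a * dotp u v.
Proof. by rewrite /dotp mulr_sumr; apply: eq_bigr => i _; rewrite mxE mulrA. Qed.

Lemma dotpDr u v w : dotp w (u + v) = dotp w u + dotp w v.
Proof. by rewrite dotpC dotpDl !(dotpC w). Qed.

Lemma dotpZr a u v : dotp u (a *: v) = a * dotp u v.
Proof. by rewrite dotpC dotpZl dotpC. Qed.

Lemma dotpNl u v : dotp (- u) v = - dotp u v.
Proof. by rewrite -scaleN1r dotpZl mulN1r. Qed.

Lemma dotpNr u v : dotp u (- v) = - dotp u v.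
Proof. by rewrite dotpC dotpNl dotpC. Qed.

Definition dotpE := (dotpDl, dotpDr, dotpNl, dotpNr, dotpZl, dotpZr).

Lemma dotp_ge0 u : 0 <= dotp u u.
Proof. by apply: sumr_ge0 => i _; rewrite -expr2 sqr_ge0. Qed.

Lemma dotp0l u : dotp 0 u = 0.
Proof. by rewrite -[0](scale0r u) dotpZl mul0r. Qed.

Lemma dotp_amgm u v : 2 * dotp u v <= dotp u u + dotp v v.
Proof.
by have := dotp_ge0 (u - v); rewrite !dotpE (dotpC v u); lra.
Qed.

Lemma dotp_sqrB u v : dotp (u - v) (u - v) = dotp u u - 2 * dotp u v + dotp v v.
Proof. by rewrite !dotpE (dotpC v u); ring. Qed.

Lemma sqr_enorm u : enorm u ^+ 2 = dotp u u.
Proof. by rewrite sqr_sqrtr// dotp_ge0. Qed.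

End dotp_theory.

Section real_estimates.
Context (R : realType).
Implicit Types x u : R.

Let sinh_ge u : 0 <= u -> 2 * u <= expR u - expR (- u).
Proof.
move=> u0; pose f (x : R) := expR x - expR (- x) - 2 * x.
have df (x : R) : is_derive x 1 f (expR x + expR (- x) - 2).
  apply: is_derive_eq; rewrite /GRing.scale/=; ring.
have [->|un0] := eqVneq u 0; first by rewrite oppr0 mulr0 subrr.
have up : 0 < u by rewrite lt0r un0.
have [|c _ h] := @MVT R f _ 0 u up (fun x _ => df x).
  apply: continuous_subspaceT => x; apply: differentiable_continuous.
  by apply/derivable1_diffP; have [] := df x.
have f00 : f 0 = 0 by rewrite /f oppr0 mulr0 !subrr.
have : 0 <= f u - f 0.
  rewrite h mulr_ge0 ?subr0//.
  have a0 := expR_gt0 c; have -> : expR (- c) = (expR c)^-1 by rewrite expRN.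
  have -> : expR c + (expR c)^-1 - 2 = (expR c - 1) ^+ 2 / expR c.
    by field; rewrite gt_eqF.
  by rewrite divr_ge0 ?sqr_ge0// ltW.
rewrite f00 subr0 /f; lra.
Qed.

(** The right-hand side minus 2 is the square of expR (u / 2) - expR (- (u / 2)), to which [sinh_ge]
    applies. *)
Lemma cosh_ge u : 2 + u ^+ 2 <= expR u + expR (- u).
Proof.
wlog u0 : u / 0 <= u => [h|].
  have [/h//|/ltW u0] := leP 0 u.
  by have := h (- u); rewrite sqrrN opprK (addrC (expR (- u))); apply; rewrite oppr_ge0.
have h := sinh_ge (divr_ge0 u0 (ler0n _ 2)).
have hu : expR u = expR (u / 2) ^+ 2 by rewrite expr2 -expRD -splitr.
have hNu : expR (- u) = expR (- (u / 2)) ^+ 2 by rewrite expr2 -expRD -opprD -splitr.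
have h1 : expR (u / 2) * expR (- (u / 2)) = 1 by rewrite -expRD subrr expR0.
have : u ^+ 2 <= (expR (u / 2) - expR (- (u / 2))) ^+ 2.
  by rewrite ler_sqr ?nnegrE//; [have := h; lra|apply: le_trans h; rewrite mulr_ge0// divr_ge0].
rewrite (_ : (_ - _) ^+ 2 = expR (u / 2) ^+ 2 + expR (- (u / 2)) ^+ 2 - 2 * (expR (u / 2) * expR (- (u / 2)))); last by ring.
rewrite h1 -hu -hNu; lra.
Qed.

(** From expR (- x) >= 1 - x, since (1 - x)(1 + x + 2 x^2) = 1 + x^2 (1 - 2 x) is at least 1. *)
Lemma expR_le_quadratic x : 0 <= x -> x <= 2^-1 -> expR x <= 1 + x + 2 * x ^+ 2.
Proof.
move=> x0 x2; have h := expR_ge1Dx (- x).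
have hx : expR x * expR (- x) = 1 by rewrite -expRD subrr expR0.
have e0 := expR_gt0 x.
have h1 : expR x * (1 - x) <= 1 by rewrite -[leRHS]hx ler_pM2l.
rewrite -(@ler_pM2r _ (1 - x)); last lra.
by apply: le_trans h1 _; nra.
Qed.

Lemma le_of_small_error (D c K e0 : R) : 0 < e0 -> 0 <= K ->
  (forall e, 0 < e -> e <= e0 -> D <= c + e * K) -> D <= c.
Proof.
move=> e00 K0 h; apply/ler_addgt0Pr => d d0.
have K1 : 0 < K + 1 by rewrite ltr_wpDl.
pose e := Num.min e0 (d / (K + 1)).
have ep : 0 < e by rewrite lt_min e00 divr_gt0.
have ee : e <= e0 by rewrite ge_min lexx.
apply: le_trans (h e ep ee) _; rewrite lerD2l.
have h1 : e * K <= e * (K + 1) by rewrite ler_pM2l// lerDl.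
apply: le_trans h1 _; rewrite -ler_pdivlMr//.
by rewrite /e ge_min lexx orbT.
Qed.

(* The second-order expansion, at small eps, of a Prekopa-Leindler inequality
   for the densities exp(- V +- eps g). *)
Lemma second_order_limit (Z Q D k M L e0 : R) : 0 < Z -> 0 <= Q -> 0 <= D ->
  0 < k -> 0 <= M -> 0 <= L -> 0 < e0 ->
  (forall e t, 0 < e -> e <= e0 -> t = e ^+ 2 * ((1 + 8 * (e * M / k)) / (2 * k)) ->
    2 * Z ^+ 2 + e ^+ 2 * D <= 2 * (Z + t * Q + 2 * t ^+ 2 * L ^+ 2 * Z) ^+ 2) ->
  D <= 2 / k * (Z * Q).
Proof.
move=> Z0 Q0 D0 k0 M0 L0 e00 h.
(* Below [e1] the correction 8 e M / k in [t] is at most 1. Then [t] is e^2 / (2 k) up to an error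
   of order e^3, and [K1] collects the coefficients of the errors. *)
pose e1 := Num.min e0 (Num.min 1 (k / (8 * M + 1))).
have M1 : 0 < 8 * M + 1 by rewrite ltr_wpDl// mulr_ge0.
have e1p : 0 < e1 by rewrite !lt_min e00 ltr01 divr_gt0.
pose K1 := 4 * M * Q / k ^+ 2 + 2 * L ^+ 2 * Z / k ^+ 2.
pose W0 := Q / (2 * k) + K1.
have K10 : 0 <= K1.
  by rewrite addr_ge0// divr_ge0 ?sqr_ge0// ?mulr_ge0 ?sqr_ge0// ltW.
have W00 : 0 <= W0 by rewrite addr_ge0// divr_ge0// mulr_ge0// ltW.
apply: (@le_of_small_error _ _ (4 * Z * K1 + 2 * W0 ^+ 2) e1) => //.
  by rewrite addr_ge0// ?mulr_ge0 ?sqr_ge0// ltW.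
move=> e ep; rewrite !le_min => /and3P[ee0 ele1 ekM].
have eM : e * (8 * M) <= k.
  move: ekM; rewrite ler_pdivlMr// mulrDr mulr1; lra.
pose tau := (1 + 8 * (e * M / k)) / (2 * k).
have x8 : 8 * (e * M / k) <= 1.
  by rewrite mulrA ler_pdivrMr// mul1r; lra.
have x0 : 0 <= e * M / k by rewrite divr_ge0 ?mulr_ge0// ltW.
have tau0 : 0 <= tau by apply: divr_ge0; [lra|rewrite mulr_ge0// ltW].
have tau1 : tau <= k^-1.
  rewrite /tau ler_pdivrMr ?mulr_gt0//.
  have -> : k^-1 * (2 * k) = 2 by field; exact: lt0r_neq0.
  lra.
have tauE : tau = (2 * k)^-1 + e * (4 * M / k ^+ 2).
  by rewrite /tau; field; exact: lt0r_neq0.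
pose W := tau * Q + 2 * e ^+ 2 * tau ^+ 2 * L ^+ 2 * Z.
have tau2 : tau ^+ 2 <= (k ^+ 2)^-1 by rewrite -exprVn ler_sqr ?nnegrE ?invr_ge0// ltW.
have L2 : 0 <= L ^+ 2 * Z by rewrite mulr_ge0 ?sqr_ge0// ltW.
have e2 : e ^+ 2 <= e by rewrite expr2 ler_piMr// ltW.
have WK : W <= Q / (2 * k) + e * K1.
  rewrite /W tauE mulrDl [_^-1 * Q]mulrC -addrA lerD2l /K1 [e * (_ + _)]mulrDr.
  apply: lerD; first by rewrite le_eqVlt; apply/orP; left; apply/eqP; ring.
  have h1 : e ^+ 2 * tau ^+ 2 <= e * (k ^+ 2)^-1 by apply: ler_pM; rewrite ?sqr_ge0.
  have := ler_wpM2r L2 h1; rewrite -tauE; lra.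
have WW0 : W <= W0.
  by apply: le_trans WK _; rewrite lerD2l ler_piMl.
have W0' : 0 <= W.
  apply: addr_ge0; first exact: mulr_ge0.
  by have := mulr_ge0 (sqr_ge0 e) (mulr_ge0 (sqr_ge0 tau) L2); clearbody tau; lra.
have := h e (e ^+ 2 * tau) ep ee0 erefl.
have -> : Z + e ^+ 2 * tau * Q + 2 * (e ^+ 2 * tau) ^+ 2 * L ^+ 2 * Z = Z + e ^+ 2 * W.
  by rewrite /W; ring.
have ep2 : 0 < e ^+ 2 by rewrite exprn_gt0.
have -> : 2 * (Z + e ^+ 2 * W) ^+ 2 = 2 * Z ^+ 2 + e ^+ 2 * (4 * Z * W + 2 * e ^+ 2 * W ^+ 2) by ring.
rewrite lerD2l ler_pM2l// => /le_trans; apply.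
have W2 : e ^+ 2 * W ^+ 2 <= e * W0 ^+ 2.
  by apply: ler_pM; rewrite ?sqr_ge0// ler_sqr.
have ZW := ler_wpM2l (ltW Z0) WK.
have -> : 2 / k * (Z * Q) = 4 * (Z * (Q / (2 * k))) by field; exact: lt0r_neq0.
move: W2 ZW; clearbody W W0 K1; set Y := Q / (2 * k); clearbody Y => W2 ZW.
have {}ZW : Z * W <= Z * Y + e * (Z * K1) by move: ZW; rewrite mulrDr mulrCA.
lra.
Qed.

End real_estimates.

Section prekopa_leindler.
Local Open Scope ereal_scope.
Context (R : realType) (n : nat).
Local Notation lam := (@lebesgue_rV R n).
Implicit Types a b c : 'rV[R]_n -> R.

Lemma measurable_expRN d (T : measurableType d) (a : T -> R) : measurable_fun setT a ->
  measurable_fun setT (fun x => expR (- a x)).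
Proof. by move=> ma; apply: measurableT_comp => //; exact: measurableT_comp. Qed.

Definition mass a : R := fine (\int[lam]_x (expR (- a x))%:E).

Lemma massE a : measurable_fun setT a -> gauss_dominated (fun x => expR (- a x)) ->
  (mass a)%:E = \int[lam]_x (expR (- a x))%:E.
Proof.
move=> ma da; rewrite /mass fineK// ge0_fin_numE; last first.
  by apply: integral_ge0 => y _; rewrite lee_fin expR_ge0.
by apply: integral_gauss_dominated_lty => //; exact: measurable_expRN.
Qed.

Lemma mass_gt0 a : measurable_fun setT a -> gauss_dominated (fun x => expR (- a x)) ->
  (0 < mass a)%R.
Proof.
move=> ma da; rewrite -lte_fin massE//; apply: integral_posf_gt0 => [|x].
  exact: measurable_expRN.
exact: expR_gt0.
Qed.

Lemma gdensity_expRN a : measurable_fun setT a ->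
  gauss_dominated (fun x => expR (- a x)) ->
  gdensity (fun x => ((mass a)^-1 * expR (- a x))%R).
Proof.
move=> ma da; have m0 := mass_gt0 ma da; split.
- by apply: measurable_funM => //; exact: measurable_expRN.
- by move=> x; rewrite mulr_gt0 ?invr_gt0// expR_gt0.
- have [k k0 [C fC]] := da; exists k => //; exists ((mass a)^-1 * C)%R => x.
  by rewrite -mulrA ler_pM2l// invr_gt0.
- under eq_integral do rewrite EFinM.
  rewrite integral_scalel; [|by rewrite invr_ge0 ltW| |by move=> x; rewrite lee_fin expR_ge0].
    by rewrite -massE// -EFinM mulVf// gt_eqF.
  by apply/measurable_EFinP; exact: measurable_expRN.
Qed.

(** Knothe's rearrangement for a family of two members, tested on exp(- c). The hypothesis on [c]
    makes the integrand at least the left-hand side at every point; the masses come out of the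
    weight because the densities are normalised. *)
Lemma prekopa_leindler (l : R) a b c : (0 < l)%R -> (l < 1)%R ->
  measurable_fun setT a -> measurable_fun setT b -> measurable_fun setT c ->
  gauss_dominated (fun x => expR (- a x)) -> gauss_dominated (fun x => expR (- b x)) ->
  (forall x y, (c ((1 - l) *: x + l *: y) <= (1 - l) * a x + l * b y)%R) ->
  (expR ((1 - l) * ln (mass a) + l * ln (mass b)))%:E <= \int[lam]_x (expR (- c x))%:E.
Proof.
move=> l0 l1 ma mb mc da db abc.
pose e (t : bool) := if t then a else b.
have me t : measurable_fun setT (e t) by case: t.
have de t : gauss_dominated (fun x => expR (- e t x)) by case: t.
pose f t x := ((mass (e t))^-1 * expR (- e t x))%R.
have mf : measurable_fun setT (fun p : bool * 'rV[R]_n => f p.1 p.2).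
  rewrite (_ : (fun _ => _) = fun p => if p.1 then f true p.2 else f false p.2); last first.
    by apply/funext => -[[] x].
  apply: measurable_fun_ifT; first exact: measurable_fst.
  - have [m _ _ _] := gdensity_expRN (me true) (de true); exact: (measurableT_comp m measurable_snd).
  - have [m _ _ _] := gdensity_expRN (me false) (de false); exact: (measurableT_comp m measurable_snd).
have fd t : gdensity (f t) by exact: gdensity_expRN.
have [d' [Om [P [Phi [mPhi _ kn]]]]] := knothe mf fd.
have mec : measurable_fun setT (fun x => (expR (- c x))%:E).
  by apply/measurable_EFinP; exact: measurable_expRN.
have mPhit t : measurable_fun setT (fun w => Phi (t, w)).
  have mp : measurable_fun setT (fun w : Om => (t, w)) by exact: pair1_measurable.
  exact: (measurableT_comp mPhi mp).
apply: le_trans (kn true false l _ l0 l1 mec _); last by move=> x; rewrite lee_fin expR_ge0.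
rewrite -[leLHS]mule1 -(probability_setT P) -integral_cst//.
have mlin : measurable_fun setT (fun w => ((1 - l) *: Phi (true, w) + l *: Phi (false, w))%R).
  apply: measurable_rVD; apply: measurable_rVZ.
  - exact: measurable_cst.
  - exact: mPhit.
  - exact: measurable_cst.
  - exact: mPhit.
apply: integral_le.
- exact: measurable_cst.
- apply: emeasurable_funM; first exact: (measurableT_comp mec mlin).
  apply/measurable_EFinP; apply: measurable_interp_weight.
    by have [m _ _ _] := fd true; exact: (measurableT_comp m (mPhit true)).
  by have [m _ _ _] := fd false; exact: (measurableT_comp m (mPhit false)).
- by move=> w; rewrite lee_fin expR_ge0.
- move=> w; rewrite -EFinM lee_fin /interp_weight -expRD ler_expR.
  have lnf t x : ln (f t x) = (- ln (mass (e t)) - e t x)%R.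
    rewrite lnM ?posrE ?invr_gt0 ?expR_gt0 ?mass_gt0//.
    by rewrite lnV ?posrE ?mass_gt0// expRK.
  rewrite !lnf /=; have := abc (Phi (true, w)) (Phi (false, w)).
  set C := c _; set A := a _; set B := b _; lra.
Qed.

End prekopa_leindler.

(** * Poincare inequality *)

Section integral_product.
Local Open Scope ereal_scope.
Context d (T : measurableType d) (R : realType).
Variable mu : {sigma_finite_measure set T -> \bar R}.

Lemma integral_prod_mul (f g : T -> R) : measurable_fun setT f -> measurable_fun setT g ->
  (forall x, (0 <= f x)%R) -> (forall x, (0 <= g x)%R) ->
  \int[mu]_x (g x)%:E < +oo ->
  \int[(mu \x mu)]_z (f z.1 * g z.2)%:E = \int[mu]_x (f x)%:E * \int[mu]_x (g x)%:E.
Proof.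
move=> mf mg f0 g0 goo.
have g00 : 0 <= \int[mu]_x (g x)%:E by apply: integral_ge0 => x _; rewrite lee_fin.
have gfin : \int[mu]_x (g x)%:E \is a fin_num by rewrite ge0_fin_numE.
rewrite fubini_tonelli1.
- under eq_integral do (rewrite /fubini_F/=; under eq_integral do rewrite EFinM;
    rewrite integral_scalel; [|exact: f0|exact/measurable_EFinP|by move=> x; rewrite lee_fin]).
  rewrite -(fineK gfin) integral_scaler//; first exact: fine_ge0.
  exact/measurable_EFinP.
- apply/measurable_EFinP; apply: measurable_funM.
    exact: (measurableT_comp mf measurable_fst).
  exact: (measurableT_comp mg measurable_snd).
- by move=> z; rewrite lee_fin mulr_ge0.
Qed.

Lemma integral_prod_swap (F : T * T -> \bar R) : measurable_fun setT F ->
  (forall z, 0 <= F z) ->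
  \int[(mu \x mu)]_z F (z.2, z.1) = \int[(mu \x mu)]_z F z.
Proof.
move=> mF F0.
have msw : measurable_fun setT (fun z : T * T => (z.2, z.1)) by exact: measurable_swap.
have mF' : measurable_fun setT (fun z => F (z.2, z.1)) by exact: (measurableT_comp mF msw).
rewrite (fubini_tonelli1 _ mF')// (fubini_tonelli2 _ mF)//.
Qed.

End integral_product.

Section poincare.
Local Open Scope ereal_scope.
Context (R : realType) (n : nat).
Local Notation lam := (@lebesgue_rV R n).
Local Notation mid x y := (2^-1 *: (x + y)).

Variables (V g : 'rV[R]_n -> R) (G : 'rV[R]_n -> 'rV[R]_n) (k M L : R).
Hypotheses (mV : measurable_fun setT V) (mg : measurable_fun setT g)
  (mG : measurable_fun setT G).
Hypotheses (k0 : (0 < k)%R) (M0 : (0 <= M)%R) (L0 : (0 <= L)%R).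
Hypothesis dV : gauss_dominated (fun x => expR (- V x)).
Hypothesis Vmid : forall x y,
  (V (mid x y) <= (V x + V y) / 2 - k / 8 * dotp (x - y) (x - y))%R.
Hypothesis gmid : forall x y,
  (g x - g y <= dotp (G (mid x y)) (x - y) + M * dotp (x - y) (x - y))%R.
Hypothesis GL : forall x, (dotp (G x) (G x) <= L)%R.

(** The midpoint inequality between x and 0, in both orders. Quadratic growth keeps the tilts of [V]
    by small multiples of [g] integrable. *)
Let growth x : (`|g x - g 0| <= L / 2 + (M + 2^-1) * dotp x x)%R.
Proof.
have h y : (dotp (G y) x <= L / 2 + dotp x x / 2)%R.
  by have := dotp_amgm (G y) x; have := GL y; lra.
rewrite ler_norml; apply/andP; split.
  have := gmid 0%R x; rewrite sub0r; set m := (2^-1 *: _)%R.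
  by have := dotp_amgm (- G m) x; have := GL m; rewrite !dotpE !opprK; lra.
by have := gmid x 0%R; rewrite subr0; set m := (2^-1 *: _)%R; have := h m; lra.
Qed.

Let tilt_dominated : exists2 e0 : R, (0 < e0)%R & forall e, (`|e| <= e0)%R ->
  gauss_dominated (fun x => expR (- (V x - e * g x))).
Proof.
have [q q0 [C VC]] := dV.
have M1 : (0 < M + 2^-1)%R by rewrite ltr_wpDl.
exists (q / (2 * (M + 2^-1)))%R; first by rewrite divr_gt0// mulr_gt0.
move=> e ee; exists (q / 2)%R; first by rewrite divr_gt0.
exists (C * expR (e * g 0 + `|e| * (L / 2)))%R => x.
have h1 : (e * g x <= e * g 0 + `|e| * (L / 2) + q / 2 * dotp x x)%R.
  have h2 : (e * (g x - g 0) <= `|e| * (L / 2 + (M + 2^-1) * dotp x x))%R.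
    by apply: (le_trans (ler_norm _)); rewrite normrM ler_wpM2l//; exact: growth.
  have h3 : (`|e| * (M + 2^-1) * dotp x x <= q / 2 * dotp x x)%R.
    move: ee; rewrite ler_pdivlMr ?mulr_gt0// => h; apply: ler_wpM2r; first exact: dotp_ge0.
    by rewrite ler_pdivlMr// -mulrA [(_ * 2)%R]mulrC.
  by move: h2 h3; rewrite mulrBr mulrDr mulrA; lra.
rewrite opprB addrC expRD.
have C0 : (0 <= C)%R.
  by have := le_trans (expR_ge0 _) (VC 0%R); rewrite pmulr_lge0// expR_gt0.
apply: (@le_trans _ _ (C * expR (- (q * dotp x x)) * expR (e * g 0 + `|e| * (L / 2) + q / 2 * dotp x x))%R).
  by apply: ler_pM; rewrite ?expR_ge0 ?ler_expR.
rewrite -!mulrA -!expRD ler_wpM2l// ler_expR; lra.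
Qed.

(** The coefficient of |x - y|^2 left over is p = k / 8 - e M / 2, and completing the square costs
    e^2 / (16 p) times |G|^2. The value of [t] dominates this because (1 - 4 X)(1 + 8 X) >= 1 for X
    = e M / k between 0 and 1/8. *)
Let tilt_ineq (e t : R) : (0 < e)%R -> (8 * (e * M / k) <= 1)%R ->
  t = (e ^+ 2 * ((1 + 8 * (e * M / k)) / (2 * k)))%R -> forall x y,
  (V (mid x y) - t * dotp (G (mid x y)) (G (mid x y)) <=
   2^-1 * (V x - e * g x) + 2^-1 * (V y - (- e) * g y))%R.
Proof.
move=> e0 ek tE x y; set m := mid x y; set A := dotp (G m) (G m).
have hV := Vmid x y; have hg := gmid x y; rewrite -/m in hV hg.
set r := dotp (x - y) (x - y) in hV hg; set B := dotp (G m) (x - y) in hg.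
pose p := (k / 8 - e * M / 2)%R.
have eMk : (e * M <= k / 8)%R.
  by move: ek; rewrite mulrA ler_pdivrMr// mul1r; lra.
have p0 : (0 < p)%R by rewrite /p; move: k0 eMk; lra.
have h1 : (0 <= p * r - e / 2 * B + e ^+ 2 / (16 * p) * A)%R.
  have := dotp_ge0 ((x - y) - (e / (4 * p)) *: G m).
  rewrite dotp_sqrB !dotpZl !dotpZr -/A -/r (dotpC _ (G m)) -/B => h.
  have := mulr_ge0 (ltW p0) h; congr (_ <= _)%R; field; exact: lt0r_neq0.
have h2 : (e ^+ 2 / (16 * p) <= t)%R.
  rewrite tE; apply: ler_wpM2l; first exact: sqr_ge0.
  pose X := (e * M / k)%R; rewrite -/X in ek *.
  have X0 : (0 <= X)%R by rewrite divr_ge0 ?mulr_ge0// ltW.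
  have X1 : (0 < 1 + 8 * X)%R by rewrite ltr_pwDl// mulr_ge0.
  have c0 : (0 < (1 + 8 * X) / (2 * k))%R by rewrite divr_gt0// mulr_gt0.
  have pE : p = (k / 8 * (1 - 4 * X))%R by rewrite /p /X; field; exact: lt0r_neq0.
  rewrite invf_ple ?posrE//; last by rewrite mulr_gt0.
  rewrite pE invf_div ler_pdivrMr//.
  rewrite [leRHS](_ : _ = 2 * k * ((1 - 4 * X) * (1 + 8 * X)))%R; last by field.
  by rewrite ler_peMr ?mulr_ge0 ?(ltW k0)//; clearbody X; nra.
have A0 : (0 <= A)%R by exact: dotp_ge0.
have h3 := ler_wpM2r A0 h2.
have h4 : (e * (g x - g y) <= e * (B + M * r))%R by rewrite ler_pM2l.
have pr : (p * r = k / 8 * r - e * M / 2 * r)%R by rewrite /p; ring.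
move: h4 h3 h1 hV pr; rewrite {h2 tE p0}; clearbody p; lra.
Qed.

Let Z : R := mass V.
Let Qe : \bar R := \int[lam]_x (dotp (G x) (G x) * expR (- V x))%:E.
Let De : \bar R := \int[(lam \x lam)]_z ((g z.1 - g z.2) ^+ 2 * (expR (- V z.1) * expR (- V z.2)))%:E.

Let mGG : measurable_fun setT (fun x => dotp (G x) (G x)).
Proof. exact: measurable_dotp. Qed.

Let meV : measurable_fun setT (fun x => expR (- V x)).
Proof. exact: measurable_expRN. Qed.

Let Z0 : (0 < Z)%R. Proof. exact: mass_gt0. Qed.

Let Q_fin : Qe = (fine Qe)%:E /\ (0 <= fine Qe)%R.
Proof.
have Q0 : 0 <= Qe.
  by apply: integral_ge0 => x _; rewrite lee_fin mulr_ge0 ?dotp_ge0 ?expR_ge0.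
split; last exact: fine_ge0.
rewrite fineK// ge0_fin_numE//.
apply: (@le_lt_trans _ _ (\int[lam]_x (L%:E * (expR (- V x))%:E))).
  apply: integral_le.
  - by apply/measurable_EFinP; exact: measurable_funM.
  - by apply: emeasurable_funM => //; exact/measurable_EFinP.
  - by move=> x; rewrite lee_fin mulr_ge0 ?dotp_ge0 ?expR_ge0.
  - by move=> x; rewrite -EFinM lee_fin ler_wpM2r ?expR_ge0.
rewrite integral_scalel; [|exact: L0|exact/measurable_EFinP|by move=> x; rewrite lee_fin expR_ge0].
by rewrite -massE// -EFinM ltry.
Qed.

Let upper (t : R) : (0 <= t)%R -> (t * L <= 2^-1)%R ->
  \int[lam]_x (expR (- (V x - t * dotp (G x) (G x))))%:E <=
  (Z + t * fine Qe + 2 * t ^+ 2 * L ^+ 2 * Z)%:E.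
Proof.
move=> t0 tL.
have m1 : measurable_fun setT (fun x => (expR (- V x))%:E) by exact/measurable_EFinP.
have m2 : measurable_fun setT (fun x => (dotp (G x) (G x) * expR (- V x))%:E).
  by apply/measurable_EFinP; exact: measurable_funM.
have p1 x : 0 <= (expR (- V x))%:E by rewrite lee_fin expR_ge0.
have p2 x : 0 <= (dotp (G x) (G x) * expR (- V x))%:E.
  by rewrite lee_fin mulr_ge0 ?dotp_ge0 ?expR_ge0.
have c0 : (0 <= 1 + 2 * t ^+ 2 * L ^+ 2)%R by rewrite addr_ge0// ?mulr_ge0 ?sqr_ge0.
apply: (@le_trans _ _ (\int[lam]_x ((1 + 2 * t ^+ 2 * L ^+ 2)%:E * (expR (- V x))%:E +
   t%:E * (dotp (G x) (G x) * expR (- V x))%:E))).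
  apply: integral_le.
  - apply/measurable_EFinP; apply: measurable_expRN; apply: measurable_funB => //.
    exact: measurable_funM.
  - by apply: emeasurable_funD; exact: measurable_funeM.
  - by move=> x; rewrite lee_fin expR_ge0.
  - move=> x; rewrite -!EFinM -EFinD lee_fin opprB addrC expRD.
    set A := dotp _ _; have A0 : (0 <= A)%R by exact: dotp_ge0.
    have tA0 : (0 <= t * A)%R by exact: mulr_ge0.
    have tAL : (t * A <= t * L)%R by rewrite ler_wpM2l// GL.
    have h1 := expR_le_quadratic tA0 (le_trans tAL tL).
    have h2 : ((t * A) ^+ 2 <= (t * L) ^+ 2)%R by rewrite ler_sqr ?nnegrE// mulr_ge0.
    have h3 : (expR (t * A) <= 1 + 2 * t ^+ 2 * L ^+ 2 + t * A)%R.
      by move: h1 h2; rewrite !exprMn; lra.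
    by have := ler_wpM2l (expR_ge0 (- V x)) h3; lra.
rewrite integral_add; [|exact: measurable_funeM|exact: measurable_funeM| |]; last 2 first.
- by move=> x; rewrite mule_ge0.
- by move=> x; rewrite mule_ge0.
rewrite integral_scalel// integral_scalel// -massE// -/Qe Q_fin.1 -!EFinM -EFinD lee_fin -/Z.
by rewrite le_eqVlt; apply/orP; left; apply/eqP; ring.
Qed.

Let tilted (e : R) x := (V x - e * g x)%R.

(** Symmetrising the product of the two tilts in (x, y) turns it into exp(- V x - V y) times twice
    the hyperbolic cosine of e (g x - g y), which [cosh_ge] bounds below. *)
Let lower (e : R) : gauss_dominated (fun x => expR (- tilted e x)) ->
  gauss_dominated (fun x => expR (- tilted (- e) x)) ->
  (2 * Z ^+ 2)%:E + (e ^+ 2)%:E * De <= (2 * (mass (tilted e) * mass (tilted (- e))))%:E.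
Proof.
move=> d1 d2.
have mt s : measurable_fun setT (tilted s).
  by apply: measurable_funB => //; exact: measurable_funM.
pose F (z : 'rV[R]_n * 'rV[R]_n) : \bar R := (expR (- tilted e z.1) * expR (- tilted (- e) z.2))%:E.
have mF : measurable_fun setT F.
  apply/measurable_EFinP; apply: measurable_funM.
    exact: (measurableT_comp (measurable_expRN (mt e)) measurable_fst).
  exact: (measurableT_comp (measurable_expRN (mt (- e)%R)) measurable_snd).
have F0 z : 0 <= F z by rewrite lee_fin mulr_ge0// expR_ge0.
have FE : \int[(lam \x lam)]_z F z = (mass (tilted e) * mass (tilted (- e)))%:E.
  rewrite EFinM !massE// -integral_prod_mul//.
  - exact: measurable_expRN.
  - exact: measurable_expRN.
  - by rewrite -massE// ltry.
have mrho : measurable_fun setT (fun z : 'rV[R]_n * 'rV[R]_n => expR (- V z.1) * expR (- V z.2))%R.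
  apply: measurable_funM.
    exact: (measurableT_comp meV measurable_fst).
  exact: (measurableT_comp meV measurable_snd).
have rho0 (z : 'rV[R]_n * 'rV[R]_n) : (0 <= expR (- V z.1) * expR (- V z.2))%R.
  by rewrite mulr_ge0// expR_ge0.
have mdg : measurable_fun setT (fun z : 'rV[R]_n * 'rV[R]_n => (g z.1 - g z.2)%R).
  apply: measurable_funB.
    exact: (measurableT_comp mg measurable_fst).
  exact: (measurableT_comp mg measurable_snd).
have mD : measurable_fun setT (fun z : 'rV[R]_n * 'rV[R]_n =>
    ((g z.1 - g z.2) ^+ 2 * (expR (- V z.1) * expR (- V z.2)))%:E).
  apply/measurable_EFinP; apply: measurable_funM => //.
  exact: (measurable_funX 2 mdg).
have D0 (z : 'rV[R]_n * 'rV[R]_n) : 0 <= ((g z.1 - g z.2) ^+ 2 * (expR (- V z.1) * expR (- V z.2)))%:E.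
  by rewrite lee_fin mulr_ge0 ?sqr_ge0.
have -> : (2 * (mass (tilted e) * mass (tilted (- e))))%:E =
    \int[(lam \x lam)]_z (F z + F (z.2, z.1)).
  rewrite integral_add//.
  - by rewrite integral_prod_swap// FE -EFinD mulr_natl mulr2n.
  - exact: (measurableT_comp mF (@measurable_swap _ _ _ _)).
have ZE : (2 * Z ^+ 2)%:E = 2%:E * \int[(lam \x lam)]_z (expR (- V z.1) * expR (- V z.2))%:E.
  rewrite EFinM (integral_prod_mul meV meV)//.
  - by rewrite -massE// -EFinM -expr2.
  - by rewrite -massE// ltry.
have mrho' := (measurable_EFinP _ _).2 mrho.
rewrite ZE -integral_scalel; [|by []|exact: mrho'|by move=> z; rewrite lee_fin].
rewrite /De -integral_scalel; [|exact: sqr_ge0|exact: mD|exact: D0].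
rewrite -integral_add; last 4 first.
- exact: measurable_funeM.
- exact: measurable_funeM.
- by move=> z; rewrite mule_ge0// lee_fin.
- by move=> z; rewrite mule_ge0// lee_fin sqr_ge0.
apply: integral_le.
- by apply: emeasurable_funD; apply: measurable_funeM => //; exact/measurable_EFinP.
- by apply: emeasurable_funD => //; exact: (measurableT_comp mF (@measurable_swap _ _ _ _)).
- by move=> z; rewrite adde_ge0// mule_ge0// lee_fin ?sqr_ge0.
- move=> -[x y]; rewrite /F /tilted /= -!EFinM -!EFinD lee_fin.
  have h := cosh_ge (e * (g x - g y)); set r := (expR (- V x) * _)%R.
  have -> : (expR (- (V x - e * g x)) * expR (- (V y - - e * g y)) = r * expR (e * (g x - g y)))%R.
    by rewrite /r -!expRD; congr expR; ring.
  have -> : (expR (- (V y - e * g y)) * expR (- (V x - - e * g x)) = r * expR (- (e * (g x - g y))))%R.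
    by rewrite /r -!expRD; congr expR; ring.
  rewrite -mulrDr; have r0 : (0 <= r)%R by exact: (rho0 (x, y)).
  have := ler_wpM2l r0 h; rewrite exprMn; lra.
Qed.

(** Prekopa-Leindler at l = 1/2 between V - e g and V + e g bounds the geometric mean of their
    masses by the mass of V - t |G|^2; to second order in e this is the claim. The mass of [V] is
    kept, as the symmetrised potentials are not normalised. *)
Theorem poincare :
  \int[(lam \x lam)]_z ((g z.1 - g z.2) ^+ 2 * (expR (- V z.1) * expR (- V z.2)))%:E <=
  (2 / k)%:E * ((mass V)%:E * \int[lam]_x (dotp (G x) (G x) * expR (- V x))%:E).
Proof.
rewrite -/De -/Qe -/Z; have [QE Q0] := Q_fin.
have [d0 d00 dd] := tilt_dominated.
have L1 : (0 < L / k + 1)%R by rewrite ltr_wpDl// divr_ge0// ltW.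
have M1 : (0 < 8 * M / k + 1)%R by rewrite ltr_wpDl// divr_ge0 ?mulr_ge0// ltW.
(* In order: integrable tilts; e <= 1/2 and e L / k <= 1, which together give t L <= 1/2; and 8 e M
   / k <= 1. *)
pose e0 := (Num.min d0 (Num.min 2^-1 (Num.min (L / k + 1)^-1 (8 * M / k + 1)^-1)))%R.
have e00 : (0 < e0)%R by rewrite /e0 !lt_min d00 !invr_gt0 L1 M1 ltr0n.
have De0 : 0 <= De.
  rewrite /De; apply: integral_ge0 => z _; rewrite lee_fin.
  apply: mulr_ge0; first exact: sqr_ge0.
  by apply: mulr_ge0; exact: expR_ge0.
have key (e t : R) : (0 < e)%R -> (e <= e0)%R ->
    t = (e ^+ 2 * ((1 + 8 * (e * M / k)) / (2 * k)))%R ->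
    (2 * Z ^+ 2)%:E + (e ^+ 2)%:E * De <=
    (2 * (Z + t * fine Qe + 2 * t ^+ 2 * L ^+ 2 * Z) ^+ 2)%:E.
  move=> ep; rewrite !le_min => /and4P[ed e12 eL eM] tE.
  have e8 : (8 * (e * M / k) <= 1)%R.
    move: eM; rewrite -[X in (_ <= X)%R]div1r ler_pdivlMr// mulrDr mulr1.
    by rewrite (_ : e * (8 * M / k) = 8 * (e * M / k))%R; [lra|ring].
  have x0 : (0 <= e * M / k)%R by rewrite divr_ge0 ?mulr_ge0// ltW.
  have t0 : (0 <= t)%R.
    rewrite tE; apply: mulr_ge0; first exact: sqr_ge0.
    by apply: divr_ge0; [rewrite addr_ge0// mulr_ge0|rewrite mulr_ge0// ltW].
  have tL : (t * L <= 2^-1)%R.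
    have h1 : ((1 + 8 * (e * M / k)) / (2 * k) <= k^-1)%R.
      rewrite ler_pdivrMr ?mulr_gt0// (_ : k^-1 * (2 * k) = 2)%R; first lra.
      by field; exact: lt0r_neq0.
    have h2 : (e * L / k <= 1)%R.
      move: eL; rewrite -[X in (_ <= X)%R]div1r ler_pdivlMr// mulrDr mulr1.
      by rewrite (_ : e * (L / k) = e * L / k)%R; [lra|ring].
    have h3 : (t <= e ^+ 2 / k)%R by rewrite tE ler_wpM2l// sqr_ge0.
    apply: le_trans (ler_wpM2r L0 h3) _.
    have -> : (e ^+ 2 / k * L = e * (e * L / k))%R by ring.
    by apply: le_trans e12; rewrite ler_piMr// ltW.
  have de : gauss_dominated (fun x => expR (- tilted e x)) by apply: dd; rewrite gtr0_norm.
  have dNe : gauss_dominated (fun x => expR (- tilted (- e) x)).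
    by apply: dd; rewrite normrN gtr0_norm.
  have mt s : measurable_fun setT (tilted s).
    by apply: measurable_funB => //; exact: measurable_funM.
  apply: (le_trans (lower de dNe)); rewrite lee_fin ler_pM2l//.
  pose W x := (V x - t * dotp (G x) (G x))%R.
  have mW : measurable_fun setT W by apply: measurable_funB => //; exact: measurable_funM.
  have half : (1 - 2^-1 = 2^-1 :> R)%R by lra.
  have hpl : forall x y, (W ((1 - 2^-1) *: x + 2^-1 *: y) <= (1 - 2^-1) * tilted e x + 2^-1 * tilted (- e) y)%R.
    by move=> x y; rewrite half -scalerDr; exact: tilt_ineq.
  have i0 : (0 < 2^-1 :> R)%R by rewrite invr_gt0.
  have i1 : (2^-1 < 1 :> R)%R by lra.
  have := prekopa_leindler i0 i1 (mt e) (mt (- e)%R) mW de dNe hpl.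
  move=> /le_trans/(_ (upper t0 tL)); rewrite lee_fin half -mulrDr.
  have a0 := mass_gt0 (mt e) de; have b0 := mass_gt0 (mt (- e)%R) dNe.
  set S := (Z + _ + _)%R => h; have S0 : (0 <= S)%R by exact: le_trans (expR_ge0 _) h.
  rewrite -[(_ * _)%R]lnK ?posrE ?mulr_gt0// lnM ?posrE//.
  set A := (ln _ + ln _)%R in h *.
  have -> : expR A = (expR (2^-1 * A) ^+ 2)%R by rewrite expr2 -expRD; congr expR; lra.
  by rewrite ler_sqr ?nnegrE// expR_ge0.
(* Finiteness of the double integral is itself a consequence of the inequality at [e0]. *)
have Dfin : De \is a fin_num.
  rewrite ge0_fin_numE// ltNge leye_eq; apply/negP => /eqP Doo.
  have := key e0 _ e00 (lexx _) erefl.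
  by rewrite Doo gt0_muley ?lte_fin ?exprn_gt0// addey// leye_eq.
rewrite QE -(fineK Dfin) -!EFinM lee_fin.
apply: (@second_order_limit _ Z (fine Qe) (fine De) k M L e0) => //; first exact: fine_ge0.
move=> e t ep ee tE; have := key e t ep ee tE.
by rewrite -(fineK Dfin) -EFinM -EFinD lee_fin.
Qed.

End poincare.

Section potentials.
Context (R : realType) (n : nat).
Implicit Types (V g : 'rV[R]_n -> R) (G : 'rV[R]_n -> 'rV[R]_n).

Definition strongly_convex V := forall l x y, 0 < l -> l < 1 ->
  V ((1 - l) *: x + l *: y) <=
    (1 - l) * V x + l * V y - l * (1 - l) / 2 * dotp (x - y) (x - y).

Definition quad_lower V :=
  exists2 k : R, 0 < k & exists a, forall x, a + k * dotp x x <= V x.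

(** What is kept of the bound on the Hessian. The convexity is stated without derivatives, and the
    quadratic lower bound supplies the Gaussian domination. *)
Definition potential V :=
  [/\ measurable_fun setT V, strongly_convex V & quad_lower V].

Lemma strongly_convex_mid V : strongly_convex V -> forall x y,
  V (2^-1 *: (x + y)) <= (V x + V y) / 2 - 1 / 8 * dotp (x - y) (x - y).
Proof.
move=> sV x y; have h0 : 0 < 2^-1 :> R by rewrite invr_gt0.
have h1 : 2^-1 < 1 :> R by lra.
have := sV _ x y h0 h1; have -> : 1 - 2^-1 = 2^-1 :> R by lra.
by rewrite -scalerDr; lra.
Qed.

Lemma quad_lower_dominated V : quad_lower V -> gauss_dominated (fun x => expR (- V x)).
Proof.
move=> [k k0 [a h]]; exists k => //; exists (expR (- a)) => x.
by rewrite -expRD ler_expR; have := h x; lra.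
Qed.

(* [G] plays the part of the gradient of [g]. *)
Definition gradient_pair g G := [/\ measurable_fun setT g, measurable_fun setT G,
  (exists2 M : R, 0 <= M & forall x y,
    g x - g y <= dotp (G (2^-1 *: (x + y))) (x - y) + M * dotp (x - y) (x - y)) &
  exists2 L : R, 0 <= L & forall x, dotp (G x) (G x) <= L].

Lemma gradient_pair_linear v : gradient_pair (fun x => dotp x v) (fun=> v).
Proof.
split => //.
- exact: measurable_dotp.
- by exists 0 => // x y; rewrite mul0r addr0 dotpDr dotpNr !(dotpC v).
- by exists (dotp v v); rewrite ?dotp_ge0.
Qed.

(** Makes the Poincare inequality available for 2 g - <., v> in [stability]. *)
Lemma gradient_pair_affine g G v : gradient_pair g G ->
  gradient_pair (fun x => 2 * g x - dotp x v) (fun x => 2 *: G x - v).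
Proof.
move=> [mg mG [M M0 gM] [L L0 GL]]; split.
- by apply: measurable_funB; [exact: measurable_funM|exact: measurable_dotp].
- by apply: measurable_rVB => //; exact: measurable_rVZ.
- exists (2 * M); first by rewrite mulr_ge0.
  move=> x y; have := gM x y; set w := G _; set r := dotp (x - y) _.
  by rewrite !dotpE !(dotpC v); lra.
- exists (8 * L + 2 * dotp v v); first by rewrite addr_ge0// mulr_ge0// dotp_ge0.
  move=> x; have := GL x; have := dotp_ge0 (2 *: G x + v); rewrite !dotpE !(dotpC v); lra.
Qed.

End potentials.

(** * Symmetrisation about midpoints *)

Section two_point.
Local Open Scope ereal_scope.
Context (R : realType) (n : nat).
Local Notation lam := (@lebesgue_rV R n).
Implicit Types (V g : 'rV[R]_n -> R) (G : 'rV[R]_n -> 'rV[R]_n).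

(** The change of variables is done one variable at a time: a translation of m at fixed x replaces
    (m + x, m - x) by (m + 2 x, m), then 2 x + m is an affine substitution at fixed m, whence the
    factor 2^-n. *)
Lemma integral_midpoint (F : 'rV[R]_n * 'rV[R]_n -> \bar R) :
  measurable_fun setT F -> (forall z, 0 <= F z) ->
  \int[lam]_m \int[lam]_x F (m + x, m - x)%R = (2 ^- n)%:E * \int[(lam \x lam)]_z F z.
Proof.
move=> mF F0.
have mlin a b : measurable_fun setT (fun z : 'rV[R]_n * 'rV[R]_n => (z.1 + a *: z.2, z.1 + b *: z.2)%R).
  have m1 c : measurable_fun setT (fun z : 'rV[R]_n * 'rV[R]_n => (z.1 + c *: z.2)%R).
    apply: measurable_rVD; first exact: measurable_fst.
    by apply: measurable_rVZ; [exact: measurable_cst|exact: measurable_snd].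
  by apply/measurable_fun_pairP; split; exact: m1.
pose K a b (z : 'rV[R]_n * 'rV[R]_n) := F (z.1 + a *: z.2, z.1 + b *: z.2)%R.
have mK a b : measurable_fun setT (K a b) by exact: (measurableT_comp mF (mlin a b)).
have K0 a b z : 0 <= K a b z by exact: F0.
transitivity (\int[lam]_m \int[lam]_x K 1%R (- 1)%R (m, x)).
  by apply: eq_integral => m _; apply: eq_integral => x _; rewrite /K/= scale1r scaleN1r.
rewrite (fubini_tonelli _ (mK _ _) (K0 _ _)).
transitivity (\int[lam]_x \int[lam]_m K 2%R 0%R (m, x)).
  apply: eq_integral => x _.
  have mx : measurable_fun setT (fun m => K 2%R 0%R (m, x)).
    have mp : measurable_fun setT (fun m : 'rV[R]_n => (m, x)) by exact: pair2_measurable.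
    exact: (measurableT_comp (mK _ _) mp).
  rewrite -(integral_rV_shift (- x)%R mx)//.
  apply: eq_integral => m _; rewrite /K/= scale1r scaleN1r scale0r addr0.
  by rewrite (_ : 2 = 1 + 1)%R// scalerDl scale1r addrA addrNK.
rewrite -(fubini_tonelli _ (mK _ _) (K0 _ _)).
have c0 : (0 <= 2 ^- n :> R)%R by rewrite invr_ge0 exprn_ge0.
have mG := measurable_fun_fubini_tonelli_G (m1 := lam) F mF F0.
rewrite (fubini_tonelli2 _ mF F0) -integral_scalel//; last by move=> x; exact: integral_ge0.
apply: eq_integral => m _.
have mm : measurable_fun setT (fun y => F (y, m)).
  have mp : measurable_fun setT (fun y : 'rV[R]_n => (y, m)) by exact: pair2_measurable.
  exact: (measurableT_comp mF mp).
have n2 : (2 != 0 :> R)%R by [].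
have := integral_rV_affine m n2 mm (fun y => F0 (y, m)).
rewrite normr_nat => <-; apply: eq_integral => x _.
by rewrite /K/= scale0r addr0 addrC.
Qed.

Lemma integral_swapN (F : 'rV[R]_n * 'rV[R]_n -> \bar R) :
  measurable_fun setT F -> (forall z, 0 <= F z) ->
  \int[(lam \x lam)]_z F (z.1, - z.2)%R = \int[(lam \x lam)]_z F z.
Proof.
move=> mF F0.
have m2 : measurable_fun setT (fun z : 'rV[R]_n * 'rV[R]_n => (z.1, - z.2)%R).
  apply/measurable_fun_pairP; split; first exact: measurable_fst.
  by apply: measurable_rVN; exact: measurable_snd.
have mFN : measurable_fun setT (fun z : 'rV[R]_n * 'rV[R]_n => F (z.1, - z.2)%R) by exact: (measurableT_comp mF m2).
rewrite (fubini_tonelli1 _ mFN)// (fubini_tonelli1 _ mF)//.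
apply: eq_integral => x _; rewrite /fubini_F/=.
have mx : measurable_fun setT (fun y => F (x, y)).
  have mp : measurable_fun setT (fun y : 'rV[R]_n => (x, y)) by exact: pair1_measurable.
  exact: (measurableT_comp mF mp).
exact: (integral_rVN mx).
Qed.

(** For fixed m, [W] is even with convexity constant 2, and [h] is odd, hence centred, so that its
    variance is the integral of its square. The Poincare inequality for [W] and [h] thus bounds that
    integral directly. *)
Lemma two_point_slice V g G m : potential V -> gradient_pair g G ->
  \int[lam]_x (2 * (g (m + x) - g (m - x)) ^+ 2 * (expR (- V (m + x)) * expR (- V (m - x))))%:E <=
  \int[lam]_x (dotp (G (m + x) + G (m - x)) (G (m + x) + G (m - x)) *
    (expR (- V (m + x)) * expR (- V (m - x))))%:E.
Proof.
move=> [mV sV [q q0 [a Va]]] [mg mG [M M0 gM] [L L0 GL]].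
pose W x := (V (m + x) + V (m - x))%R.
pose h x := (g (m + x) - g (m - x))%R.
pose H x := (G (m + x) + G (m - x))%R.
have mp : measurable_fun setT (fun x : 'rV[R]_n => m + x)%R by exact: measurable_rVD.
have mm : measurable_fun setT (fun x : 'rV[R]_n => m - x)%R by exact: measurable_rVB.
have mW : measurable_fun setT W.
  by apply: measurable_funD; [exact: (measurableT_comp mV mp)|exact: (measurableT_comp mV mm)].
have mh : measurable_fun setT h.
  by apply: measurable_funB; [exact: (measurableT_comp mg mp)|exact: (measurableT_comp mg mm)].
have mH : measurable_fun setT H.
  by apply: measurable_rVD; [exact: (measurableT_comp mG mp)|exact: (measurableT_comp mG mm)].
have dW : gauss_dominated (fun x => expR (- W x)).
  apply: quad_lower_dominated; exists (2 * q)%R; first by rewrite mulr_gt0.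
  exists (2 * a)%R => x; have := Va (m + x)%R; have := Va (m - x)%R; rewrite /W.
  have : (0 <= q * dotp m m)%R by rewrite mulr_ge0 ?dotp_ge0// ltW.
  by rewrite !dotpE (dotpC x m); lra.
have midp x y : (m + 2^-1 *: (x + y) = 2^-1 *: ((m + x) + (m + y)))%R.
  by apply/rowP => i; rewrite !mxE; lra.
have midm x y : (m - 2^-1 *: (x + y) = 2^-1 *: ((m - x) + (m - y)))%R.
  by apply/rowP => i; rewrite !mxE; lra.
have Wmid x y : (W (2^-1 *: (x + y)) <= (W x + W y) / 2 - 2 / 8 * dotp (x - y) (x - y))%R.
  rewrite /W midp midm; have := strongly_convex_mid sV (m + x)%R (m + y)%R.
  have := strongly_convex_mid sV (m - x)%R (m - y)%R.
  have -> : (m + x - (m + y) = x - y)%R by rewrite opprD addrACA subrr add0r.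
  have -> : (m - x - (m - y) = - (x - y))%R by rewrite opprB addrC addrA subrK opprB.
  by rewrite dotpNl dotpNr opprK; lra.
have hmid x y : (h x - h y <= dotp (H (2^-1 *: (x + y))) (x - y) + (2 * M) * dotp (x - y) (x - y))%R.
  rewrite /h /H midp midm; have := gM (m + x)%R (m + y)%R; have := gM (m - y)%R (m - x)%R.
  have -> : (m + x - (m + y) = x - y)%R by rewrite opprD addrACA subrr add0r.
  have -> : (m - y - (m - x) = x - y)%R by rewrite opprB addrC addrA subrK.
  rewrite [(m - y + (m - x))%R]addrC (dotpDl (G _) (G _)); lra.
have HL x : (dotp (H x) (H x) <= 4 * L)%R.
  have := GL (m + x)%R; have := GL (m - x)%R; have := dotp_ge0 (G (m + x) - G (m - x))%R.
  by rewrite /H !dotpE (dotpC (G (m - x)%R)); lra.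
have L4 : (0 <= 4 * L)%R by rewrite mulr_ge0.
have M2 : (0 <= 2 * M)%R by rewrite mulr_ge0.
have := poincare mW mh mH (ltr0Sn _ 1) M2 L4 dW Wmid hmid HL.
rewrite divff// mul1e.
have Wfin := mass_gt0 mW dW.
have meW : measurable_fun setT (fun x => expR (- W x)) by exact: measurable_expRN.
set LHS := \int[_]_z _; set A := \int[lam]_x _ => PW.
have hN x : h (- x)%R = (- h x)%R by rewrite /h opprK opprB.
have WN x : W (- x)%R = W x by rewrite /W opprK addrC.
pose F (z : 'rV[R]_n * 'rV[R]_n) : \bar R := ((h z.1 - h z.2) ^+ 2 * (expR (- W z.1) * expR (- W z.2)))%:E.
have mh1 : measurable_fun setT (fun z : 'rV[R]_n * 'rV[R]_n => h z.1) by exact: (measurableT_comp mh measurable_fst).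
have mh2 : measurable_fun setT (fun z : 'rV[R]_n * 'rV[R]_n => h z.2) by exact: (measurableT_comp mh measurable_snd).
have mF : measurable_fun setT F.
  apply/measurable_EFinP; apply: measurable_funM.
    exact: (measurable_funX 2 (measurable_funB mh1 mh2)).
  apply: measurable_funM.
    exact: (measurableT_comp meW measurable_fst).
  exact: (measurableT_comp meW measurable_snd).
have F0 z : 0 <= F z.
  rewrite /F lee_fin; apply: mulr_ge0; first exact: sqr_ge0.
  by apply: mulr_ge0; exact: expR_ge0.
pose B := \int[lam]_x (2 * h x ^+ 2 * expR (- W x))%:E.
have mB : measurable_fun setT (fun x => 2 * h x ^+ 2 * expR (- W x))%R.
  by apply: measurable_funM => //; apply: measurable_funM => //; exact: measurable_funX.
have B0 x : (0 <= 2 * h x ^+ 2 * expR (- W x))%R.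
  by apply: mulr_ge0; [apply: mulr_ge0; rewrite ?sqr_ge0|exact: expR_ge0].
have Woo : \int[lam]_x (expR (- W x))%:E < +oo by rewrite -massE// ltry.
(* Adding the reflection y |-> - y kills the cross term: (h x - h y)^2 + (h x + h y)^2 = 2 (h x)^2 +
   2 (h y)^2. *)
have LE : LHS + LHS = (mass W)%:E * B + (mass W)%:E * B.
  rewrite {2}/LHS -/(\int[(lam \x lam)]_z F z) -(integral_swapN mF F0) /LHS -integral_add//; last first.
    have m2 : measurable_fun setT (fun z : 'rV[R]_n * 'rV[R]_n => (z.1, - z.2)%R).
      apply/measurable_fun_pairP; split; first exact: measurable_fst.
      by apply: measurable_rVN; exact: measurable_snd.
    exact: (measurableT_comp mF m2).
  pose F1 (z : 'rV[R]_n * 'rV[R]_n) := ((2 * h z.1 ^+ 2 * expR (- W z.1)) * expR (- W z.2))%:E.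
  have mF1 : measurable_fun setT F1.
    apply/measurable_EFinP; apply: measurable_funM.
      exact: (measurableT_comp mB measurable_fst).
    exact: (measurableT_comp meW measurable_snd).
  have F10 z : 0 <= F1 z by rewrite lee_fin mulr_ge0 ?expR_ge0.
  have F1E : \int[(lam \x lam)]_z F1 z = (mass W)%:E * B.
    by rewrite /F1 (integral_prod_mul mB meW B0 (fun=> expR_ge0 _) Woo) -massE// muleC.
  have F1E' : \int[(lam \x lam)]_z F1 (z.2, z.1) = (mass W)%:E * B by rewrite integral_prod_swap.
  rewrite -{1}F1E -F1E' -integral_add//; last first.
    exact: (measurableT_comp mF1 (@measurable_swap _ _ _ _)).
  apply: eq_integral => z _; rewrite /F /F1/= hN WN -!EFinD; congr EFin; ring.
have Bfin : B <= A.
  rewrite -(@lee_pmul2l _ (mass W)%:E)// ?lte_fin//.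
  have [Xoo|] := eqVneq ((mass W)%:E * A) +oo; first by rewrite Xoo leey.
  move=> Xoo; have A0 : 0 <= A.
    by apply: integral_ge0 => x _; rewrite lee_fin mulr_ge0 ?dotp_ge0 ?expR_ge0.
  have XA0 : 0 <= (mass W)%:E * A by rewrite mule_ge0// lee_fin ltW.
  have L0' : 0 <= LHS by apply: integral_ge0 => z _; exact: F0.
  have Lfin : LHS \is a fin_num by rewrite ge0_fin_numE// (le_lt_trans PW)// ltey.
  apply: le_trans PW.
  have : (mass W)%:E * B + (mass W)%:E * B <= LHS + LHS by rewrite LE.
  have mB0 : 0 <= (mass W)%:E * B.
    by rewrite mule_ge0 ?lee_fin ?(ltW Wfin)//; apply: integral_ge0 => x _; rewrite lee_fin.
  rewrite -(fineK Lfin); case: (_ * B) mB0 => [r| |]// r0.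
  by rewrite -!EFinD !lee_fin; lra.
move: Bfin; rewrite /B /A /h /H /W.
by under eq_integral do rewrite opprD expRD;
   under [X in _ <= X -> _]eq_integral do rewrite opprD expRD.
Qed.

(** Pairs are sorted by midpoint: the slices are integrated over [m], and both sides pick up the
    same factor 2^-n. *)
Theorem two_point_poincare V g G : potential V -> gradient_pair g G ->
  \int[(lam \x lam)]_z (2 * (g z.1 - g z.2) ^+ 2 * (expR (- V z.1) * expR (- V z.2)))%:E <=
  \int[(lam \x lam)]_z (dotp (G z.1 + G z.2) (G z.1 + G z.2) * (expR (- V z.1) * expR (- V z.2)))%:E.
Proof.
move=> pV gG; have [mV _ _] := pV; have [mg mG _ _] := gG.
have meV : measurable_fun setT (fun x => expR (- V x)) by exact: measurable_expRN.
have mE : measurable_fun setT (fun z : 'rV[R]_n * 'rV[R]_n => expR (- V z.1) * expR (- V z.2))%R.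
  apply: measurable_funM.
    exact: (measurableT_comp meV measurable_fst).
  exact: (measurableT_comp meV measurable_snd).
have mg1 : measurable_fun setT (fun z : 'rV[R]_n * 'rV[R]_n => g z.1) by exact: (measurableT_comp mg measurable_fst).
have mg2 : measurable_fun setT (fun z : 'rV[R]_n * 'rV[R]_n => g z.2) by exact: (measurableT_comp mg measurable_snd).
have mG1 : measurable_fun setT (fun z : 'rV[R]_n * 'rV[R]_n => G z.1) by exact: (measurableT_comp mG measurable_fst).
have mG2 : measurable_fun setT (fun z : 'rV[R]_n * 'rV[R]_n => G z.2) by exact: (measurableT_comp mG measurable_snd).
pose F1 (z : 'rV[R]_n * 'rV[R]_n) := (2 * (g z.1 - g z.2) ^+ 2 * (expR (- V z.1) * expR (- V z.2)))%:E.
pose F2 (z : 'rV[R]_n * 'rV[R]_n) := (dotp (G z.1 + G z.2) (G z.1 + G z.2) * (expR (- V z.1) * expR (- V z.2)))%:E.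
have mF1 : measurable_fun setT F1.
  apply/measurable_EFinP; apply: measurable_funM => //; apply: measurable_funM => //.
  exact: (measurable_funX 2 (measurable_funB mg1 mg2)).
have mF2 : measurable_fun setT F2.
  apply/measurable_EFinP; apply: measurable_funM => //.
  by apply: measurable_dotp; exact: measurable_rVD.
have F10 z : 0 <= F1 z.
  by rewrite /F1 lee_fin; apply: mulr_ge0; apply: mulr_ge0; rewrite ?sqr_ge0 ?expR_ge0.
have F20 z : 0 <= F2 z by rewrite lee_fin !mulr_ge0 ?dotp_ge0 ?expR_ge0.
have c0 : 0 < (2 ^- n : R)%:E by rewrite lte_fin invr_gt0 exprn_gt0.
rewrite -(@lee_pmul2l _ (2 ^- n)%:E)//.
rewrite -(integral_midpoint mF1 F10) -(integral_midpoint mF2 F20).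
have mS (F : 'rV[R]_n * 'rV[R]_n -> \bar R) : measurable_fun setT F ->
    measurable_fun setT (fun z : 'rV[R]_n * 'rV[R]_n => F (z.1 + z.2, z.1 - z.2)%R).
  move=> mF; have m2 : measurable_fun setT (fun z : 'rV[R]_n * 'rV[R]_n => (z.1 + z.2, z.1 - z.2)%R).
    apply/measurable_fun_pairP; split.
      by apply: measurable_rVD; [exact: measurable_fst|exact: measurable_snd].
    by apply: measurable_rVB; [exact: measurable_fst|exact: measurable_snd].
  exact: (measurableT_comp mF m2).
apply: integral_le.
- exact: (measurable_fun_fubini_tonelli_F _ (mS _ mF1)).
- exact: (measurable_fun_fubini_tonelli_F _ (mS _ mF2)).
- by move=> m; exact: integral_ge0.
- by move=> m; exact: two_point_slice.
Qed.

End two_point.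

(** * Stability of the Poincare inequality *)

Section product_marginals.
Local Open Scope ereal_scope.
Context d1 d2 (T1 : measurableType d1) (T2 : measurableType d2) (R : realType).
Variables (P1 : probability T1 R) (P2 : probability T2 R).

Lemma integral_prod_fst (k : T1 -> \bar R) : measurable_fun setT k -> (forall x, 0 <= k x) ->
  \int[(P1 \x P2)]_z k z.1 = \int[P1]_x k x.
Proof.
move=> mk k0; have mk1 : measurable_fun setT (fun z : T1 * T2 => k z.1).
  exact: (measurableT_comp mk measurable_fst).
rewrite (fubini_tonelli1 _ mk1)//; apply: eq_integral => x _.
by rewrite /fubini_F/= integral_cst//= probability_setT mule1.
Qed.

Lemma integral_prod_snd (k : T2 -> \bar R) : measurable_fun setT k -> (forall x, 0 <= k x) ->
  \int[(P1 \x P2)]_z k z.2 = \int[P2]_x k x.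
Proof.
move=> mk k0; have mk1 : measurable_fun setT (fun z : T1 * T2 => k z.2).
  exact: (measurableT_comp mk measurable_snd).
rewrite (fubini_tonelli2 _ mk1)//; apply: eq_integral => x _.
by rewrite /fubini_G/= integral_cst//= probability_setT mule1.
Qed.

End product_marginals.

Section doubled_variance.
Local Open Scope ereal_scope.
Context d (T : measurableType d) (R : realType) (mu : probability T R).
Implicit Types f g : T -> R.

(** Written without the mean, so that it makes sense in [0, +oo] for every measurable [f]. *)
Definition dvar f : \bar R := \int[(mu \x mu)]_z ((f z.1 - f z.2) ^+ 2)%:E.

Lemma measurable_dvar f : measurable_fun setT f ->
  measurable_fun setT (fun z : T * T => ((f z.1 - f z.2) ^+ 2)%:E).
Proof.
move=> mf; apply/measurable_EFinP; apply: (@measurable_funX _ _ _ _ _ 2).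
apply: measurable_funB.
  exact: (measurableT_comp mf measurable_fst).
exact: (measurableT_comp mf measurable_snd).
Qed.

Lemma dvar_ge0 f : 0 <= dvar f.
Proof. by apply: integral_ge0 => z _; rewrite lee_fin sqr_ge0. Qed.

Lemma integral_bounded_fin (f : T -> R) (L : R) : measurable_fun setT f ->
  (forall x, (0 <= f x <= L)%R) -> \int[mu]_x (f x)%:E \is a fin_num.
Proof.
move=> mf fL; rewrite ge0_fin_numE; last first.
  by apply: integral_ge0 => x _; rewrite lee_fin; case/andP: (fL x).
apply: (@le_lt_trans _ _ (\int[mu]_x (cst L%:E) x)).
  apply: integral_le => //; first exact/measurable_EFinP.
  - by move=> x; rewrite lee_fin; case/andP: (fL x).
  - by move=> x; rewrite lee_fin; case/andP: (fL x).
by rewrite integral_cst//= probability_setT mule1 ltry.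
Qed.

(** Otherwise f - c would be positive everywhere with nonpositive integral. It selects a good value
    of a function where one would expect its mean. *)
Lemma exists_le_integral (f : T -> \bar R) (c : R) : measurable_fun setT f ->
  (forall x, 0 <= f x) -> (0 <= c)%R -> \int[mu]_x f x <= c%:E -> exists x, f x <= c%:E.
Proof.
move=> mf f0 c0 fc; apply: contrapT => /forallNP h.
have {}h x : c%:E < f x by rewrite ltNge; apply/negP.
have md : measurable_fun setT (fun x => f x - c%:E) by exact: emeasurable_funB.
have d0 x : 0 < f x - c%:E by rewrite sube_gt0.
have : 0 < \int[mu]_x (f x - c%:E).
  have h1 : 0 < mu setT by rewrite probability_setT.
  exact: integral_gt0.
have := fc; rewrite (_ : \int[mu]_x f x = \int[mu]_x (cst c%:E x + (f x - c%:E))); last first.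
  by apply: eq_integral => x _; rewrite /cst addeC subeK.
rewrite integral_add//; last by move=> x; exact: ltW.
rewrite integral_cst//= probability_setT mule1.
case: (\int[mu]_x _) => [r| |]//; rewrite -?EFinD ?lee_fin ?lte_fin; first lra.
Qed.

End doubled_variance.

Section stability.
Local Open Scope ereal_scope.
Context (R : realType) (n : nat) (V : 'rV[R]_n -> R) (mu : probability 'rV[R]_n R).
Local Notation lam := (@lebesgue_rV R n).
Hypothesis pV : potential V.
Hypothesis muE : forall A, measurable A -> mu A = \int[lam]_(x in A) (expR (- V x))%:E.

Let mV : measurable_fun setT V. Proof. by case: pV. Qed.

Let meV : measurable_fun setT (fun x => expR (- V x)).
Proof. exact: measurable_expRN. Qed.

Lemma integral_mu (f : 'rV[R]_n -> \bar R) : measurable_fun setT f ->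
  (forall x, 0 <= f x) -> \int[mu]_x f x = \int[lam]_x (f x * (expR (- V x))%:E).
Proof. by move=> mf f0; apply: integral_density => // x; exact: expR_ge0. Qed.

Lemma integral_mu2 (F : 'rV[R]_n * 'rV[R]_n -> \bar R) : measurable_fun setT F ->
  (forall z, 0 <= F z) ->
  \int[(mu \x mu)]_z F z =
  \int[(lam \x lam)]_z (F z * (expR (- V z.1) * expR (- V z.2))%:E).
Proof.
move=> mF F0.
have mE : measurable_fun setT (fun z : 'rV[R]_n * 'rV[R]_n => expR (- V z.1) * expR (- V z.2))%R.
  apply: measurable_funM.
    exact: (measurableT_comp meV measurable_fst).
  exact: (measurableT_comp meV measurable_snd).
have mFE : measurable_fun setT (fun z : 'rV[R]_n * 'rV[R]_n => F z * (expR (- V z.1) * expR (- V z.2))%:E).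
  by apply: emeasurable_funM => //; exact/measurable_EFinP.
have FE0 z : 0 <= F z * (expR (- V z.1) * expR (- V z.2))%:E.
  by rewrite mule_ge0// lee_fin mulr_ge0 ?expR_ge0.
rewrite (fubini_tonelli1 _ mF)// (fubini_tonelli1 _ mFE)// integral_mu; last 2 first.
- exact: measurable_fun_fubini_tonelli_F.
- by move=> x; exact: integral_ge0.
apply: eq_integral => x _; rewrite /fubini_F.
have mFx : measurable_fun setT (fun y => F (x, y)).
  have mp : measurable_fun setT (fun y : 'rV[R]_n => (x, y)) by exact: pair1_measurable.
  exact: (measurableT_comp mF mp).
rewrite integral_mu// -integral_scaler; [|exact: expR_ge0| |]; last 2 first.
- by apply: emeasurable_funM => //; exact/measurable_EFinP.
- by move=> y; rewrite mule_ge0// lee_fin expR_ge0.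
by apply: eq_integral => y _; rewrite -muleA -EFinM mulrC.
Qed.

Lemma mass_mu : mass V = 1%R.
Proof. by rewrite /mass -[RHS]/(fine 1) -(probability_setT mu) muE. Qed.

Lemma poincare_mu (g : 'rV[R]_n -> R) G : gradient_pair g G ->
  dvar mu g <= 2%:E * \int[mu]_x (dotp (G x) (G x))%:E.
Proof.
move=> [mg mG [M M0 gM] [L L0 GL]]; have [_ sV lV] := pV.
have mGG : measurable_fun setT (fun x => dotp (G x) (G x)) by exact: measurable_dotp.
have := poincare mV mg mG ltr01 M0 L0 (quad_lower_dominated lV) (strongly_convex_mid sV) gM GL.
rewrite mass_mu mul1e divr1 /dvar integral_mu2; last 2 first.
- exact: measurable_dvar.
- by move=> z; rewrite lee_fin sqr_ge0.
rewrite integral_mu; [|exact/measurable_EFinP|by move=> x; rewrite lee_fin dotp_ge0].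
by [].
Qed.

Lemma two_point_mu (g : 'rV[R]_n -> R) G : gradient_pair g G ->
  2%:E * dvar mu g <= \int[(mu \x mu)]_z (dotp (G z.1 + G z.2) (G z.1 + G z.2))%:E.
Proof.
move=> gG; have [mg mG _ _] := gG; have tp := two_point_poincare pV gG.
have mG1 : measurable_fun setT (fun z : 'rV[R]_n * 'rV[R]_n => G z.1) by exact: (measurableT_comp mG measurable_fst).
have mG2 : measurable_fun setT (fun z : 'rV[R]_n * 'rV[R]_n => G z.2) by exact: (measurableT_comp mG measurable_snd).
rewrite /dvar -integral_scalel; [|by []|exact: measurable_dvar|by move=> z; rewrite lee_fin sqr_ge0].
rewrite [leLHS]integral_mu2; last 2 first.
- by apply: measurable_funeM; exact: measurable_dvar.
- by move=> z; rewrite mule_ge0// lee_fin sqr_ge0.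
rewrite [leRHS]integral_mu2; last 2 first.
- by apply/measurable_EFinP; apply: measurable_dotp; exact: measurable_rVD.
- by move=> z; rewrite lee_fin dotp_ge0.
exact: tp.
Qed.

(** [D] is the doubled variance of g; [Q], [S], [P] are the squared norms of G, G - v, 2 G - v; [A]
    and [B] those of G x + G y and G x - G y; [L0] is the doubled variance of <., v> and [s2] is
    |v|^2. The first three hypotheses give B <= 4 (1 - c) Q, and S obeys the same bound. Then L0 >=
    2 D - 2 P >= 2 s2 - 20 (1 - c) Q, where 20 = 4 + 4 * 4, and Q <= 4 s2 turns 20 into 80. The
    threshold 1/16 makes S <= Q / 4, whence Q <= 4 s2. *)
Let real_stability (D Q A B P S L0 s2 c : R) :
  (A + B = 4 * Q)%R -> (2 * D <= A)%R -> (2 * c * Q <= D)%R -> (S <= B)%R ->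
  (P + s2 = 2 * Q + 2 * S)%R -> (2 * D <= L0 + 2 * P)%R -> (Q <= 2 * S + 2 * s2)%R ->
  (0 <= Q)%R -> (c <= 1)%R -> (1 - c <= 16^-1)%R -> ((2 - 80 * (1 - c)) * s2 <= L0)%R /\ (Q <= 4 * s2)%R.
Proof.
move=> AB DA cD SB PS LP QS Q0 c1 c16.
have SQ : (S <= 4 * (1 - c) * Q)%R by lra.
have S4 : (S <= 4^-1 * Q)%R by apply: (le_trans SQ); rewrite ler_wpM2r//; lra.
have Q4 : (Q <= 4 * s2)%R by lra.
have h : (20 * (1 - c) * Q <= 80 * (1 - c) * s2)%R.
  have c1' : (0 <= 20 * (1 - c))%R by lra.
  have := ler_wpM2l c1' Q4; lra.
split=> //; lra.
Qed.

Theorem stability (g : 'rV[R]_n -> R) G (c : R) : gradient_pair g G ->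
  (c <= 1)%R -> (1 - c <= 16^-1)%R ->
  0 < dvar mu g -> (2 * c)%:E * \int[mu]_x (dotp (G x) (G x))%:E <= dvar mu g ->
  exists2 s : 'rV[R]_n, dotp s s = 1%R &
    (2 - 80 * (1 - c))%:E <= dvar mu (fun x => dotp x s).
Proof.
move=> gG c1 c16 Dpos cD; have [mg mG _ [L L0 GL]] := gG.
pose Q := \int[mu]_x (dotp (G x) (G x))%:E.
have mGG : measurable_fun setT (fun x => dotp (G x) (G x)) by exact: measurable_dotp.
have Qfin : Q \is a fin_num.
  by apply: (@integral_bounded_fin _ _ _ _ _ L) => // x; rewrite dotp_ge0 GL.
have Q0 : 0 <= Q by apply: integral_ge0 => x _; rewrite lee_fin dotp_ge0.
have DQ : dvar mu g <= 2%:E * Q by exact: poincare_mu.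
have Dfin : dvar mu g \is a fin_num.
  by rewrite ge0_fin_numE ?dvar_ge0// (le_lt_trans DQ)// -(fineK Qfin) -EFinM ltry.
have mG1 : measurable_fun setT (fun z : 'rV[R]_n * 'rV[R]_n => G z.1) by exact: (measurableT_comp mG measurable_fst).
have mG2 : measurable_fun setT (fun z : 'rV[R]_n * 'rV[R]_n => G z.2) by exact: (measurableT_comp mG measurable_snd).
pose A := \int[(mu \x mu)]_z (dotp (G z.1 + G z.2) (G z.1 + G z.2))%:E.
pose B := \int[(mu \x mu)]_z (dotp (G z.1 - G z.2) (G z.1 - G z.2))%:E.
have mA : measurable_fun setT (fun z : 'rV[R]_n * 'rV[R]_n => (dotp (G z.1 + G z.2) (G z.1 + G z.2))%:E).
  by apply/measurable_EFinP; apply: measurable_dotp; exact: measurable_rVD.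
have mB : measurable_fun setT (fun z : 'rV[R]_n * 'rV[R]_n => (dotp (G z.1 - G z.2) (G z.1 - G z.2))%:E).
  by apply/measurable_EFinP; apply: measurable_dotp; exact: measurable_rVB.
have Bz (z : 'rV[R]_n * 'rV[R]_n) : 0 <= (dotp (G z.1 - G z.2) (G z.1 - G z.2))%:E.
  by rewrite lee_fin dotp_ge0.
have A0 : 0 <= A by apply: integral_ge0 => z _; rewrite lee_fin dotp_ge0.
have B0 : 0 <= B by apply: integral_ge0 => z _; rewrite lee_fin dotp_ge0.
have mQe : measurable_fun setT (fun x => (dotp (G x) (G x))%:E) by exact/measurable_EFinP.
have Qe0 x : 0 <= (dotp (G x) (G x))%:E by rewrite lee_fin dotp_ge0.
have AB : A + B = 4%:E * Q.
  rewrite /A /B -integral_add; [|exact: mA|exact: mB|by move=> z; rewrite lee_fin dotp_ge0|exact: Bz].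
  have m1 : measurable_fun setT (fun z : 'rV[R]_n * 'rV[R]_n => (dotp (G z.1) (G z.1))%:E).
    exact: (measurableT_comp mQe measurable_fst).
  have m2 : measurable_fun setT (fun z : 'rV[R]_n * 'rV[R]_n => (dotp (G z.2) (G z.2))%:E).
    exact: (measurableT_comp mQe measurable_snd).
  transitivity (\int[(mu \x mu)]_z (2%:E * (dotp (G z.1) (G z.1))%:E + 2%:E * (dotp (G z.2) (G z.2))%:E)).
    apply: eq_integral => z _; rewrite -!EFinM -!EFinD; congr EFin.
    by rewrite !dotpE (dotpC (G z.2)); ring.
  rewrite integral_add; [|exact: measurable_funeM|exact: measurable_funeM| |]; last 2 first.
  - by move=> z; rewrite mule_ge0.
  - by move=> z; rewrite mule_ge0.
  rewrite integral_scalel//; rewrite integral_scalel//.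
  rewrite (integral_prod_fst mu mu mQe Qe0) (integral_prod_snd mu mu mQe Qe0) -/Q -(fineK Qfin) -!EFinM -EFinD.
  by congr EFin; ring.
have ABfin : A + B \is a fin_num by rewrite AB -(fineK Qfin) -EFinM.
have Afin : A \is a fin_num by move: ABfin; rewrite fin_numD => /andP[].
have Bfin : B \is a fin_num by move: ABfin; rewrite fin_numD => /andP[].
have DA : 2%:E * dvar mu g <= A by exact: two_point_mu.
(* The constant vector is a value of [G], at a point where the mean squared distance to [G] is at
   most its average [B]. *)
have [y Sy] : exists y, \int[mu]_x (dotp (G x - G y) (G x - G y))%:E <= (fine B)%:E.
  apply: (exists_le_integral (mu := mu)).
  - exact: (measurable_fun_fubini_tonelli_G (m1 := mu) _ mB Bz).
  - by move=> y; apply: integral_ge0 => x _; rewrite lee_fin dotp_ge0.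
  - exact: fine_ge0.
  - by rewrite fineK// /B (fubini_tonelli2 _ mB)// => z; rewrite lee_fin dotp_ge0.
set v := G y in Sy.
pose S := \int[mu]_x (dotp (G x - v) (G x - v))%:E; rewrite -/S in Sy.
pose P := \int[mu]_x (dotp (2 *: G x - v) (2 *: G x - v))%:E.
have S0 : 0 <= S by apply: integral_ge0 => z _; rewrite lee_fin dotp_ge0.
have Sfin : S \is a fin_num by rewrite ge0_fin_numE// (le_lt_trans Sy)// ltry.
have mv : measurable_fun setT (fun _ : 'rV[R]_n => v) by exact: measurable_cst.
have m2G : measurable_fun setT (fun x => 2 *: G x)%R by exact: measurable_rVZ.
have mS : measurable_fun setT (fun x => (dotp (G x - v) (G x - v))%:E).
  by apply/measurable_EFinP; apply: measurable_dotp; exact: measurable_rVB.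
have mP : measurable_fun setT (fun x => (dotp (2 *: G x - v) (2 *: G x - v))%:E).
  by apply/measurable_EFinP; apply: measurable_dotp; exact: measurable_rVB.
pose s2 := dotp v v.
have cstE (r : R) : \int[mu]_x (cst r%:E x) = r%:E by rewrite integral_cst//= probability_setT mule1.
(* Parallelogram identity for G and G - v, whose sum is 2 G - v and whose difference is v. *)
have PS : P + s2%:E = 2%:E * Q + 2%:E * S.
  have Sx x : 0 <= (dotp (G x - v) (G x - v))%:E by rewrite lee_fin dotp_ge0.
  have Px x : 0 <= (dotp (2 *: G x - v) (2 *: G x - v))%:E by rewrite lee_fin dotp_ge0.
  have s20 (x : 'rV[R]_n) : 0 <= cst s2%:E x by rewrite lee_fin dotp_ge0.
  have mc : measurable_fun setT (cst s2%:E : 'rV[R]_n -> \bar R) by exact: measurable_cst.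
  rewrite -(cstE s2) /Q /S -(@integral_scalel _ _ _ mu 2%R _ (ler0n _ 2) mQe Qe0).
  rewrite -(@integral_scalel _ _ _ mu 2%R _ (ler0n _ 2) mS Sx).
  rewrite -(integral_add mu mP mc Px s20) -integral_add; last 4 first.
  - exact: measurable_funeM.
  - exact: measurable_funeM.
  - by move=> x; rewrite mule_ge0.
  - by move=> x; rewrite mule_ge0.
  apply: eq_integral => x _; rewrite /cst -!EFinM -!EFinD; congr EFin.
  by rewrite /s2 !dotpE (dotpC v); ring.
have P0 : 0 <= P by apply: integral_ge0 => z _; rewrite lee_fin dotp_ge0.
have Pfin : P \is a fin_num.
  have : P + s2%:E \is a fin_num by rewrite PS -(fineK Qfin) -(fineK Sfin) -!EFinM -EFinD.
  by rewrite fin_numD => /andP[].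
have gl := gradient_pair_linear v; have ga := gradient_pair_affine v gG.
have [ml _ _ _] := gl; have [ma _ _ _] := ga.
have DP : dvar mu (fun x => 2 * g x - dotp x v)%R <= 2%:E * P by exact: poincare_mu ga.
have Dl : dvar mu (fun x => dotp x v) <= 2%:E * s2%:E.
  by rewrite -(cstE s2); exact: poincare_mu gl.
set Lv := dvar mu (fun x => dotp x v) in Dl.
have Lfin : Lv \is a fin_num by rewrite ge0_fin_numE ?dvar_ge0// (le_lt_trans Dl)// -EFinM ltry.
(* Integrates 2 a^2 <= w^2 + (2 a - w)^2, where a and w are the increments of g and of <., v>. *)
have LP : 2%:E * dvar mu g <= Lv + 2%:E * P.
  apply: (@le_trans _ _ (Lv + dvar mu (fun x => 2 * g x - dotp x v)%R)); last by rewrite leeD2l.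
  rewrite /Lv /dvar -integral_scalel; [|by []|exact: measurable_dvar|by move=> z; rewrite lee_fin sqr_ge0].
  rewrite -(integral_add _ (measurable_dvar ml) (measurable_dvar ma)); last 2 first.
  - by move=> z; rewrite lee_fin sqr_ge0.
  - by move=> z; rewrite lee_fin sqr_ge0.
  apply: integral_le.
  - by apply: measurable_funeM; exact: measurable_dvar.
  - exact: (emeasurable_funD (measurable_dvar ml) (measurable_dvar ma)).
  - by move=> z; rewrite mule_ge0// lee_fin sqr_ge0.
  - move=> z; rewrite -EFinM -EFinD lee_fin.
    set a := g _; set b := g _; set u := dotp _ _; set w := dotp _ _.
    by have := sqr_ge0 ((a - b) - (u - w))%R; lra.
have QS : Q <= 2%:E * S + 2%:E * s2%:E.
  rewrite -(cstE s2) -integral_scalel//; last by move=> x; rewrite lee_fin dotp_ge0.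
  rewrite -integral_scalel//; last by move=> x; rewrite lee_fin dotp_ge0.
  rewrite -integral_add; last 4 first.
  - exact: measurable_funeM.
  - exact: measurable_funeM.
  - by move=> x; rewrite mule_ge0// lee_fin dotp_ge0.
  - by move=> x; rewrite mule_ge0// lee_fin dotp_ge0.
  apply: integral_le => //.
  - by apply: emeasurable_funD; exact: measurable_funeM.
  - move=> x; rewrite /cst -!EFinM -EFinD lee_fin /s2.
    by have := dotp_ge0 (G x - 2 *: v)%R; rewrite !dotpE (dotpC v); lra.
move: Dpos cD DQ DA AB LP PS Sy QS Q0.
rewrite -/Q -(fineK Qfin) -(fineK Dfin) -(fineK Afin) -(fineK Bfin) -(fineK Lfin) -(fineK Pfin) -(fineK Sfin).
rewrite -?EFinM -?EFinD ?lee_fin ?lte_fin => Dpos cD DQ DA [AB] LP [PS] Sy QS Q0.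
have [h1 h2] := real_stability AB DA cD Sy PS LP QS Q0 c1 c16.
(* The doubled variance of g is positive, so Q > 0, and Q <= 4 s2: the vector can be normalised. *)
have s20 : (0 < s2)%R by lra.
exists ((Num.sqrt s2)^-1 *: v).
  rewrite dotpZl dotpZr -/s2 mulrA -expr2 exprVn sqr_sqrtr ?ltW// mulVf// gt_eqF//.
have -> : dvar mu (fun x => dotp x ((Num.sqrt s2)^-1 *: v)) = (s2^-1)%:E * Lv.
  rewrite /Lv /dvar -integral_scalel; [|by rewrite invr_ge0 ltW|exact: (measurable_dvar ml)|by move=> z; rewrite lee_fin sqr_ge0].
  apply: eq_integral => z _; rewrite -EFinM !dotpZr -mulrBr exprMn exprVn sqr_sqrtr//.
  exact: ltW.
by rewrite -(fineK Lfin) -EFinM lee_fin [leRHS]mulrC ler_pdivlMr.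
Qed.

End stability.

(** * Disintegration along a direction *)

Section slicing.
Local Open Scope ereal_scope.
Context (R : realType) (n : nat).
Local Notation leb := (@lebesgue_measure R).
Local Notation lam := (@lebesgue_rV R n).
Local Notation lamS := (@lebesgue_rV R n.+1).

(* Linear coordinates adapted to the hyperplanes orthogonal to [s] *)
Definition slicing (s : 'rV[R]_n.+1) (c K : R)
    (L : measurableTypeR R * 'rV[R]_n -> 'rV[R]_n.+1) := [/\ (0 < c)%R,
  measurable_fun setT L,
  (forall l t t' y y', L ((1 - l) * t + l * t', (1 - l) *: y + l *: y')%R =
     ((1 - l) *: L (t, y) + l *: L (t', y'))%R),
  (forall t y, dotp (L (t, y)) s = t) &
  (0 < K)%R /\ (forall t y, (K * dotp y y <= dotp (L (t, y)) (L (t, y)))%R) /\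
  forall h : 'rV[R]_n.+1 -> \bar R, measurable_fun setT h -> (forall x, 0 <= h x) ->
    \int[lamS]_x h x = c%:E * \int[leb]_t \int[lam]_y h (L (t, y))].

(** Explicit shears instead of an orthonormal basis. With s = (s0, b), the point is (z, y + z tau),
    where z is determined by asking that its product with s be t; solving divides by a = s0 + <tau,
    b>. A translation of y by z tau followed by an affine substitution in z gives the Jacobian 1 /
    |a|. *)
Lemma slicing_exists (s : 'rV[R]_n.+1) : dotp s s = 1%R ->
  exists c K L, slicing s c K L.
Proof.
move=> s1; rewrite (cons_rV_eta s) in s1 *.
move: (s 0%R ord0) (\row_j s 0%R (lift ord0 j)) s1 => s0 b {s}; rewrite dotp_cons => s1.
(* The sign of [tau] follows that of [s0], so that the two terms of [a] never cancel. *)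
pose tau := if (0 <= s0)%R then b else (- b)%R.
pose a := (s0 + dotp tau b)%R.
have a0 : (a != 0)%R.
  rewrite /a /tau; have b0 := dotp_ge0 b; case: leP => s00; last first.
    by rewrite lt_eqF// dotpNl; lra.
  have [s0E|s0N] := eqVneq s0 0%R.
    by move: s1; rewrite s0E mul0r !add0r => ->; exact: oner_neq0.
  by rewrite gt_eqF// ltr_pwDl// lt0r s0N.
pose z0 (t : R) (y : 'rV[R]_n) := ((t - dotp b y) / a)%R.
pose L (p : measurableTypeR R * 'rV[R]_n) := cons_rV (z0 p.1 p.2, p.2 + z0 p.1 p.2 *: tau)%R.
have mz0 : measurable_fun setT (fun p : measurableTypeR R * 'rV[R]_n => z0 p.1 p.2).
  apply: measurable_funM => //; apply: measurable_funB; first exact: measurable_fst.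
  by apply: measurable_dotp; [exact: measurable_cst|exact: measurable_snd].
have mL : measurable_fun setT L.
  apply: measurable_cons_rV_fun => //; apply: measurable_rVD; first exact: measurable_snd.
  by apply: measurable_rVZ => //; exact: measurable_cst.
(* The second constant comes from y = w - z tau, with w the tail of L (t, y): |y|^2 <= 2 |w|^2 + 2
   z^2 |tau|^2. *)
exists (`|a|^-1)%R, (2 * (1 + dotp tau tau))^-1%R, L; split => //.
- by rewrite invr_gt0 normr_gt0.
- move=> l t t' y y'; rewrite /L/= !cons_rVZ cons_rVD.
  have -> : z0 ((1 - l) * t + l * t')%R ((1 - l) *: y + l *: y')%R =
      ((1 - l) * z0 t y + l * z0 t' y')%R.
    by rewrite /z0 !dotpE; ring.
  by congr (cons_rV (_, _)); apply/rowP => i; rewrite !mxE; ring.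
- move=> t y; rewrite /L/= dotp_cons dotpDl dotpZl (dotpC y).
  have zE : (z0 t y * a = t - dotp b y)%R by rewrite /z0 divfK.
  by move: zE; rewrite /a mulrDr; lra.
- split; first by rewrite invr_gt0 mulr_gt0// ltr_wpDr// dotp_ge0.
  split=> [t y|h mh h0].
    rewrite /L/= dotp_cons; set z := z0 t y; set w := (y + _)%R.
    rewrite ler_pdivrMl; last by rewrite mulr_gt0// ltr_wpDr// dotp_ge0.
    have yE : y = (w - z *: tau)%R by rewrite /w addrK.
    have h1 : (dotp y y <= 2 * dotp w w + 2 * (z * z * dotp tau tau))%R.
      rewrite {1 2}yE; have := dotp_ge0 (w + z *: tau)%R; clearbody w.
      by rewrite !dotpE (dotpC w tau); lra.
    have hw := dotp_ge0 w; have ht := dotp_ge0 tau.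
    have hz : (0 <= z * z)%R by rewrite -expr2 sqr_ge0.
    have := mulr_ge0 ht hw; lra.
  have mhy z : measurable_fun setT (fun y : 'rV[R]_n => h (cons_rV (z, y))).
    by apply: (measurableT_comp mh); exact: measurable_cons_rV_fun.
  pose K (p : measurableTypeR R * 'rV[R]_n) := h (cons_rV (p.1, p.2 + p.1 *: tau)%R).
  have mK : measurable_fun setT K.
    have mc : measurable_fun setT (fun p : measurableTypeR R * 'rV[R]_n =>
        cons_rV (p.1, p.2 + p.1 *: tau)%R).
      apply: measurable_cons_rV_fun; first exact: measurable_fst.
      apply: measurable_rVD; first exact: measurable_snd.
      by apply: measurable_rVZ; [exact: measurable_fst|exact: measurable_cst].
    exact: (measurableT_comp mh mc).
  have K0 p : 0 <= K p by exact: h0.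
  have mhL : measurable_fun setT (fun p => h (L p)) by exact: (measurableT_comp mh mL).
  have mG := measurable_fun_fubini_tonelli_G (m1 := leb) _ mhL (fun=> h0 _).
  rewrite integral_rVS//.
  transitivity (\int[leb]_z \int[lam]_y K (z, y)).
    apply: eq_integral => z _; rewrite /K/=.
    by rewrite (integral_rV_shift (z *: tau)%R (mhy z)).
  rewrite (fubini_tonelli _ mK)// (fubini_tonelli _ mhL)//.
  rewrite -integral_scalel//; last by move=> y; exact: integral_ge0.
  apply: eq_integral => y _.
  have mhLy : measurable_fun setT (fun t => h (L (t, y))).
    have mp : measurable_fun setT (fun t : measurableTypeR R => (t, y)) by exact: pair2_measurable.
    exact: (measurableT_comp mhL mp).
  rewrite -(ge0_integral_affine (dotp b y) a0 mhLy)//.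
  by apply: eq_integral => z _; rewrite /K /L/= /z0 addrK mulrC mulKf.
Qed.

End slicing.

Section fibres.
Local Open Scope ereal_scope.
Context (R : realType) (n : nat) (V : 'rV[R]_n.+1 -> R) (mu : probability 'rV[R]_n.+1 R).
Local Notation leb := (@lebesgue_measure R).
Local Notation lam := (@lebesgue_rV R n).
Hypothesis pV : potential V.
Hypothesis muE : forall A, measurable A ->
  mu A = \int[@lebesgue_rV R n.+1]_(x in A) (expR (- V x))%:E.
Variables (s : 'rV[R]_n.+1) (c K : R) (L : measurableTypeR R * 'rV[R]_n -> 'rV[R]_n.+1).
Hypotheses (s1 : dotp s s = 1%R) (slL : slicing s c K L).

Let mV : measurable_fun setT V. Proof. by case: pV. Qed.
Let mL : measurable_fun setT L. Proof. by case: slL. Qed.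
Let c0 : (0 < c)%R. Proof. by case: slL. Qed.

Definition fibre (t : R) (y : 'rV[R]_n) : R := V (L (t, y)).

(** The potential of the marginal along [s]; the Jacobian [c] makes exp(- fibre_potential) a
    probability density. *)
Definition fibre_potential (t : R) : R := (- ln (c * mass (fibre t)))%R.

Definition fibre_density (t : measurableTypeR R) (y : 'rV[R]_n) : R :=
  ((mass (fibre t))^-1 * expR (- fibre t y))%R.

Let mfib2 : measurable_fun setT (fun p : measurableTypeR R * 'rV[R]_n => fibre p.1 p.2).
Proof.
rewrite (_ : (fun _ => _) = V \o L); first exact: (measurableT_comp mV mL).
by apply/funext => -[t y].
Qed.

Let mfib t : measurable_fun setT (fibre t).
Proof.
have mp : measurable_fun setT (fun y : 'rV[R]_n => (t : measurableTypeR R, y)) by exact: pair1_measurable.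
exact: (measurableT_comp mfib2 mp).
Qed.

Let dfib t : gauss_dominated (fun y => expR (- fibre t y)).
Proof.
have [_ _ [k k0 [a aV]]] := pV; have [_ _ _ _ [K0 [KL _]]] := slL.
apply: quad_lower_dominated; exists (k * K)%R; first exact: mulr_gt0.
exists a => y; apply: le_trans (aV _); rewrite lerD2l -mulrA.
by apply: ler_wpM2l; [exact: ltW|exact: KL].
Qed.

Lemma fibre_mass_gt0 t : (0 < mass (fibre t))%R.
Proof. exact: mass_gt0 (mfib t) (dfib t). Qed.

Lemma fibre_density_gdensity t : gdensity (fibre_density t).
Proof. exact: gdensity_expRN (mfib t) (dfib t). Qed.

Lemma measurable_fibre_mass : measurable_fun setT (fun t : measurableTypeR R => mass (fibre t)).
Proof.
apply/measurable_EFinP; rewrite (_ : _ \o _ = fubini_F lam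
    (fun p : measurableTypeR R * 'rV[R]_n => (expR (- fibre p.1 p.2))%:E)); last first.
  by apply/funext => t; rewrite /= massE.
apply: measurable_fun_fubini_tonelli_F => [|p]; last by rewrite lee_fin expR_ge0.
by apply/measurable_EFinP; exact: measurable_expRN.
Qed.

Lemma measurable_fibre_density :
  measurable_fun setT (fun p : measurableTypeR R * 'rV[R]_n => fibre_density p.1 p.2).
Proof.
apply: measurable_funM; last exact: measurable_expRN.
apply: measurable_inv_pos => [|p]; last exact: fibre_mass_gt0.
exact: (measurableT_comp measurable_fibre_mass measurable_fst).
Qed.

Lemma fibre_potentialE t : expR (- fibre_potential t) = (c * mass (fibre t))%R.
Proof. by rewrite opprK lnK// posrE mulr_gt0// fibre_mass_gt0. Qed.

Lemma measurable_fibre_potential :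
  measurable_fun setT (fun t : measurableTypeR R => fibre_potential t).
Proof.
have m1 : measurable_fun setT (fun t : measurableTypeR R => c * mass (fibre t))%R.
  by apply: measurable_funM => //; exact: measurable_fibre_mass.
have m2 := measurableT_comp (@measurable_ln R) m1.
exact: (measurable_funN m2).
Qed.

Lemma integral_fibre (h : 'rV[R]_n.+1 -> \bar R) : measurable_fun setT h ->
  (forall x, 0 <= h x) ->
  \int[mu]_x h x = \int[leb]_t ((\int[lam]_y (h (L (t, y)) * (fibre_density t y)%:E)) *
    (expR (- fibre_potential t))%:E).
Proof.
move=> mh h0; rewrite (integral_mu pV muE)//.
have [_ _ _ _ [_ [_ ->]]] := slL; last 2 first.
- by apply: emeasurable_funM => //; apply/measurable_EFinP; exact: measurable_expRN.
- by move=> x; rewrite mule_ge0// lee_fin expR_ge0.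
have mhL : measurable_fun setT (fun p => h (L p)) by exact: (measurableT_comp mh mL).
have mF : measurable_fun setT (fun p : measurableTypeR R * 'rV[R]_n => h (L p) * (expR (- fibre p.1 p.2))%:E).
  by apply: emeasurable_funM => //; apply/measurable_EFinP; exact: measurable_expRN.
have F0 (p : measurableTypeR R * 'rV[R]_n) : 0 <= h (L p) * (expR (- fibre p.1 p.2))%:E.
  by rewrite mule_ge0// lee_fin expR_ge0.
rewrite -integral_scalel; [|exact: ltW|exact: (measurable_fun_fubini_tonelli_F _ mF F0)|].
  apply: eq_integral => t _; rewrite fibre_potentialE.
  have mFt : measurable_fun setT (fun y => h (L (t, y)) * (expR (- fibre t y))%:E).
    have mp : measurable_fun setT (fun y : 'rV[R]_n => (t : measurableTypeR R, y)) by exact: pair1_measurable.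
    exact: (measurableT_comp mF mp).
  have -> : \int[lam]_y (h (L (t, y)) * (fibre_density t y)%:E) =
      ((mass (fibre t))^-1)%:E * \int[lam]_y (h (L (t, y)) * (expR (- fibre t y))%:E).
    rewrite -integral_scalel.
    - by apply: eq_integral => y _; rewrite /fibre_density EFinM muleCA.
    - by rewrite invr_ge0 ltW// fibre_mass_gt0.
    - exact: mFt.
    - by move=> y; exact: (F0 (t, y)).
  rewrite [X in _ = X * _]muleC -muleA -EFinM mulrCA mulVf ?mulr1 1?muleC//.
  by rewrite gt_eqF// fibre_mass_gt0.
by move=> t; apply: integral_ge0 => y _; exact: (F0 (t, y)).
Qed.

Lemma pdensity_marginal : pdensity (fun t => expR (- fibre_potential t)).
Proof.
split.
- by apply: measurable_expRN; exact: measurable_fibre_potential.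
- by move=> t; exact: expR_gt0.
- have := integral_fibre (measurable_cst 1) (fun=> lee01).
  rewrite integral_cst//= probability_setT mule1 => ->; apply: eq_integral => t _.
  under eq_integral do rewrite mul1e.
  by have [_ _ _ ->] := fibre_density_gdensity t; rewrite mul1e.
Qed.

Lemma integral_marginal (h : R -> \bar R) : measurable_fun setT h ->
  (forall x, 0 <= h x) ->
  \int[mu]_x h (dotp x s) = \int[leb]_t (h t * (expR (- fibre_potential t))%:E).
Proof.
move=> mh h0; rewrite integral_fibre//; last first.
  have md : measurable_fun setT (fun x : 'rV[R]_n.+1 => dotp x s) by exact: measurable_dotp.
  exact: (measurableT_comp mh md).
have [_ _ _ Ls _] := slL; apply: eq_integral => t _; congr (_ * _).
under eq_integral do rewrite Ls.
have [mf f0 _ f1] := fibre_density_gdensity t.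
rewrite ge0_integralZl//; [by rewrite f1 mule1|exact/measurable_EFinP|].
by move=> y _; rewrite lee_fin ltW.
Qed.

(** Pythagoras: the component of [L (t, y)] along [s] is [t]. *)
Lemma dotp_slice_ge t t' y y' :
  dotp (L (t, y) - L (t', y')) (L (t, y) - L (t', y')) =
  ((t - t') ^+ 2 + dotp (orth_proj s (L (t, y)) - orth_proj s (L (t', y')))
     (orth_proj s (L (t, y)) - orth_proj s (L (t', y'))))%R.
Proof.
have [_ _ _ Ls _] := slL; rewrite /orth_proj !Ls.
set x := L _; set x' := L _.
have -> : (x - t *: s - (x' - t' *: s) = (x - x') - (t - t') *: s)%R.
  by apply/rowP => i; rewrite !mxE; ring.
rewrite [in RHS]dotp_sqrB !dotpZr !dotpZl s1 [dotp (x - x') s]dotpDl dotpNl !Ls; ring.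
Qed.

(** Marginals keep the convexity constant: Prekopa-Leindler between the fibres at t and t', with the
    fibre at the intermediate parameter raised by the constant [d]. The part of strong convexity
    orthogonal to [s] is discarded here; [fibre_cost] exploits it. *)
Lemma fibre_potential_convex l t t' : (0 < l)%R -> (l < 1)%R ->
  (fibre_potential ((1 - l) * t + l * t') <= (1 - l) * fibre_potential t +
    l * fibre_potential t' - l * (1 - l) / 2 * (t - t') ^+ 2)%R.
Proof.
move=> l0 l1; have [_ sV _] := pV; have [_ _ Llin Ls _] := slL.
set d := (l * (1 - l) / 2 * (t - t') ^+ 2)%R; set r := ((1 - l) * t + l * t')%R.
pose C y := (fibre r y + d)%R.
have mC : measurable_fun setT C by apply: measurable_funD.
have hC x y : (C ((1 - l) *: x + l *: y) <= (1 - l) * fibre t x + l * fibre t' y)%R.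
  rewrite /C /fibre /r Llin; have := sV l (L (t, x)) (L (t', y)) l0 l1.
  rewrite dotp_slice_ge; set P := dotp _ _ => h.
  have P0 : (0 <= l * (1 - l) / 2 * P)%R.
    by rewrite mulr_ge0 ?dotp_ge0// divr_ge0// mulr_ge0 ?subr_ge0// ltW.
  by move: h P0; rewrite mulrDr -/d; lra.
have := prekopa_leindler l0 l1 (mfib t) (mfib t') mC (dfib t) (dfib t') hC.
have -> : \int[lam]_x (expR (- C x))%:E = (expR (- d) * mass (fibre r))%:E.
  rewrite EFinM massE// -integral_scalel; [|exact: expR_ge0| |by move=> y; rewrite lee_fin expR_ge0].
    by apply: eq_integral => y _; rewrite -EFinM -expRD /C opprD addrC.
  by apply/measurable_EFinP; exact: measurable_expRN.
rewrite lee_fin -[X in (_ <= X)%R -> _]lnK ?posrE ?mulr_gt0 ?expR_gt0 ?fibre_mass_gt0//.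
rewrite ler_expR lnM ?posrE ?expR_gt0 ?fibre_mass_gt0// expRK.
rewrite /fibre_potential !lnM ?posrE ?fibre_mass_gt0//; lra.
Qed.

End fibres.

(** * Contraction of the Gaussian quantiles *)

Section quantile_contraction.
Local Open Scope ereal_scope.
Context (R : realType).
Local Notation leb := (@lebesgue_measure R).
Implicit Types f g : measurableTypeR R -> R.

Lemma pdensity_shift f (a : R) : pdensity f -> pdensity (fun x => f (x - a)%R).
Proof.
move=> [mf f0 f1]; have ms : measurable_fun setT (fun x : measurableTypeR R => (x - a)%R : measurableTypeR R).
  exact: measurable_funB.
split=> //; first exact: (measurableT_comp mf ms).
rewrite -[RHS]f1; have mf' : measurable_fun setT (fun x : measurableTypeR R => (f x)%:E) by exact/measurable_EFinP.
have := ge0_integral_affine (- a) (oner_neq0 R) mf' (fun x => ltW (f0 x)).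
rewrite normr1 invr1 mul1e => <-; by apply: eq_integral => x _; rewrite mul1r.
Qed.

Lemma cdfd_shift f (a s : R) : pdensity f ->
  cdfd (fun x => f (x - a)%R) s = cdfd f (s - a).
Proof.
move=> pf; have [mf f0 f1] := pf; congr fine.
pose h (x : measurableTypeR R) := (f x)%:E * (\1_(`]-oo, (s - a)%R]%classic : set R) x)%:E.
have mh : measurable_fun setT h.
  by apply: emeasurable_funM; apply/measurable_EFinP => //; exact: measurable_indic.
have h0 x : 0 <= h x by rewrite mule_ge0// lee_fin ltW.
have restr (g : R -> R) (D : set R) : \int[leb]_(x in D) (g x)%:E = \int[leb]_x ((g x)%:E * (\1_D x)%:E).
  rewrite integral_mkcond; apply: eq_integral => x _; rewrite patchE indicE.
  by case: ifP => _; rewrite ?mule1 ?mule0.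
rewrite [LHS](restr (fun x => f (x - a)%R) `]-oo, s]%classic) [RHS](restr f `]-oo, (s - a)%R]%classic).
have := ge0_integral_affine (- a) (oner_neq0 R) mh h0.
rewrite normr1 invr1 mul1e => <-; apply: eq_integral => x _; rewrite mul1r /h.
congr (_ * _%:E); rewrite !indicE; congr (nat_of_bool _)%:R.
by apply/idP/idP; rewrite !inE/= !in_itv/= lerD2r.
Qed.

Lemma integral_itv_cdfd f (a b : R) : pdensity f -> (a <= b)%R ->
  \int[leb]_(x in `]a, b]) (f x)%:E = (cdfd f b - cdfd f a)%:E.
Proof.
move=> pf ab; have [mf f0 _] := pf.
have mf' : measurable_fun setT (fun x : measurableTypeR R => (f x)%:E) by exact/measurable_EFinP.
rewrite EFinB (cdfdE pf b) (_ : `]-oo, b]%classic = `]-oo, a] `|` `]a, b]); last first.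
  apply/seteqP; split=> x /=; rewrite !in_itv/=.
    by case: (leP x a) => _ xt; [left|right].
  by move=> [xs|/andP[//]]; exact: le_trans xs ab.
rewrite ge0_integral_setU//; last 3 first.
- exact: measurable_funTS.
- by move=> x _; rewrite lee_fin ltW.
- by apply/disj_setPS => x []; rewrite /= !in_itv/= => xs /andP[/(le_lt_trans xs)]; rewrite ltxx.
by rewrite -(cdfdE pf a) addeAC subee// add0e.
Qed.

Lemma integral_itvy_cdfd f (a : R) : pdensity f ->
  \int[leb]_(x in `]a, +oo[) (f x)%:E = (1 - cdfd f a)%:E.
Proof.
move=> pf; have [mf f0 f1] := pf.
have mf' : measurable_fun setT (fun x : measurableTypeR R => (f x)%:E) by exact/measurable_EFinP.
rewrite EFinB -f1 -(setUv `]-oo, a]) setCitvl ge0_integral_setU//; last 3 first.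
- exact: measurable_funTS.
- by move=> x _; rewrite lee_fin ltW.
- by apply/disj_setPS => x []; rewrite /= !in_itv/= andbT => xs /(le_lt_trans xs); rewrite ltxx.
by rewrite -(cdfdE pf a) addeAC subee// add0e.
Qed.

(* The assumption says that [f / g(. - c)] crosses the level 1 at most twice,
   from below and then from above. *)
Lemma cdfd_single_crossing f g (a b : R) : pdensity f -> pdensity g -> (a < b)%R ->
  (forall x z y, (x < z)%R -> (z < y)%R -> (g x <= f x)%R -> (g y <= f y)%R -> (g z <= f z)%R) ->
  (cdfd g a < cdfd f a)%R -> (cdfd g b <= cdfd f b)%R.
Proof.
move=> pf pg ab H gfa; rewrite leNgt; apply/negP => fgb.
have [mf f0 _] := pf; have [mg g0 _] := pg.
have mf' : measurable_fun setT (fun x : measurableTypeR R => (f x)%:E) by exact/measurable_EFinP.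
have mg' : measurable_fun setT (fun x : measurableTypeR R => (g x)%:E) by exact/measurable_EFinP.
have le (h k : measurableTypeR R -> R) (i : interval R) : pdensity h -> pdensity k ->
    (forall x, x \in i -> (h x <= k x)%R) ->
    \int[leb]_(x in [set` i]) (h x)%:E <= \int[leb]_(x in [set` i]) (k x)%:E.
  move=> [mh h0 _] [mk k0 _] hk; apply: ge0_le_integral => //.
  - by move=> x _; rewrite lee_fin ltW.
  - by apply: measurable_funTS; exact/measurable_EFinP.
  - by apply: measurable_funTS; exact/measurable_EFinP.
have [x xa gfx] : exists2 x, (x <= a)%R & (g x <= f x)%R.
  apply: contrapT => h; have : \int[leb]_(x in `]-oo, a]) (f x)%:E <= \int[leb]_(x in `]-oo, a]) (g x)%:E.
    apply: le => // x; rewrite in_itv/= => xa; rewrite leNgt; apply/negP => gf.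
    by apply: h; exists x => //; exact: ltW.
  by rewrite -!cdfdE// lee_fin leNgt gfa.
have [y yb gfy] : exists2 y, (b < y)%R & (g y <= f y)%R.
  apply: contrapT => h; have : \int[leb]_(x in `]b, +oo[) (f x)%:E <= \int[leb]_(x in `]b, +oo[) (g x)%:E.
    apply: le => // z; rewrite in_itv/= andbT => zb; rewrite leNgt; apply/negP => gf.
    by apply: h; exists z => //; exact: ltW.
  by rewrite !integral_itvy_cdfd// lee_fin lerD2l lerN2 leNgt fgb.
have : \int[leb]_(x in `]a, b]) (g x)%:E <= \int[leb]_(x in `]a, b]) (f x)%:E.
  apply: le => // z; rewrite in_itv/= => /andP[az zb].
  exact: (H x z y (le_lt_trans xa az) (le_lt_trans zb yb)).
by rewrite !integral_itv_cdfd ?(ltW ab)// lee_fin; move: gfa fgb; lra.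
Qed.

(** If the increment for f were larger, a translate of g would have its distribution function
    strictly below that of f at [a] and strictly above it at b - e, against
    [cdfd_single_crossing]. *)
Lemma quantile_contraction f g (u v : R) : pdensity f -> pdensity g ->
  (forall c x z y, (x < z)%R -> (z < y)%R ->
    (g (x - c) <= f x)%R -> (g (y - c) <= f y)%R -> (g (z - c) <= f z)%R) ->
  (0 < u < 1)%R -> (0 < v < 1)%R -> (u <= v)%R ->
  (quantile f v - quantile f u <= quantile g v - quantile g u)%R.
Proof.
move=> pf pg H u01 v01 uv; rewrite leNgt; apply/negP => lt.
set a := quantile f u in lt; set b := quantile f v in lt.
set A := quantile g u in lt; set B := quantile g v in lt.
(* A quarter of the excess leaves room to lower both [A] and [b] by [e], which makes the comparisons
   of levels strict; the translation [c] then brings A - e onto [a]. *)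
pose e := ((b - a - (B - A)) / 4)%R.
have AB : (A <= B)%R by exact: quantile_homo.
have e0 : (0 < e)%R by rewrite /e divr_gt0// subr_gt0.
pose c := (a - (A - e))%R.
have ab : (a < b - e)%R.
  have eE : (e = (b - a - (B - A)) / 4)%R by []; clearbody e a b A B; lra.
have := cdfd_single_crossing pf (pdensity_shift c pg) ab (H c).
rewrite !cdfd_shift// => h.
have h1 : (u <= cdfd f a)%R by rewrite -quantile_le.
have h2 : (cdfd g (a - c) < u)%R.
  by rewrite ltNge -quantile_le// -ltNge /c opprB addrC subrK ltrBlDr ltrDl.
have h3 : (cdfd f (b - e) < v)%R.
  by rewrite ltNge -quantile_le// -ltNge ltrBlDr ltrDl.
have h4 : (v <= cdfd g (b - e - c))%R.
  rewrite -quantile_le// -/B /c.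
  have eE : (e = (b - a - (B - A)) / 4)%R by []; clearbody e a b A B; lra.
have := h (lt_le_trans h2 h1); clear -h3 h4 => h; lra.
Qed.

End quantile_contraction.

(** * Strongly convex potentials on the line *)

Section line_potentials.
Local Open Scope ereal_scope.
Context (R : realType).
Local Notation leb := (@lebesgue_measure R).
Implicit Types v : measurableTypeR R -> R.

Definition strongly_convex1 (v : R -> R) := forall l t t', (0 < l)%R -> (l < 1)%R ->
  (v ((1 - l) * t + l * t') <= (1 - l) * v t + l * v t' - l * (1 - l) / 2 * (t - t') ^+ 2)%R.

(** The last term is the defect of t^2 / 2 itself, so the standard Gaussian potential has defect
    zero. *)
Definition mid_defect (v : R -> R) (s t : R) : R :=
  ((v s + v t) / 2 - v ((s + t) / 2) - (s - t) ^+ 2 / 8)%R.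

Lemma mid_defect_ge0 v s t : strongly_convex1 v -> (0 <= mid_defect v s t)%R.
Proof.
move=> sv; have h0 : (0 < 2^-1 :> R)%R by rewrite invr_gt0.
have h1 : (2^-1 < 1 :> R)%R by lra.
have := sv _ s t h0 h1; rewrite /mid_defect.
have -> : ((1 - 2^-1) * s + 2^-1 * t = (s + t) / 2)%R by lra.
lra.
Qed.

Lemma measurable_mid_defect v : measurable_fun setT v ->
  measurable_fun setT (fun z : measurableTypeR R * measurableTypeR R => mid_defect v z.1 z.2).
Proof.
move=> mv.
have m1 : measurable_fun setT (fun z : measurableTypeR R * measurableTypeR R => v z.1) by exact: (measurableT_comp mv measurable_fst).
have m2 : measurable_fun setT (fun z : measurableTypeR R * measurableTypeR R => v z.2) by exact: (measurableT_comp mv measurable_snd).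
have mf : measurable_fun setT (fst : measurableTypeR R * measurableTypeR R -> measurableTypeR R) by exact: measurable_fst.
have ms : measurable_fun setT (snd : measurableTypeR R * measurableTypeR R -> measurableTypeR R) by exact: measurable_snd.
have m3 : measurable_fun setT (fun z : measurableTypeR R * measurableTypeR R => ((z.1 + z.2) / 2)%R : measurableTypeR R).
  by apply: measurable_funM; [exact: measurable_funD|exact: measurable_cst].
have m4 : measurable_fun setT (fun z : measurableTypeR R * measurableTypeR R => v ((z.1 + z.2) / 2)%R) by exact: (measurableT_comp mv m3).
apply: measurable_funB; first apply: measurable_funB => //.
  by apply: measurable_funM; [exact: measurable_funD|exact: measurable_cst].
apply: measurable_funM; last exact: measurable_cst.
exact: (measurable_funX 2 (measurable_funB mf ms)).
Qed.

(** The point (1 - h) s + h t lies at the fraction 2 h of the way from s to the midpoint. Strong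
    convexity on that half, and symmetrically on the other, brings in the value at the midpoint;
    then exp x >= 1 + x. *)
Let interpolation_gap v (h s t : R) : strongly_convex1 v -> (0 < h)%R -> (h < 2^-1)%R ->
  (2 + 4 * h * mid_defect v s t + (h - h ^+ 2) * (s - t) ^+ 2 <=
   expR (v s - v ((1 - h) * s + h * t)) + expR (v t - v ((1 - h) * t + h * s)))%R.
Proof.
move=> sv h0 h2.
have hh0 : (0 < 2 * h)%R by rewrite mulr_gt0.
have hh1 : (2 * h < 1)%R by lra.
have hs := sv _ s ((s + t) / 2)%R hh0 hh1; have ht := sv _ t ((s + t) / 2)%R hh0 hh1.
have es : ((1 - 2 * h) * s + 2 * h * ((s + t) / 2) = (1 - h) * s + h * t)%R by lra.
have et : ((1 - 2 * h) * t + 2 * h * ((s + t) / 2) = (1 - h) * t + h * s)%R by lra.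
rewrite es in hs; rewrite et in ht.
apply: le_trans (lerD (expR_ge1Dx _) (expR_ge1Dx _)).
move: hs ht; rewrite /mid_defect; set A := v (_ + _)%R; set B := v (_ + _)%R.
set M := v ((s + t) / 2)%R => hs ht.
have -> : ((h - h ^+ 2) * (s - t) ^+ 2 = h * (1 - h) * (s - t) ^+ 2)%R by ring.
have {}hs : (A <= (1 - 2 * h) * v s + 2 * h * M - h * (1 - 2 * h) / 4 * (s - t) ^+ 2)%R by lra.
have {}ht : (B <= (1 - 2 * h) * v t + 2 * h * M - h * (1 - 2 * h) / 4 * (s - t) ^+ 2)%R by lra.
lra.
Qed.

Section one_potential.
Variable v : measurableTypeR R -> R.
Hypotheses (sv : strongly_convex1 v) (mv : measurable_fun setT v).
Hypothesis pv : pdensity (fun t => expR (- v t)).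

Let p (z : measurableTypeR R * measurableTypeR R) : R := (expR (- v z.1) * expR (- v z.2))%R.

Let mev : measurable_fun setT (fun t => expR (- v t)). Proof. by case: pv. Qed.
Let mp : measurable_fun setT p.
Proof.
apply: measurable_funM.
  exact: (measurableT_comp mev measurable_fst).
exact: (measurableT_comp mev measurable_snd).
Qed.
Let p0 z : (0 <= p z)%R. Proof. by rewrite mulr_ge0// expR_ge0. Qed.
Let v1 : \int[leb]_t (expR (- v t))%:E = 1. Proof. by case: pv. Qed.

Let mfst : measurable_fun setT (fst : measurableTypeR R * measurableTypeR R -> measurableTypeR R).
Proof. exact: measurable_fst. Qed.
Let msnd : measurable_fun setT (snd : measurableTypeR R * measurableTypeR R -> measurableTypeR R).
Proof. exact: measurable_snd. Qed.

Let m_interp (h : R) : measurable_fun setT (fun z : measurableTypeR R * measurableTypeR R =>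
   ((1 - h) * z.1 + h * z.2)%R : measurableTypeR R).
Proof.
apply: measurable_funD; apply: measurable_funM.
- exact: measurable_cst.
- exact: mfst.
- exact: measurable_cst.
- exact: msnd.
Qed.

Let F (h : R) (z : measurableTypeR R * measurableTypeR R) : \bar R :=
  (expR (- v ((1 - h) * z.1 + h * z.2)) * expR (- v z.2))%:E.

Let mF h : measurable_fun setT (F h).
Proof.
apply/measurable_EFinP; apply: measurable_funM.
  exact: (measurableT_comp mev (m_interp h)).
exact: (measurableT_comp mev msnd).
Qed.

Let F0 h z : 0 <= F h z. Proof. by rewrite lee_fin mulr_ge0// expR_ge0. Qed.

(** A dilation of the first variable evaluates the perturbed integral exactly, so that [v] is never
    differentiated. *)
Let FE (h : R) : (0 < h)%R -> (h < 1)%R -> \int[(leb \x leb)]_z F h z = ((1 - h)^-1)%:E.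
Proof.
move=> h0 h1; rewrite (fubini_tonelli2 _ (mF h) (F0 h)).
have h1' : (1 - h != 0)%R by rewrite gt_eqF// subr_gt0.
have mev' : measurable_fun setT (fun t : measurableTypeR R => (expR (- v t))%:E) by exact/measurable_EFinP.
have ev0 t : 0 <= (expR (- v t))%:E by rewrite lee_fin expR_ge0.
rewrite (eq_integral (fun t => ((1 - h)^-1)%:E * (expR (- v t))%:E)).
  by rewrite integral_scalel// ?v1 ?mule1// invr_ge0 subr_ge0 ltW.
move=> t _; rewrite /fubini_G /F/=; under eq_integral do rewrite EFinM.
have mt : measurable_fun setT (fun s : measurableTypeR R => (expR (- v ((1 - h) * s + h * t)))%:E).
  have m1 : measurable_fun setT (fun s : measurableTypeR R => ((1 - h) * s + h * t)%R : measurableTypeR R).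
    by apply: measurable_funD; [apply: measurable_funM; [exact: measurable_cst|exact: measurable_id]|exact: measurable_cst].
  exact: (measurableT_comp mev' m1).
rewrite integral_scaler; [|exact: expR_ge0|exact: mt|by move=> s; rewrite lee_fin expR_ge0].
congr (_ * _); rewrite (ge0_integral_affine (h * t) h1' mev' ev0) v1 mule1.
by rewrite gtr0_norm// subr_gt0.
Qed.

Let mD : measurable_fun setT (fun z : measurableTypeR R * measurableTypeR R => (mid_defect v z.1 z.2 * p z)%:E).
Proof. by apply/measurable_EFinP; apply: measurable_funM => //; exact: measurable_mid_defect. Qed.

Let mq : measurable_fun setT (fun z : measurableTypeR R * measurableTypeR R => ((z.1 - z.2) ^+ 2 * p z)%:E).
Proof.
apply/measurable_EFinP; apply: measurable_funM => //.
exact: (measurable_funX 2 (measurable_funB mfst msnd)).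
Qed.

Let D0 (z : measurableTypeR R * measurableTypeR R) : 0 <= (mid_defect v z.1 z.2 * p z)%:E.
Proof. by rewrite lee_fin mulr_ge0// mid_defect_ge0. Qed.

Let q0 (z : measurableTypeR R * measurableTypeR R) : 0 <= ((z.1 - z.2) ^+ 2 * p z)%:E.
Proof. by rewrite lee_fin mulr_ge0// sqr_ge0. Qed.

Let pE : \int[(leb \x leb)]_z (p z)%:E = 1.
Proof.
rewrite (integral_prod_mul mev mev (fun=> expR_ge0 _) (fun=> expR_ge0 _)) v1 ?mule1//.
by rewrite ltry.
Qed.

Let gap_integral (h : R) : (0 < h)%R -> (h < 2^-1)%R ->
  2%:E + ((4 * h)%:E * \int[(leb \x leb)]_z (mid_defect v z.1 z.2 * p z)%:E +
  (h - h ^+ 2)%:E * \int[(leb \x leb)]_z ((z.1 - z.2) ^+ 2 * p z)%:E) <= (2 / (1 - h))%:E.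
Proof.
move=> h0 h2; have h1 : (h < 1)%R by lra.
have mp' : measurable_fun setT (fun z => (p z)%:E) by exact/measurable_EFinP.
have hh : (0 <= h - h ^+ 2)%R by rewrite expr2 subr_ge0 ler_piMr// ltW.
have mFs : measurable_fun setT (fun z : measurableTypeR R * measurableTypeR R => F h (z.2, z.1)).
  exact: (measurableT_comp (mF h) (@measurable_swap _ _ _ _)).
have -> : (2 / (1 - h))%:E = \int[(leb \x leb)]_z (F h z + F h (z.2, z.1)).
  rewrite integral_add; [|exact: mF|exact: mFs|exact: F0|by move=> z; exact: F0].
  rewrite (integral_prod_swap _ (mF h) (F0 h)) FE// -EFinD; congr EFin.
  by field; rewrite gt_eqF// subr_gt0.
rewrite -[X in X%:E + _]mulr1 EFinM -pE.
rewrite -integral_scalel; [|by []|exact: mp'|by move=> z; rewrite lee_fin].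
rewrite -integral_scalel; [|by rewrite mulr_ge0// ltW|exact: mD|exact: D0].
rewrite -(@integral_scalel _ _ _ _ (h - h ^+ 2)%R _ hh mq q0).
rewrite -integral_add; last 4 first.
- exact: measurable_funeM.
- exact: measurable_funeM.
- by move=> z; rewrite mule_ge0// lee_fin mulr_ge0// ltW.
- by move=> z; rewrite mule_ge0.
rewrite -integral_add; last 4 first.
- exact: measurable_funeM.
- by apply: emeasurable_funD; exact: measurable_funeM.
- by move=> z; rewrite mule_ge0// lee_fin.
- by move=> z; rewrite adde_ge0// mule_ge0// lee_fin mulr_ge0// ltW.
apply: integral_le.
- by apply: emeasurable_funD; [|apply: emeasurable_funD]; exact: measurable_funeM.
- by apply: emeasurable_funD; [exact: mF|exact: mFs].
- move=> z; apply: adde_ge0; first by rewrite mule_ge0// lee_fin.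
  by apply: adde_ge0; apply: mule_ge0 => //; rewrite lee_fin mulr_ge0// ltW.
- move=> -[s t]; rewrite /F /p/= -!EFinM -!EFinD lee_fin.
  have -> : (expR (- v ((1 - h) * s + h * t)) * expR (- v t) =
      expR (v s - v ((1 - h) * s + h * t)) * (expR (- v s) * expR (- v t)))%R.
    by rewrite -!expRD; congr expR; ring.
  have -> : (expR (- v ((1 - h) * t + h * s)) * expR (- v s) =
      expR (v t - v ((1 - h) * t + h * s)) * (expR (- v s) * expR (- v t)))%R.
    by rewrite -!expRD; congr expR; ring.
  have := ler_wpM2r (p0 (s, t)) (interpolation_gap s t sv h0 h2).
  rewrite /p/=; set r := (expR (- v s) * _)%R; lra.
Qed.

(** A sharpened Poincare inequality for the identity function: what the doubled variance lacks from
    2 controls the mean defect. It is the first-order term in h of [gap_integral], whose right-hand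
    side is 2 + 2 h up to higher order. *)
Lemma integral_mid_defect_le :
  4%:E * \int[(leb \x leb)]_z (mid_defect v z.1 z.2 * (expR (- v z.1) * expR (- v z.2)))%:E +
  \int[(leb \x leb)]_z ((z.1 - z.2) ^+ 2 * (expR (- v z.1) * expR (- v z.2)))%:E <= 2%:E.
Proof.
set X := \int[_]_z (mid_defect _ _ _ * _)%:E; set q := \int[_]_z _.
have X0 : 0 <= X by exact: integral_ge0.
have q00 : 0 <= q by exact: integral_ge0.
have key (h : R) : (0 < h)%R -> (h < 2^-1)%R ->
    2%:E + ((4 * h)%:E * X + (h - h ^+ 2)%:E * q) <= (2 / (1 - h))%:E.
  exact: gap_integral.
have h4 : (0 < 4^-1 :> R)%R by rewrite invr_gt0.
have h42 : (4^-1 < 2^-1 :> R)%R by lra.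
(* At h = 1/4 both coefficients are positive, which makes both integrals finite. *)
have fin (a b : \bar R) (c e r : R) : 0 <= a -> 0 <= b -> (0 < c)%R -> (0 < e)%R ->
    2%:E + (c%:E * a + e%:E * b) <= r%:E -> a \is a fin_num /\ b \is a fin_num.
  case: a => [a| |]//; case: b => [b| |]// a0 b0 c0 e0.
  - by rewrite gt0_muley ?lte_fin// -EFinM addey// addey// leye_eq.
  - by rewrite gt0_muley ?lte_fin// addye// addey// leye_eq.
  - by rewrite !gt0_muley ?lte_fin// addye// addey// leye_eq.
have c1 : (0 < 4 * 4^-1 :> R)%R by rewrite mulr_gt0.
have c2 : (0 < 4^-1 - 4^-1 ^+ 2 :> R)%R by lra.
have [Xf qf] := fin _ _ _ _ _ X0 q00 c1 c2 (key _ h4 h42).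
move: key X0 q00; rewrite -(fineK Xf) -(fineK qf); set x := fine X; set y := fine q.
move=> key x0 y0; rewrite lee_fin in x0; rewrite lee_fin in y0.
rewrite -EFinM -EFinD lee_fin.
apply: (@le_of_small_error _ _ _ (4 + y) 4^-1) => //; first by rewrite addr_ge0.
move=> h h0 h1; have h2 : (h < 2^-1)%R by lra.
have := key h h0 h2; rewrite -!EFinM -!EFinD lee_fin ler_pdivlMr; last lra.
move=> {}key.
have : (h * ((4 * x + (1 - h) * y) * (1 - h)) <= h * 2)%R.
  have -> : (h * ((4 * x + (1 - h) * y) * (1 - h)) =
      (2 + (4 * h * x + (h - h ^+ 2) * y)) * (1 - h) - 2 * (1 - h))%R by ring.
  lra.
rewrite ler_pM2l// => k2.
have x4 : (0 <= 4 * x + (1 - h) * y)%R by rewrite addr_ge0// mulr_ge0//; lra.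
have : (4 * x + (1 - h) * y <= 2 + 4 * h)%R.
  have hk : ((4 * x + (1 - h) * y) * (1 - h) <= (2 + 4 * h) * (1 - h))%R by apply: (le_trans k2); nra.
  by move: hk; rewrite ler_pM2r//; lra.
lra.
Qed.

End one_potential.

Definition gauss_potential (t : R) : R := (t ^+ 2 / 2 - ln (normal_peak 1%R))%R.

Lemma expR_gauss_potential t : expR (- gauss_potential t) = normal_pdf 0 1 t.
Proof.
have p0 : (0 < normal_peak (1 : R))%R by rewrite normal_peak_gt0.
rewrite normal_pdfE// /gauss_potential opprB expRD lnK ?posrE//; congr (_ * expR _)%R.
by rewrite subr0 expr1n -mulr_natr mul1r mulNr.
Qed.

Lemma measurable_gauss_potential :
  measurable_fun setT (gauss_potential : measurableTypeR R -> R).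
Proof.
by apply: measurable_funB => //; apply: measurable_funM => //; exact: measurable_funX.
Qed.

Lemma pdensity_gauss : pdensity (fun t => expR (- gauss_potential t)).
Proof.
split.
- by apply: measurable_expRN; exact: measurable_gauss_potential.
- by move=> x; exact: expR_gt0.
- under eq_integral do rewrite expR_gauss_potential; exact: integral_normal_pdf.
Qed.

Lemma strongly_convex1_gauss : strongly_convex1 gauss_potential.
Proof. move=> l t t' l0 l1; rewrite /gauss_potential; lra. Qed.

End line_potentials.

Lemma sqr_contraction (R : realFieldType) (x x' g g' : R) :
  0 <= x' - x -> x' - x <= g' - g ->
  ((x - g) - (x' - g')) ^+ 2 + (x - x') ^+ 2 <= (g - g') ^+ 2.
Proof.
move=> h2 h1; have h3 : 0 <= (g' - g) - (x' - x) by rewrite subr_ge0.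
by have := mulr_ge0 h2 h3; lra.
Qed.

Lemma sqr_contraction_sym (R : realFieldType) (x x' g g' : R) :
  0 <= x - x' -> x - x' <= g - g' ->
  ((x - g) - (x' - g')) ^+ 2 + (x - x') ^+ 2 <= (g - g') ^+ 2.
Proof.
move=> h2 h1; have h3 : 0 <= (g - g') - (x - x') by rewrite subr_ge0.
by have := mulr_ge0 h2 h3; lra.
Qed.

(** * Distance of the marginal to a translated Gaussian *)

Section gaussian_shift.
Local Open Scope ereal_scope.
Context (R : realType).
Local Notation leb := (@lebesgue_measure R).
Local Notation RR := (measurableTypeR R * measurableTypeR R)%type.

Lemma integral_quantile2 (f : measurableTypeR R -> R) (F : RR -> \bar R) :
  pdensity f -> measurable_fun setT F -> (forall z, 0 <= F z) ->
  \int[@unif R]_u \int[@unif R]_t F (quantile f u, quantile f t) =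
  \int[(leb \x leb)]_z (F z * (f z.1 * f z.2)%:E).
Proof.
move=> pf mF F0; have [mf f0 _] := pf.
have mff : measurable_fun setT (fun z : RR => f z.1 * f z.2)%R.
  apply: measurable_funM.
    exact: (measurableT_comp mf measurable_fst).
  exact: (measurableT_comp mf measurable_snd).
have mH : measurable_fun setT (fun z : RR => F z * (f z.1 * f z.2)%:E).
  by apply: emeasurable_funM => //; exact/measurable_EFinP.
have H0 (z : RR) : 0 <= F z * (f z.1 * f z.2)%:E.
  by rewrite mule_ge0// lee_fin mulr_ge0// ltW.
have mFx x : measurable_fun setT (fun y => F (x, y)).
  have mp : measurable_fun setT (fun y : measurableTypeR R => (x : measurableTypeR R, y)) by exact: pair1_measurable.
  exact: (measurableT_comp mF mp).
pose h (x : measurableTypeR R) := \int[leb]_y (F (x, y) * (f y)%:E).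
have mFf : measurable_fun setT (fun z : RR => F z * (f z.2)%:E).
  apply: emeasurable_funM => //; apply/measurable_EFinP.
  exact: (measurableT_comp mf measurable_snd).
have Ff0 (z : RR) : 0 <= F z * (f z.2)%:E by rewrite mule_ge0// lee_fin ltW.
have mh : measurable_fun setT h by exact: (measurable_fun_fubini_tonelli_F _ mFf Ff0).
have h0 x : 0 <= h x by apply: integral_ge0 => y _; exact: (Ff0 (x, y)).
rewrite (fubini_tonelli1 _ mH H0).
transitivity (\int[@unif R]_u h (quantile f u)).
  by apply: eq_integral => u _; rewrite (integral_quantile pf (mFx _)).
rewrite (integral_quantile pf mh h0); apply: eq_integral => x _; rewrite /h /fubini_F/=.
rewrite -integral_scaler; [|exact: ltW| |by move=> y; exact: (Ff0 (x, y))].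
  by apply: eq_integral => y _; rewrite -muleA -EFinM mulrC.
apply: emeasurable_funM; first exact: mFx.
exact/measurable_EFinP.
Qed.

Variable v : measurableTypeR R -> R.
Hypotheses (sv : strongly_convex1 v) (pv : pdensity (fun t => expR (- v t))).

Local Notation gauss := (fun t : measurableTypeR R => expR (- gauss_potential t)).
Local Notation X := (quantile (fun t => expR (- v t))).
Local Notation G := (quantile gauss).

(** v minus a translate of the Gaussian potential is convex, so the set where it is nonpositive is
    an interval: this is the crossing hypothesis of [quantile_contraction]. *)
Lemma gauss_contraction u t : (0 < u < 1)%R -> (0 < t < 1)%R -> (u <= t)%R ->
  (X t - X u <= G t - G u)%R.
Proof.
apply: quantile_contraction => //; first exact: pdensity_gauss.
move=> c x z y xz zy; rewrite !ler_expR !lerN2 => vx vy.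
have xy : (0 < y - x)%R by rewrite subr_gt0 (lt_trans xz).
pose l := ((z - x) / (y - x))%R.
have l0 : (0 < l)%R by rewrite divr_gt0// subr_gt0.
have l1 : (l < 1)%R by rewrite ltr_pdivrMr// mul1r ltrD2r.
have zE : (z = (1 - l) * x + l * y)%R by rewrite /l; field; rewrite gt_eqF.
have l1' : (0 <= 1 - l)%R by rewrite subr_ge0 ltW.
have := sv x y l0 l1; rewrite -zE.
have := ler_wpM2l l1' vx; have := ler_wpM2l (ltW l0) vy.
have -> : (gauss_potential (z - c) = (1 - l) * gauss_potential (x - c) +
    l * gauss_potential (y - c) - l * (1 - l) / 2 * (x - y) ^+ 2)%R.
  by rewrite /gauss_potential zE; ring.
set a := gauss_potential _; set b := gauss_potential _; set d := (_ / 2 * _)%R.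
lra.
Qed.

Let contraction_sqr u t : (0 < u < 1)%R -> (0 < t < 1)%R ->
  (((X u - G u) - (X t - G t)) ^+ 2 + (X u - X t) ^+ 2 <= (G u - G t) ^+ 2)%R.
Proof.
move=> u01 t01; have [ut|/ltW tu] := leP u t.
  apply: sqr_contraction; last exact: gauss_contraction.
  by rewrite subr_ge0; exact: quantile_homo.
apply: sqr_contraction_sym; last exact: gauss_contraction.
by rewrite subr_ge0; exact: quantile_homo.
Qed.

Let mX : measurable_fun setT (X : measurableTypeR R -> R) := measurable_quantile1 pv.
Let mG : measurable_fun setT (G : measurableTypeR R -> R) := measurable_quantile1 (@pdensity_gauss R).

Let mdiff (F : measurableTypeR R -> R) : measurable_fun setT F ->
  measurable_fun setT (fun z : RR => ((F z.1 - F z.2) ^+ 2)%:E).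
Proof.
move=> mF; apply/measurable_EFinP; apply: (@measurable_funX _ _ _ _ _ 2).
apply: measurable_funB.
  exact: (measurableT_comp mF measurable_fst).
exact: (measurableT_comp mF measurable_snd).
Qed.

Let EE (F : R -> R) : \bar R := \int[@unif R]_t \int[@unif R]_u ((F u - F t) ^+ 2)%:E.

Let EE_law (f : measurableTypeR R -> R) : pdensity f ->
  EE (quantile f) = \int[(leb \x leb)]_z ((z.1 - z.2) ^+ 2 * (f z.1 * f z.2))%:E.
Proof.
move=> pf; have mF : measurable_fun setT (fun z : RR => ((z.2 - z.1) ^+ 2)%:E).
  apply/measurable_EFinP; apply: (@measurable_funX _ _ _ _ _ 2).
  apply: measurable_funB.
    exact: (measurable_snd : measurable_fun _ (snd : RR -> measurableTypeR R)).
  exact: (measurable_fst : measurable_fun _ (fst : RR -> measurableTypeR R)).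
rewrite /EE (integral_quantile2 pf mF); last by move=> z; rewrite lee_fin sqr_ge0.
by apply: eq_integral => z _; rewrite -EFinM -sqrrN opprB.
Qed.

(** X and G - X are both nondecreasing, so the squared increments of X - G and of X add up to at
    most those of G. As the doubled variance of G is at most 2 and that of X at least 2 - e, that of
    X - G is at most e; [m] is a well-chosen value of X - G. *)
Lemma gaussian_shift (e : R) : (0 <= e)%R ->
  (2 - e)%:E <= \int[(leb \x leb)]_z ((z.1 - z.2) ^+ 2 * (expR (- v z.1) * expR (- v z.2)))%:E ->
  exists m : R, \int[@unif R]_u ((X u - G u - m) ^+ 2)%:E <= e%:E.
Proof.
move=> e0; rewrite -(EE_law pv) => AX.
(* No Gaussian moment is computed: this is [integral_mid_defect_le] for the Gaussian potential. *)
have AG : EE G <= 2%:E.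
  rewrite (EE_law (@pdensity_gauss R)).
  apply: le_trans (integral_mid_defect_le (@strongly_convex1_gauss R)
    (@measurable_gauss_potential R) (@pdensity_gauss R)).
  rewrite leeDr// mule_ge0//; apply: integral_ge0 => z _.
  by rewrite lee_fin !mulr_ge0 ?expR_ge0// mid_defect_ge0//; exact: strongly_convex1_gauss.
pose Y u := (X u - G u)%R.
have mY : measurable_fun setT (Y : measurableTypeR R -> R) by exact: (measurable_funB mX mG).
have s0 (F : R -> R) (z : RR) : 0 <= ((F z.1 - F z.2) ^+ 2)%:E by rewrite lee_fin sqr_ge0.
have minner (F : measurableTypeR R -> R) t : measurable_fun setT F ->
    measurable_fun setT (fun u : measurableTypeR R => ((F u - F t) ^+ 2)%:E).
  move=> mF; have mp : measurable_fun setT (fun y : measurableTypeR R => (y, t : measurableTypeR R)) by exact: pair2_measurable.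
  exact: (measurableT_comp (mdiff mF) mp).
have mouter (F : measurableTypeR R -> R) : measurable_fun setT F ->
    measurable_fun setT (fun t : measurableTypeR R => \int[@unif R]_u ((F u - F t) ^+ 2)%:E).
  by move=> mF; exact: (measurable_fun_fubini_tonelli_G (m1 := @unif R) _ (mdiff mF) (s0 F)).
have in0 (F : R -> R) t : 0 <= \int[@unif R]_u ((F u - F t) ^+ 2)%:E.
  by apply: integral_ge0 => u _; rewrite lee_fin sqr_ge0.
have sum : EE Y + EE X <= EE G.
  rewrite /EE -integral_add; [|exact: mouter|exact: mouter|exact: in0|exact: in0].
  apply: le_integral_unif; [|exact: mouter| |exact: in0|].
  - by apply: emeasurable_funD; exact: mouter.
  - by move=> t; rewrite adde_ge0.
  move=> t t01; rewrite -integral_add; last 4 first.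
  - exact: minner.
  - exact: minner.
  - by move=> u; rewrite lee_fin sqr_ge0.
  - by move=> u; rewrite lee_fin sqr_ge0.
  apply: le_integral_unif; [|exact: minner| | |].
  - by apply: emeasurable_funD; exact: minner.
  - by move=> u; rewrite adde_ge0// lee_fin sqr_ge0.
  - by move=> u; rewrite lee_fin sqr_ge0.
  - by move=> u u01; rewrite -EFinD lee_fin; exact: contraction_sqr.
have Y0 : 0 <= EE Y by apply: integral_ge0 => t _; exact: in0.
have Ye : EE Y <= e%:E.
  have := le_trans sum AG; move: AX Y0; case: (EE X) => [x| |]//; case: (EE Y) => [y| |]//.
  by rewrite -EFinD !lee_fin; lra.
have [t ht] := exists_le_integral (mouter _ mY) (in0 Y) e0 Ye.
by exists (Y t).
Qed.

End gaussian_shift.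

(** * Coupling of mu with the product *)

Section wasserstein_bound.
Local Open Scope ereal_scope.
Context (R : realType) (n : nat) (V : 'rV[R]_n.+1 -> R) (mu : probability 'rV[R]_n.+1 R).
Local Notation leb := (@lebesgue_measure R).
Local Notation lam := (@lebesgue_rV R n).
Hypothesis pV : potential V.
Hypothesis muE : forall A, measurable A ->
  mu A = \int[@lebesgue_rV R n.+1]_(x in A) (expR (- V x))%:E.

Lemma measurable_dotpl (s : 'rV[R]_n.+1) : measurable_fun setT (fun x : 'rV[R]_n.+1 => dotp x s).
Proof. by apply: measurable_dotp; [exact: measurable_id|exact: measurable_cst]. Qed.

Section sliced.
Variables (s : 'rV[R]_n.+1) (c K : R) (L : measurableTypeR R * 'rV[R]_n -> 'rV[R]_n.+1).
Hypotheses (s1 : dotp s s = 1%R) (slL : slicing s c K L).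

Let v : measurableTypeR R -> R := fibre_potential V c L.
Let f : measurableTypeR R -> 'rV[R]_n -> R := fibre_density V L.
Let mv : measurable_fun setT v := measurable_fibre_potential pV slL.
Let sv : strongly_convex1 v.
Proof. by move=> l t t' l0 l1; exact: (fibre_potential_convex pV s1 slL). Qed.
Let pv : pdensity (fun t => expR (- v t)) := pdensity_marginal pV muE slL.

Lemma dvar_marginal : dvar mu (fun x => dotp x s) =
  \int[(leb \x leb)]_z ((z.1 - z.2) ^+ 2 * (expR (- v z.1) * expR (- v z.2)))%:E.
Proof.
have mev : measurable_fun setT (fun t => expR (- v t)) by case: pv.
have md : measurable_fun setT (fun z : measurableTypeR R * measurableTypeR R => ((z.1 - z.2) ^+ 2)%:E).
  apply/measurable_EFinP; apply: (@measurable_funX _ _ _ _ _ 2).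
  apply: measurable_funB.
    exact: (measurable_fst : measurable_fun _ (fst : _ -> measurableTypeR R)).
  exact: (measurable_snd : measurable_fun _ (snd : _ -> measurableTypeR R)).
have d0 (z : R * R) : 0 <= ((z.1 - z.2) ^+ 2)%:E by rewrite lee_fin sqr_ge0.
have md1 t : measurable_fun setT (fun u : R => ((t - u) ^+ 2)%:E).
  have mp : measurable_fun setT (fun y : measurableTypeR R => (t : measurableTypeR R, y)) by exact: pair1_measurable.
  exact: (measurableT_comp md mp).
have me1 : measurable_fun setT (fun z : measurableTypeR R * measurableTypeR R => ((z.1 - z.2) ^+ 2)%:E * (expR (- v z.2))%:E).
  apply: emeasurable_funM; first exact: md.
  by apply/measurable_EFinP; exact: (measurableT_comp mev measurable_snd).
have e10 (z : measurableTypeR R * measurableTypeR R) : 0 <= ((z.1 - z.2) ^+ 2)%:E * (expR (- v z.2))%:E.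
  by rewrite mule_ge0// lee_fin ?sqr_ge0// expR_ge0.
have me2 : measurable_fun setT (fun z : measurableTypeR R * measurableTypeR R => ((z.1 - z.2) ^+ 2 * (expR (- v z.1) * expR (- v z.2)))%:E).
  apply/measurable_EFinP; apply: measurable_funM.
    have mfst : measurable_fun setT (fst : measurableTypeR R * measurableTypeR R -> measurableTypeR R) := measurable_fst.
    have msnd : measurable_fun setT (snd : measurableTypeR R * measurableTypeR R -> measurableTypeR R) := measurable_snd.
    exact: (measurable_funX 2 (measurable_funB mfst msnd)).
  apply: measurable_funM; first exact: (measurableT_comp mev measurable_fst).
  exact: (measurableT_comp mev measurable_snd).
have e20 (z : measurableTypeR R * measurableTypeR R) : 0 <= ((z.1 - z.2) ^+ 2 * (expR (- v z.1) * expR (- v z.2)))%:E.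
  by rewrite lee_fin; apply: mulr_ge0; [exact: sqr_ge0|apply: mulr_ge0; exact: expR_ge0].
pose k (t : measurableTypeR R) := \int[leb]_u (((t - u) ^+ 2)%:E * (expR (- v u))%:E).
have mk : measurable_fun setT k by exact: (measurable_fun_fubini_tonelli_F _ me1 e10).
have k0 t : 0 <= k t by apply: integral_ge0 => u _; exact: (e10 (t, u)).
rewrite /dvar (fubini_tonelli1 _ (measurable_dvar (measurable_dotpl s))); last first.
  by move=> z; rewrite lee_fin sqr_ge0.
transitivity (\int[mu]_x k (dotp x s)).
  apply: eq_integral => x _; rewrite /fubini_F/=.
  rewrite (integral_marginal pV muE slL (md1 (dotp x s)))// => u.
  by rewrite lee_fin sqr_ge0.
rewrite (integral_marginal pV muE slL mk k0) (fubini_tonelli1 _ me2 e20).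
have rearr (a b b' : R) : (a * (b * b'))%:E = a%:E * b'%:E * b%:E.
  by rewrite -!EFinM (mulrC b) mulrA.
apply: eq_integral => t _; rewrite /fubini_F/= /k -integral_scaler.
- by apply: eq_integral => u _; symmetry; exact: rearr.
- exact: expR_ge0.
- have mp : measurable_fun setT (fun y : measurableTypeR R => (t : measurableTypeR R, y)) by exact: pair1_measurable.
  exact: (measurableT_comp me1 mp).
- by move=> u; exact: (e10 (t, u)).
Qed.

Variables (d' : measure_display) (Om : measurableType d') (P : probability Om R)
  (Phi : measurableTypeR R * Om -> 'rV[R]_n).
Hypothesis kn : knothe_coupling f P Phi.

(** The point that the common randomness [p.2] selects in the hyperplane at height [p.1]. *)
Let Xi (p : measurableTypeR R * Om) : 'rV[R]_n.+1 := L (p.1, Phi p).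

Let mPhi : measurable_fun setT Phi. Proof. by case: kn. Qed.
Let mL : measurable_fun setT L. Proof. by case: slL. Qed.

Let mXi : measurable_fun setT Xi.
Proof.
have m1 : measurable_fun setT (fun p : measurableTypeR R * Om => (p.1, Phi p)).
  by apply/measurable_fun_pairP; split; [exact: measurable_fst|exact: mPhi].
exact: (measurableT_comp mL m1).
Qed.

Let mXit t : measurable_fun setT (fun w => Xi (t, w)).
Proof.
have mp : measurable_fun setT (fun w : Om => (t : measurableTypeR R, w)) by exact: pair1_measurable.
exact: (measurableT_comp mXi mp).
Qed.

Let cost (x y : 'rV[R]_n.+1) : R :=
  dotp (orth_proj s x - orth_proj s y) (orth_proj s x - orth_proj s y).

Let cost_ge0 x y : (0 <= cost x y)%R. Proof. exact: dotp_ge0. Qed.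

Let measurable_cost d (T : measurableType d) (a b : T -> 'rV[R]_n.+1) :
  measurable_fun setT a -> measurable_fun setT b ->
  measurable_fun setT (fun t => (cost (a t) (b t))%:E).
Proof.
move=> ma mb; apply/measurable_EFinP.
have mab : measurable_fun setT (fun t => orth_proj s (a t) - orth_proj s (b t))%R.
  by apply: measurable_rVB; exact: (measurableT_comp (measurable_orth_proj s)).
exact: measurable_dotp.
Qed.

(** The rearrangement inequality for the fibres t and t', tested on the density of the middle fibre,
    bounds by 1 the mean of some exp E. Strong convexity of [V] contributes cost / 8 + (t - t')^2 /
    8 to E and the normalising masses contribute the values of [v], so E >= cost / 8 - mid_defect;
    then exp E >= 1 + E. *)
Let fibre_cost t t' : \int[P]_w (cost (Xi (t, w)) (Xi (t', w)))%:E <= (8 * mid_defect v t t')%:E.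
Proof.
have [_ _ knP] := kn; have [_ sV _] := pV; have [_ _ Llin _ _] := slL.
set D := mid_defect v t t'; have D0 : (0 <= D)%R by exact: mid_defect_ge0.
pose r := ((t + t') / 2)%R.
have [mfr fr0 _ fr1] := fibre_density_gdensity pV slL r.
have h0 : (0 < 2^-1 :> R)%R by rewrite invr_gt0.
have h1 : (2^-1 < 1 :> R)%R by lra.
have mfr' : measurable_fun setT (fun y => (f r y)%:E) by exact/measurable_EFinP.
have hk := knP t t' 2^-1%R _ h0 h1 mfr' (fun y => ltW (fr0 y)).
rewrite fr1 in hk; move: hk; set I := (X in \int[P]_w X w) => hk.
have mft u : measurable_fun setT (f u) by case: (fibre_density_gdensity pV slL u).
have mPhit u : measurable_fun setT (fun w => Phi (u, w)).
  have mp : measurable_fun setT (fun w : Om => (u : measurableTypeR R, w)) by exact: pair1_measurable.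
  exact: (measurableT_comp mPhi mp).
have mI : measurable_fun setT I.
  have mlin : measurable_fun setT (fun w => ((1 - 2^-1) *: Phi (t, w) + 2^-1 *: Phi (t', w))%R).
    apply: measurable_rVD; apply: measurable_rVZ.
    - exact: measurable_cst.
    - exact: mPhit.
    - exact: measurable_cst.
    - exact: mPhit.
  apply: emeasurable_funM; first exact: (measurableT_comp mfr' mlin).
  apply/measurable_EFinP; apply: measurable_interp_weight.
    exact: (measurableT_comp (mft t) (mPhit t)).
  exact: (measurableT_comp (mft t') (mPhit t')).
have I0 w : 0 <= I w by rewrite mule_ge0// lee_fin ?interp_weight_ge0// ltW.
have lnf u y : ln (f u y) = (- ln (mass (fibre V L u)) - V (L (u, y)))%R.
  have m0 := fibre_mass_gt0 pV slL u.
  rewrite /f /fibre_density lnM ?posrE ?invr_gt0 ?expR_gt0//.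
  by rewrite lnV ?posrE// expRK.
have vE u : v u = (- ln c - ln (mass (fibre V L u)))%R.
  have m0 := fibre_mass_gt0 pV slL u; have [c0 _ _ _ _] := slL.
  by rewrite /v /fibre_potential lnM ?posrE// opprD.
have pw w : 1 + (8^-1)%:E * (cost (Xi (t, w)) (Xi (t', w)))%:E <= I w + D%:E.
  rewrite /I -[f r _]lnK ?posrE// /interp_weight -!EFinM -!EFinD lee_fin -expRD !lnf.
  set y := Phi (t, w); set y' := Phi (t', w).
  have Lr : L (r, (1 - 2^-1) *: y + 2^-1 *: y')%R = ((1 - 2^-1) *: L (t, y) + 2^-1 *: L (t', y'))%R.
    by rewrite -Llin; congr (L (_, _)); rewrite /r; lra.
  rewrite Lr; have := sV _ (L (t, y)) (L (t', y')) h0 h1.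
  rewrite (dotp_slice_ge s1 slL) -/(cost _ _) -/(Xi (t, w)) -/(Xi (t', w)).
  rewrite /D /mid_defect !vE -/r.
  set C := cost _ _; set A := V (Xi _); set A' := V (Xi _); set B := V (_ + _)%R.
  set lt := ln (mass (fibre V L t)); set lt' := ln (mass (fibre V L t')); set lr := ln (mass (fibre V L r)).
  move=> hB; apply: le_trans (lerD (expR_ge1Dx _) (lexx _)).
  by clearbody C A A' B lt lt' lr; lra.
have mC := measurable_cost (mXit t) (mXit t').
have C0 w : 0 <= (cost (Xi (t, w)) (Xi (t', w)))%:E by rewrite lee_fin cost_ge0.
have cst1 (a : R) : \int[P]_w (cst a%:E w) = a%:E by rewrite integral_cst//= probability_setT mule1.
have : 1 + (8^-1)%:E * \int[P]_w (cost (Xi (t, w)) (Xi (t', w)))%:E <= 1 + D%:E.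
  apply: (@le_trans _ _ (\int[P]_w I w + D%:E)); last by rewrite leeD2r.
  rewrite -{1}(cst1 1%R) -(cst1 D) -integral_scalel; [|by rewrite invr_ge0|exact: mC|exact: C0].
  rewrite -integral_add; last 4 first.
  - exact: measurable_cst.
  - exact: measurable_funeM.
  - by move=> w; rewrite lee_fin.
  - by move=> w; rewrite mule_ge0// lee_fin invr_ge0.
  rewrite -(integral_add _ mI); last 3 first.
  - exact: measurable_cst.
  - exact: I0.
  - by move=> w; rewrite lee_fin.
  apply: integral_le.
  - by apply: emeasurable_funD; [exact: measurable_cst|exact: measurable_funeM].
  - by apply: emeasurable_funD; [exact: mI|exact: measurable_cst].
  - by move=> w; rewrite adde_ge0// mule_ge0// lee_fin invr_ge0.
  - exact: pw.
have : 0 <= \int[P]_w (cost (Xi (t, w)) (Xi (t', w)))%:E by exact: integral_ge0.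
case: (\int[P]_w _) => [x| |]// x0.
- by rewrite -EFinM -!EFinD !lee_fin; lra.
- by rewrite gt0_muley ?lte_fin ?invr_gt0// addey// leye_eq.
Qed.

Local Notation X := (quantile (fun t => expR (- v t))).
Local Notation G := (quantile (fun t : measurableTypeR R => expR (- gauss_potential t))).
Let P2 : probability (measurableTypeR R * Om)%type R := (@unif R \x P)%E.
Local Notation P3 := (@unif R \x P2)%E.

Let mX : measurable_fun setT (X : measurableTypeR R -> measurableTypeR R) := measurable_quantile1 pv.
Let mG : measurable_fun setT (G : measurableTypeR R -> measurableTypeR R) := measurable_quantile1 (@pdensity_gauss R).

Let Y (z : measurableTypeR R * Om) : 'rV[R]_n.+1 := Xi (X z.1, z.2).

Let mY : measurable_fun setT Y.
Proof.
have m1 : measurable_fun setT (fun z : measurableTypeR R * Om => (X z.1 : measurableTypeR R, z.2)).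
  apply/measurable_fun_pairP; split; last exact: measurable_snd.
  exact: (measurableT_comp mX measurable_fst).
exact: (measurableT_comp mXi m1).
Qed.

Let law_Y (h : 'rV[R]_n.+1 -> \bar R) : measurable_fun setT h -> (forall x, 0 <= h x) ->
  \int[P2]_z h (Y z) = \int[mu]_x h x.
Proof.
move=> mh h0; have [_ lawP _] := kn.
have mhY : measurable_fun setT (fun z => h (Y z)) by exact: (measurableT_comp mh mY).
have mhL : measurable_fun setT (fun p => h (L p)) by exact: (measurableT_comp mh mL).
have mff : measurable_fun setT (fun p : measurableTypeR R * 'rV[R]_n => f p.1 p.2) := measurable_fibre_density pV slL.
have f0 t y : (0 <= f t y)%R by have [_ /(_ y)/ltW] := fibre_density_gdensity pV slL t.
have mF : measurable_fun setT (fun p : measurableTypeR R * 'rV[R]_n => h (L p) * (f p.1 p.2)%:E).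
  by apply: emeasurable_funM => //; exact/measurable_EFinP.
have F0 (p : measurableTypeR R * 'rV[R]_n) : 0 <= h (L p) * (f p.1 p.2)%:E by rewrite mule_ge0// lee_fin.
pose k (t : measurableTypeR R) := \int[lam]_y (h (L (t, y)) * (f t y)%:E).
have mk : measurable_fun setT k by exact: (measurable_fun_fubini_tonelli_F _ mF F0).
have k0 t : 0 <= k t by apply: integral_ge0 => y _; exact: (F0 (t, y)).
rewrite /P2 (fubini_tonelli1 _ mhY)// (integral_fibre pV muE slL mh h0).
rewrite -(integral_quantile pv mk k0); apply: eq_integral => u _; rewrite /fubini_F /Y /Xi/=.
rewrite (lawP (X u) (fun y => h (L (X u, y))))//.
have mp : measurable_fun setT (fun y : 'rV[R]_n => (X u : measurableTypeR R, y)) by exact: pair1_measurable.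
exact: (measurableT_comp mhL mp).
Qed.

Variable m : R.

(** With z = (u, (t, w)), both points use the fibre randomness [w], while [Z2] takes its orthogonal
    part at the level [t], independent of [u]; this makes the two summands of [Z2] independent. *)
Let Z1 (z : measurableTypeR R * (measurableTypeR R * Om)) : 'rV[R]_n.+1 := Y (z.1, z.2.2).
Let Z2 (z : measurableTypeR R * (measurableTypeR R * Om)) : 'rV[R]_n.+1 :=
  (line_param (m *: s) s (G z.1) + orth_proj s (Y z.2))%R.

Let mpr : measurable_fun setT (fun z : measurableTypeR R * (measurableTypeR R * Om) => (z.1, z.2.2)).
Proof.
apply/measurable_fun_pairP; split; first exact: measurable_fst.
exact: (measurableT_comp measurable_snd measurable_snd).
Qed.

Let mZ1 : measurable_fun setT Z1. Proof. exact: (measurableT_comp mY mpr). Qed.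

Let mZ2 : measurable_fun setT Z2.
Proof.
apply: measurable_rVD.
  have m1 : measurable_fun setT (fun z : measurableTypeR R * (measurableTypeR R * Om) => G z.1 : measurableTypeR R).
    exact: (measurableT_comp mG measurable_fst).
  exact: (measurableT_comp (measurable_line_param (m *: s) s) m1).
have m2 : measurable_fun setT (fun z : measurableTypeR R * (measurableTypeR R * Om) => Y z.2).
  exact: (measurableT_comp mY measurable_snd).
exact: (measurableT_comp (measurable_orth_proj s) m2).
Qed.

Let law_Z1 (h : 'rV[R]_n.+1 -> \bar R) : measurable_fun setT h -> (forall x, 0 <= h x) ->
  \int[P3]_z h (Z1 z) = \int[mu]_x h x.
Proof.
move=> mh h0; rewrite -(law_Y mh h0).
have mhZ : measurable_fun setT (fun z => h (Z1 z)) by exact: (measurableT_comp mh mZ1).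
have mhY : measurable_fun setT (fun z => h (Y z)) by exact: (measurableT_comp mh mY).
rewrite (fubini_tonelli1 _ mhZ)// /P2 (fubini_tonelli1 _ mhY)//.
apply: eq_integral => u _; rewrite /fubini_F /Z1/=.
have mhu : measurable_fun setT (fun w => h (Y (u, w))).
  have mp : measurable_fun setT (fun w : Om => (u : measurableTypeR R, w)) by exact: pair1_measurable.
  exact: (measurableT_comp mhY mp).
exact: (integral_prod_snd (@unif R) P mhu (fun w => h0 _)).
Qed.

Let law_Z2 (h : 'rV[R]_n.+1 -> \bar R) : measurable_fun setT h -> (forall x, 0 <= h x) ->
  \int[P3]_z h (Z2 z) =
  \int[prod_direct_sum (gaussian_line (m *: s) s) (orth_marginal s mu)]_x h x.
Proof.
move=> mh h0.
have mhZ : measurable_fun setT (fun z => h (Z2 z)) by exact: (measurableT_comp mh mZ2).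
pose F (z : measurableTypeR R * 'rV[R]_n.+1) := h (line_param (m *: s) s z.1 + orth_proj s z.2)%R.
have mF : measurable_fun setT F.
  have m1 : measurable_fun setT (fun z : measurableTypeR R * 'rV[R]_n.+1 => (line_param (m *: s) s z.1 + orth_proj s z.2)%R).
    apply: measurable_rVD.
      exact: (measurableT_comp (measurable_line_param (m *: s) s) measurable_fst).
    exact: (measurableT_comp (measurable_orth_proj s) measurable_snd).
  exact: (measurableT_comp mh m1).
have F0 z : 0 <= F z by exact: h0.
pose k (t : measurableTypeR R) := \int[mu]_x F (t, x).
have mk : measurable_fun setT k by exact: (measurable_fun_fubini_tonelli_F _ mF F0).
have k0 t : 0 <= k t by apply: integral_ge0 => y _; exact: F0.
have mFt t : measurable_fun setT (fun x => F (t, x)).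
  have mp : measurable_fun setT (fun w : 'rV[R]_n.+1 => (t : measurableTypeR R, w)) by exact: pair1_measurable.
  exact: (measurableT_comp mF mp).
transitivity (\int[leb]_t (k t * (expR (- gauss_potential t))%:E)).
  rewrite (fubini_tonelli1 _ mhZ)// -(integral_quantile (@pdensity_gauss R) mk k0).
  apply: eq_integral => u _; rewrite /fubini_F /Z2/=.
  exact: (law_Y (mFt (G u)) (fun x => F0 (G u, x))).
transitivity (\int[@normal_prob R 0 1]_t k t).
  rewrite (@integral_density _ _ _ leb (@normal_prob R 0 1) (normal_pdf 0 1))//.
  - by apply: eq_integral => t _; rewrite expR_gauss_potential.
  - exact: measurable_normal_pdf.
  - by move=> x; exact: normal_pdf_ge0.
have mhd : measurable_fun setT (fun z : 'rV[R]_n.+1 * 'rV[R]_n.+1 => h (direct_sum z)).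
  exact: (measurableT_comp mh (@measurable_direct_sum R n.+1)).
rewrite ge0_integral_distribution// (fubini_tonelli1 _ mhd)//.
pose k2 (a : 'rV[R]_n.+1) := \int[orth_marginal s mu]_b h (a + b)%R.
have mk2 : measurable_fun setT k2 by exact: (measurable_fun_fubini_tonelli_F _ mhd (fun=> h0 _)).
have k20 a : 0 <= k2 a by exact: integral_ge0.
rewrite [RHS](ge0_integral_distribution (line_param (m *: s) s) mk2 k20).
apply: eq_integral => t _; rewrite /k /F /k2/=.
rewrite (@ge0_integral_distribution _ _ _ _ _ mu (orth_proj s) (fun b => h (line_param (m *: s) s t + b)%R))//.
have mp : measurable_fun setT (fun b : 'rV[R]_n.+1 => (line_param (m *: s) s t + b)%R).
  by apply: measurable_rVD; [exact: measurable_cst|exact: measurable_id].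
exact: (measurableT_comp mh mp).
Qed.

(** By Pythagoras the squared distance between [Z1] and [Z2] is a + b. The mean of [a] is at most e,
    and that of [b] at most 8 times the mean defect, itself at most e / 4: in all 3 e. *)
Lemma sliced_wasserstein (e : R) : (0 <= e)%R ->
  \int[@unif R]_u ((X u - G u - m) ^+ 2)%:E <= e%:E ->
  (2 - e)%:E <= dvar mu (fun x => dotp x s) ->
  wasserstein1 mu (prod_direct_sum (gaussian_line (m *: s) s) (orth_marginal s mu)) <=
    (Num.sqrt (3 * e))%:E.
Proof.
move=> e0 hm hq; set nu := prod_direct_sum _ _.
have mZ : measurable_fun setT (fun z => (Z1 z, Z2 z)) by apply/measurable_fun_pairP; split.
pose mZmix := isMeasurableFun.Build _ _ _ _ _ mZ.
pose Z : {mfun _ >-> _} := HB.pack (fun z => (Z1 z, Z2 z)) mZmix.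
pose PP : probability _ R := P3.
pose pi : probability _ R := distribution PP Z.
have mset (B : set ('rV[R]_n.+1 * 'rV[R]_n.+1)) : measurable B -> measurable (Z @^-1` B).
  by move=> mB; have := mZ measurableT B mB; rewrite setTI.
have cpl : coupling mu nu pi.
  split=> A mA.
  - transitivity (\int[P3]_z (\1_A (Z1 z))%:E); last first.
      rewrite (@law_Z1 (fun x => (\1_A x)%:E)) ?integral_indic ?setIT//.
      by apply/measurable_EFinP; exact: measurable_indic.
    rewrite -[LHS]/(PP (Z @^-1` (A `*` setT))) -[LHS]mul1e -[in LHS](setIT (Z @^-1` _)).
    rewrite mul1e -integral_indic//; last by apply: mset; exact: measurableX.
    apply: eq_integral => z _; rewrite !indicE; congr (nat_of_bool _)%:R%:E.
    by apply/idP/idP => /set_mem h; apply/mem_set; [case: h|split].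
  - transitivity (\int[P3]_z (\1_A (Z2 z))%:E); last first.
      rewrite (@law_Z2 (fun x => (\1_A x)%:E)) ?integral_indic ?setIT//.
      by apply/measurable_EFinP; exact: measurable_indic.
    rewrite -[LHS]/(PP (Z @^-1` (setT `*` A))) -[LHS]mul1e -[in LHS](setIT (Z @^-1` _)).
    rewrite mul1e -integral_indic//; last by apply: mset; exact: measurableX.
    apply: eq_integral => z _; rewrite !indicE; congr (nat_of_bool _)%:R%:E.
    by apply/idP/idP => /set_mem h; apply/mem_set; [case: h|split].
have men : measurable_fun setT (fun z : 'rV[R]_n.+1 * 'rV[R]_n.+1 => (enorm (z.1 - z.2))%:E).
  apply/measurable_EFinP; apply: measurable_enorm.
  by apply: measurable_rVB; [exact: measurable_fst|exact: measurable_snd].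
have W1 : wasserstein1 mu nu <= \int[P3]_z (enorm (Z1 z - Z2 z))%:E.
  apply: ereal_inf_lbound; exists pi => //.
  rewrite (ge0_integral_distribution Z men)// => z.
  by rewrite lee_fin sqrtr_ge0.
pose a (z : measurableTypeR R * (measurableTypeR R * Om)) := ((X z.1 - G z.1 - m) ^+ 2)%R.
pose b (z : measurableTypeR R * (measurableTypeR R * Om)) := cost (Y (z.1, z.2.2)) (Y z.2).
have dist z : dotp (Z1 z - Z2 z) (Z1 z - Z2 z) = (a z + b z)%R.
  rewrite /a /b /cost /Z2 /line_param.
  have Ys : dotp (Y (z.1, z.2.2)) s = X z.1 by case: slL => _ _ _ Ls _; rewrite /Y /Xi Ls.
  set x := Y (z.1, _) in Ys *; set y := Y z.2.
  have orth u : dotp s (orth_proj s u) = 0%R.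
    by rewrite /orth_proj dotpDr dotpNr dotpZr s1 mulr1 dotpC subrr.
  have -> : (Z1 z - (m *: s + G z.1 *: s + orth_proj s y) =
      (X z.1 - G z.1 - m) *: s + (orth_proj s x - orth_proj s y))%R.
    rewrite -[Z1 z]/x [orth_proj s x]/orth_proj Ys.
    generalize (X z.1) (G z.1) (orth_proj s y) x => a1 a2 a3 a4.
    by apply/rowP => i; rewrite !mxE; ring.
  set w := (orth_proj s x - _)%R; set k := (X z.1 - _ - m)%R.
  have ws : dotp s w = 0%R by rewrite /w dotpDr dotpNr !orth subrr.
  by clearbody w k; rewrite !dotpDl !dotpDr !dotpZl !dotpZr s1 [dotp w s]dotpC ws; ring.
have ma1 : measurable_fun setT (fun u : measurableTypeR R => ((X u - G u - m) ^+ 2)%:E).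
  apply/measurable_EFinP; apply: (@measurable_funX _ _ _ _ _ 2).
  have mXG := measurable_funB mX mG.
  exact: (measurable_funB mXG (measurable_cst m)).
have a10 u : 0 <= ((X u - G u - m) ^+ 2)%:E by rewrite lee_fin sqr_ge0.
have ma : measurable_fun setT (fun z => (a z)%:E) by exact: (measurableT_comp ma1 measurable_fst).
have mb : measurable_fun setT (fun z => (b z)%:E).
  apply: measurable_cost; first exact: mZ1.
  exact: (measurableT_comp mY measurable_snd).
have a0 z : 0 <= (a z)%:E by exact: a10.
have b0 z : 0 <= (b z)%:E by rewrite lee_fin cost_ge0.
have Ea : \int[P3]_z (a z)%:E <= e%:E.
  by rewrite (integral_prod_fst (@unif R) P2 ma1 a10).
have mD := measurable_mid_defect mv.
have D0 (z : R * R) : (0 <= mid_defect v z.1 z.2)%R by exact: mid_defect_ge0.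
have Eb : \int[P3]_z (b z)%:E <= (2 * e)%:E.
  apply: (@le_trans _ _ (\int[@unif R]_u \int[@unif R]_t (8 * mid_defect v (X u) (X t))%:E)).
    have mD8 : measurable_fun setT (fun z : measurableTypeR R * measurableTypeR R => (8 * mid_defect v z.1 z.2)%:E).
      by apply/measurable_EFinP; apply: measurable_funM => //; exact: measurable_cst.
    have mXX : measurable_fun setT (fun z : measurableTypeR R * measurableTypeR R => (X z.1 : measurableTypeR R, X z.2 : measurableTypeR R)).
      apply/measurable_fun_pairP; split.
        exact: (measurableT_comp mX measurable_fst).
      exact: (measurableT_comp mX measurable_snd).
    have mDX : measurable_fun setT (fun z : measurableTypeR R * measurableTypeR R => (8 * mid_defect v (X z.1) (X z.2))%:E).
      exact: (measurableT_comp mD8 mXX).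
    have DX0 (z : measurableTypeR R * measurableTypeR R) : 0 <= (8 * mid_defect v (X z.1) (X z.2))%:E.
      by rewrite lee_fin mulr_ge0//; exact: (D0 (X z.1, X z.2)).
    rewrite (fubini_tonelli1 _ mb b0); apply: integral_le.
    - exact: (measurable_fun_fubini_tonelli_F _ mb b0).
    - exact: (measurable_fun_fubini_tonelli_F _ mDX DX0).
    - by move=> u; apply: integral_ge0 => z _; exact: b0.
    move=> u; have mbu : measurable_fun setT (fun z => (b (u, z))%:E).
      have mp : measurable_fun setT (fun w : measurableTypeR R * Om => (u : measurableTypeR R, w)) by exact: pair1_measurable.
      exact: (measurableT_comp mb mp).
    rewrite /fubini_F /P2 (fubini_tonelli1 _ mbu (fun z => b0 _)); apply: integral_le.
    - exact: (measurable_fun_fubini_tonelli_F _ mbu (fun z => b0 _)).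
    - have mp : measurable_fun setT (fun w : measurableTypeR R => (u : measurableTypeR R, w)) by exact: pair1_measurable.
      exact: (measurableT_comp mDX mp).
    - by move=> t; apply: integral_ge0 => w _; exact: b0.
    - move=> t; rewrite /fubini_F; exact: (fibre_cost (X u) (X t)).
  have mD8 : measurable_fun setT (fun z : measurableTypeR R * measurableTypeR R => (8 * mid_defect v z.1 z.2)%:E).
    by apply/measurable_EFinP; apply: measurable_funM => //; exact: measurable_cst.
  rewrite (integral_quantile2 pv mD8); last by move=> z; rewrite lee_fin mulr_ge0.
  have le2 := integral_mid_defect_le sv mv pv.
  rewrite dvar_marginal in hq.
  move: le2 hq; set q := \int[_]_z ((_ - _) ^+ 2 * _)%:E; set D := \int[_]_z (mid_defect _ _ _ * _)%:E.
  have -> : \int[(leb \x leb)]_z ((8 * mid_defect v z.1 z.2)%:E * (expR (- v z.1) * expR (- v z.2))%:E) = 8%:E * D.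
    rewrite /D -integral_scalel//; last 2 first.
    - apply/measurable_EFinP; apply: measurable_funM => //.
      have [mev _ _] := pv; apply: measurable_funM; first exact: (measurableT_comp mev measurable_fst).
      exact: (measurableT_comp mev measurable_snd).
    - by move=> z; rewrite lee_fin mulr_ge0// mulr_ge0 ?expR_ge0.
    by apply: eq_integral => z _; rewrite -!EFinM -mulrA.
  have DD0 : 0 <= D by apply: integral_ge0 => z _; rewrite lee_fin mulr_ge0// mulr_ge0 ?expR_ge0.
  case: q => [q| |]//; case: D DD0 => [D| |]// DD0.
  - by rewrite -!EFinM -EFinD !lee_fin; lra.
  - by rewrite gt0_muley ?lte_fin// addye.
  - by rewrite gt0_muley ?lte_fin// addye.
(* N <= eta / 2 + N^2 / (2 eta) stands in for the Cauchy-Schwarz inequality. The best choice is eta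
   = sqrt(3 e); for e = 0 it is reached by letting eta tend to 0. *)
have bound (eta : R) : (0 < eta)%R -> wasserstein1 mu nu <= ((eta + 3 * e / eta) / 2)%:E.
  move=> eta0; apply: (le_trans W1).
  have cst1 : \int[P3]_z (cst (eta / 2)%:E z) = (eta / 2)%:E.
    by rewrite integral_cst//= (probability_setT PP) mule1.
  have k0 : (0 <= (2 * eta)^-1)%R by rewrite invr_ge0 mulr_ge0// ltW.
  apply: (@le_trans _ _ (\int[P3]_z (cst (eta / 2)%:E z + (2 * eta)^-1%:E * ((a z)%:E + (b z)%:E)))).
    apply: integral_le.
    - exact: (measurableT_comp men mZ).
    - apply: emeasurable_funD; first exact: measurable_cst.
      by apply: measurable_funeM; exact: emeasurable_funD.
    - by move=> z; rewrite lee_fin sqrtr_ge0.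
    - move=> z; rewrite -!EFinD lee_fin -dist -sqr_enorm; set N := enorm _.
      have := sqr_ge0 (N - eta)%R => h.
      have -> : (eta / 2 + (2 * eta)^-1 * N ^+ 2 = N + (2 * eta)^-1 * (N - eta) ^+ 2)%R.
        by field; exact: lt0r_neq0.
      by rewrite lerDl mulr_ge0.
  rewrite integral_add; last 4 first.
  - exact: measurable_cst.
  - by apply: measurable_funeM; exact: emeasurable_funD.
  - by move=> z; rewrite lee_fin divr_ge0// ltW.
  - by move=> z; rewrite mule_ge0// adde_ge0.
  rewrite cst1 integral_scalel//; last 2 first.
  - exact: emeasurable_funD.
  - by move=> z; rewrite adde_ge0.
  rewrite integral_add//; apply: (@le_trans _ _ ((eta / 2)%:E + (2 * eta)^-1%:E * (e%:E + (2 * e)%:E))).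
    by rewrite leeD2l// lee_wpmul2l// leeD.
  rewrite -!EFinD lee_fin le_eqVlt; apply/orP; left; apply/eqP.
  by field; exact: lt0r_neq0.
have [e00|ep] := eqVneq e 0%R.
  rewrite e00 mulr0 sqrtr0; apply/lee_addgt0Pr => r r0; rewrite add0e.
  apply: le_trans (bound r r0) _; rewrite e00 mulr0 mul0r addr0 lee_fin; lra.
have e3 : (0 < 3 * e)%R by rewrite mulr_gt0// lt0r ep.
have se : (0 < Num.sqrt (3 * e))%R by rewrite sqrtr_gt0.
apply: le_trans (bound _ se) _; rewrite lee_fin.
have -> : (3 * e / Num.sqrt (3 * e) = Num.sqrt (3 * e))%R.
  by rewrite -{1}(sqr_sqrtr (ltW e3)) expr2 mulfK// gt_eqF.
by move: (Num.sqrt _) => w; lra.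
Qed.

End sliced.

Theorem wasserstein_bound (s : 'rV[R]_n.+1) (e : R) : dotp s s = 1%R -> (0 <= e)%R ->
  (2 - e)%:E <= dvar mu (fun x => dotp x s) ->
  exists2 p : 'rV[R]_n.+1, (p <= s)%MS &
    wasserstein1 mu (prod_direct_sum (gaussian_line p s) (orth_marginal s mu)) <=
    (Num.sqrt (3 * e))%:E.
Proof.
move=> s1 e0 hq; have [c [K [L slL]]] := slicing_exists s1.
have [d' [Om [P [Phi kn]]]] := knothe (measurable_fibre_density pV slL)
  (fibre_density_gdensity pV slL).
have hq' := hq.
rewrite (dvar_marginal slL) in hq'.
have sv : strongly_convex1 (fibre_potential V c L).
  by move=> l t t' l0 l1; exact: (fibre_potential_convex pV s1 slL).
have [m hm] := gaussian_shift sv (pdensity_marginal pV muE slL) e0 hq'.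
exists (m *: s)%R; first exact: scalemx_sub.
exact: (sliced_wasserstein s1 slL kn e0 hm hq).
Qed.

End wasserstein_bound.

(** * Smooth functions *)

Section line_derivatives.
Context (R : realType).

Lemma is_derive_line n (W : normedModType R) (f : 'rV[R]_n -> W) x v t df :
  is_derive (x + t *: v) v f df -> is_derive t (1 : R) (fun s : R => f (x + s *: v)) df.
Proof.
have E : (fun h : R => h^-1 *: (((fun s : R => f (x + s *: v)) \o shift t) (h *: (1 : R)) - f (x + t *: v))) =
    (fun h => h^-1 *: ((f \o shift (x + t *: v)) (h *: v) - f (x + t *: v))).
  by apply/funext => h /=; rewrite [h *: (1 : R)]mulr1 scalerDl [in RHS]addrCA.
move=> [h1 h2]; split; first by rewrite /derivable E.
by rewrite -h2 /derive E.
Qed.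

Lemma is_derive_gradient n (f : 'rV[R]_n -> R) x v :
  differentiable f x -> is_derive x v f (dotp (gradient f x) v).
Proof.
move=> df; apply: DeriveDef; first exact: diff_derivable.
rewrite deriveE// {1}[v]row_sum_delta linear_sum; apply: eq_bigr => i _.
by rewrite linearZ/= mxE deriveE// mulrC.
Qed.

Lemma is_derive_coord n (g : 'rV[R]_n -> 'rV[R]_n) x v dg i :
  is_derive x v g dg -> is_derive x v (fun y => g y 0 i) (dg 0 i).
Proof.
move=> [h <-]; have := cvg_comp _ _ h (@coord_continuous _ _ _ 0 i _).
set q := (X in X @ 0^' --> _); rewrite -/(derive g x v) => hq.
have E : q = (fun h : R => h^-1 *: (((fun y => g y 0 i) \o shift x) (h *: v) - g x 0 i)).
  by apply/funext => t; rewrite /q/= !mxE.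
by rewrite E in hq; apply: DeriveDef; [exact: cvgP hq|exact: cvg_lim hq].
Qed.

Lemma is_derive_dotp n (g : 'rV[R]_n -> 'rV[R]_n) x v (dg w : 'rV[R]_n) :
  (forall i, is_derive x v (fun y => g y 0 i) (dg 0 i)) ->
  is_derive x v (fun y => dotp (g y) w) (dotp dg w).
Proof.
move=> h; have -> : (fun y => dotp (g y) w) = \sum_i (w 0 i *: (fun y => g y 0 i)).
  by apply/funext => y; rewrite fct_sumE; apply: eq_bigr => i _; rewrite mulrC.
have -> : dotp dg w = \sum_i (w 0 i *: dg 0 i) by apply: eq_bigr => i _; rewrite mulrC.
by apply: is_derive_sum => i; exact: is_deriveZ.
Qed.

Lemma mean_value (f df : R -> R) (a b : R) : a < b -> (forall t, is_derive t (1 : R) f (df t)) ->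
  exists2 c, a < c < b & f b - f a = df c * (b - a).
Proof.
move=> ab h; have cf : {within `[a, b], continuous f}.
  apply: derivable_within_continuous => t _; exact: ex_derive.
have [c] := MVT ab (fun t _ => h t) cf.
by rewrite in_itv/= => cab E; exists c.
Qed.

End line_derivatives.

Section second_order.
Context (R : realType).
Variables (f f1 f2 : R -> R) (q : R).
Hypotheses (df : forall t, is_derive t (1 : R) f (f1 t))
  (df1 : forall t, is_derive t (1 : R) f1 (f2 t)) (qf2 : forall t, q <= f2 t).

Let f1_growth s t : s <= t -> q * (t - s) <= f1 t - f1 s.
Proof.
rewrite le_eqVlt => /orP[/eqP ->|st]; first by rewrite !subrr mulr0.
have [c _ ->] := mean_value st df1; rewrite ler_wpM2r//; lra.
Qed.

Let h (t : R) := f t - q / 2 * t ^+ 2.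

Let dh t : is_derive t (1 : R) h (f1 t - q * t).
Proof.
have -> : h = f - (q / 2) *: (fun s : R => s) ^+ 2.
  by apply/funext => s; rewrite /h !fctE.
by apply: is_derive_eq; rewrite -[_ *: _]/(_ * _) -[_ *: _]/(_ * _) -[t ^+ 2.-1]/t; field.
Qed.

Lemma second_order_lower : f 0 + f1 0 + q / 2 <= f 1.
Proof.
have [c /andP[c0 c1] E] := mean_value ltr01 dh.
have := f1_growth (ltW c0); move: E; rewrite /h; lra.
Qed.

(** The second derivative may be discontinuous, so Taylor's formula with integral remainder is
    replaced by the mean value theorem for f - q t^2 / 2 on [0, l] and [l, 1], the derivative of
    this function being nondecreasing. *)
Lemma second_order_convex (l : R) : 0 < l -> l < 1 ->
  f l <= (1 - l) * f 0 + l * f 1 - l * (1 - l) / 2 * q.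
Proof.
move=> l0 l1; have [a /andP[a0 al] E] := mean_value l0 dh.
have [b /andP[lb b1] E'] := mean_value l1 dh.
have := f1_growth (ltW (lt_trans al lb)); move: E E'; rewrite /h.
move: (f1 a) (f1 b) => A B E E' AB.
have key : 0 <= (B - A - q * (b - a)) * (l * (1 - l)).
  by apply: mulr_ge0; [lra|apply: mulr_ge0; lra].
have F0 : f 0 = f l - q / 2 * l ^+ 2 - (A - q * a) * l by lra.
have F1 : f 1 = f l - q / 2 * l ^+ 2 + q / 2 + (B - q * b) * (1 - l) by lra.
rewrite F0 F1 -subr_ge0; apply: le_trans key _; rewrite le_eqVlt; apply/orP; left.
by apply/eqP; field.
Qed.

End second_order.

Section potential_of_hessian.
Context (R : realType) (n : nat) (V : 'rV[R]_n -> R).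
Hypotheses (dV : twice_differentiable V) (hV : forall x, loewner_le 1%:M (hessian V x)).

Let f1 x v t := dotp (gradient V (x + t *: v)) v.
Let f2 x v t := dotp (v *m hessian V (x + t *: v)) v.

Let df x v t : is_derive t (1 : R) (fun s => V (x + s *: v)) (f1 x v t).
Proof. by apply: is_derive_line; apply: is_derive_gradient; exact: dV.1. Qed.

Let df1 x v t : is_derive t (1 : R) (f1 x v) (f2 x v t).
Proof.
apply: (@is_derive_line _ _ _ (fun y => dotp (gradient V y) v)).
have dg := dV.2 (x + t *: v); apply: is_derive_dotp => i; apply: is_derive_coord.
by rewrite /hessian -deriveEjacobian//; apply/derivableP/diff_derivable.
Qed.

Let qf2 x v t : dotp v v <= f2 x v t.
Proof.
have := hV (x + t *: v) v; rewrite mulmxBr mulmx1 !dotpE.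
by rewrite subr_ge0.
Qed.

(** Along a line of direction v the matrix inequality says that the second derivative is at least
    |v|^2. In the expansion at 0 half of the quadratic term absorbs the linear one, hence the rate
    1/4. *)
Lemma potential_of_hessian : potential V.
Proof.
split.
- by apply: continuous_measurable_rV => x; apply: differentiable_continuous; exact: dV.1.
- move=> l x y l0 l1; have := second_order_convex (df x (y - x)) (df1 x (y - x)) (qf2 x (y - x)) l0 l1.
  rewrite scale0r addr0 scale1r [x + (y - x)]addrC subrK.
  have -> : x + l *: (y - x) = (1 - l) *: x + l *: y.
    by rewrite scalerBr scalerBl scale1r addrA addrAC.
  by rewrite -[y - x]opprB dotpNl dotpNr opprK.
- have h x : V 0 + dotp (gradient V 0) x + dotp x x / 2 <= V x.
    have := second_order_lower (df 0 x) (df1 0 x) (qf2 0 x).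
    by rewrite /f1 scale0r scale1r !add0r.
  exists (1 / 4); first by lra.
  exists (V 0 - dotp (gradient V 0) (gradient V 0)) => x; apply: le_trans (h x).
  have := dotp_ge0 (gradient V 0 + 2^-1 *: x); rewrite !dotpE (dotpC x); lra.
Qed.

End potential_of_hessian.

Section test_functions.
Context (R : realType) (n : nat).
Implicit Types (f : 'rV[R]_n -> R) (s : seq 'I_n).

Lemma iter_partial_eq0 f s x : ~ closure [set y | f y != 0] x -> iter_partial s f x = 0.
Proof.
elim: s x => [|i s IH] x nx /=.
  apply: contrapT => fx; apply: nx; apply: subset_closure; exact/eqP.
have -> : 0 = 'D_(delta_mx 0 i) (cst 0 : 'rV[R]_n -> R) x.
  by apply/esym; apply: derive_val.
apply: near_eq_derive.
have : nbhs x (~` closure [set y | f y != 0]).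
  by apply: open_nbhs_nbhs; split => //; apply: closed_openC; exact: closed_closure.
by apply: filterS => y; exact: IH.
Qed.

Lemma smooth_continuous f s : smooth f -> continuous (iter_partial s f).
Proof. by move=> sf x; apply: differentiable_continuous; exact: sf. Qed.

(** An iterated derivative is continuous on the compact support and zero off it. *)
Lemma test_function_bounded f s : test_function f ->
  exists2 B : R, 0 <= B & forall x, `|iter_partial s f x| <= B.
Proof.
move=> [sf cf]; have ci := continuous_subspaceT (smooth_continuous (s := s) sf).
have [M [_ hM]] := compact_bounded (continuous_compact (ci _) cf).
exists (`|M| + 1); first by rewrite addr_ge0.
move=> x; have [Kx|nKx] := pselect (closure [set y | f y != 0] x).
  apply: (hM (`|M| + 1)); last by exists x.
  by rewrite (le_lt_trans (ler_norm M))// ltrDl.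
by rewrite iter_partial_eq0// normr0 addr_ge0.
Qed.

(** The second derivatives are bounded, and [M] sums their bounds. The mean value theorem is applied
    twice on the segment, parametrised by [-1, 1] so that 0 is the midpoint, where [gradient_pair]
    evaluates the gradient. *)
Lemma gradient_pair_test f : test_function f -> gradient_pair f (gradient f).
Proof.
move=> tf; have [sf cf] := tf.
have dfx x : differentiable f x by exact: (sf [::]).
have dgx i x : differentiable (fun y => gradient f y 0 i) x.
  have -> : (fun y => gradient f y 0 i) = iter_partial [:: i] f.
    by apply/funext => y; rewrite mxE.
  exact: (sf [:: i]).
have [B1 B10 hB1] := all_sig2 (fun i : 'I_n => cid2 (test_function_bounded [:: i] tf)).
split.
- by apply: continuous_measurable_rV; exact: (smooth_continuous (s := [::]) sf).
- apply: measurable_fun_mxP => k i; rewrite (ord1 k).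
  by apply: continuous_measurable_rV => x; exact: differentiable_continuous.
- have [B2 B20 hB2] := all_sig2 (fun ij : 'I_n * 'I_n => cid2 (test_function_bounded [:: ij.2; ij.1] tf)).
  pose M := \sum_(i < n) \sum_(j < n) B2 (i, j).
  have M0 : 0 <= M by apply: sumr_ge0 => i _; apply: sumr_ge0 => j _; exact: B20.
  exists M => // x y; pose m := 2^-1 *: (x + y); pose d := 2^-1 *: (x - y).
  have df t : is_derive t (1 : R) (fun s : R => f (m + s *: d)) (dotp (gradient f (m + t *: d)) d).
    by apply: is_derive_line; exact: is_derive_gradient.
  have df1 t : is_derive t (1 : R) (fun s : R => dotp (gradient f (m + s *: d)) d)
      (\sum_(i < n) dotp (gradient (fun z => gradient f z 0 i) (m + t *: d)) d * d 0 i).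
    apply: (@is_derive_line _ _ _ (fun z => dotp (gradient f z) d)).
    have -> : \sum_(i < n) dotp (gradient (fun z => gradient f z 0 i) (m + t *: d)) d * d 0 i =
        dotp (\row_i dotp (gradient (fun z => gradient f z 0 i) (m + t *: d)) d) d.
      by apply: eq_bigr => i _; rewrite mxE.
    by apply: is_derive_dotp => i; rewrite mxE; exact: is_derive_gradient.
  have dd0 := dotp_ge0 d.
  have f2M t : `|\sum_(i < n) dotp (gradient (fun z => gradient f z 0 i) (m + t *: d)) d * d 0 i| <= M * dotp d d.
    rewrite /M mulr_suml; apply: le_trans (ler_norm_sum _ _ _) _.
    apply: ler_sum => i _; rewrite {1}/dotp !mulr_suml.
    apply: le_trans (ler_norm_sum _ _ _) _; apply: ler_sum => j _.
    rewrite -mulrA normrM; apply: ler_pM => //.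
      rewrite mxE; have -> : (fun z => gradient f z 0 i) = iter_partial [:: i] f.
        by apply/funext => z; rewrite mxE.
      exact: (hB2 (i, j)).
    rewrite ler_norml.
    have Hs (k : 'I_n) : d 0 k ^+ 2 <= dotp d d.
      rewrite /dotp (bigD1 k)//= -expr2 lerDl; apply: sumr_ge0 => l _.
      by rewrite -expr2 sqr_ge0.
    have := Hs i; have := Hs j; have := sqr_ge0 (d 0 i - d 0 j); have := sqr_ge0 (d 0 i + d 0 j).
    by rewrite !expr2 => *; apply/andP; split; nra.
  have lt1 : -1 < 1 :> R by lra.
  have [c /andP[c1 c2]] := mean_value lt1 df.
  have -> : m + 1 *: d = x by rewrite /m /d; apply/rowP => i; rewrite !mxE; field.
  have -> : m + -1 *: d = y by rewrite /m /d; apply/rowP => i; rewrite !mxE; field.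
  move=> ->; rewrite -/m; have -> : x - y = 2 *: d by rewrite scalerA divff// scale1r.
  clearbody m d; rewrite !(dotpZl, dotpZr).
  have key : dotp (gradient f (m + c *: d)) d - dotp (gradient f m) d <= M * dotp d d.
    (* The intermediate point may lie on either side of the midpoint or coincide with it. *)
    have [->|[s Ms]] : c = 0 \/ exists2 s : R, `|s| <= M * dotp d d &
        dotp (gradient f (m + c *: d)) d - dotp (gradient f (m + 0 *: d)) d = s * c.
    - have [c0|c0|->] := ltgtP c 0; last by left.
      + have [e _ E] := mean_value c0 df1; right; exists (\sum_(i < n) dotp (gradient (fun z => gradient f z 0 i) (m + e *: d)) d * d 0 i) => //.
        by rewrite -[LHS]opprB E; lra.
      + have [e _ E] := mean_value c0 df1; right; exists (\sum_(i < n) dotp (gradient (fun z => gradient f z 0 i) (m + e *: d)) d * d 0 i) => //.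
        by rewrite E subr0.
    - by rewrite scale0r addr0 subrr mulr_ge0.
    rewrite scale0r addr0 => ->; apply: le_trans (ler_norm _) _; rewrite normrM.
    rewrite -[leRHS]mulr1 ler_pM// ler_norml; lra.
  have := mulr_ge0 M0 dd0; lra.
- exists (\sum_(i < n) B1 i ^+ 2); first by apply: sumr_ge0 => i _; exact: sqr_ge0.
  move=> x; apply: ler_sum => i _; rewrite mxE -expr2 -real_normK ?num_real//.
  by rewrite lerXn2r ?nnegrE//; exact: hB1.
Qed.

End test_functions.

(** * A nonconstant test function *)

Section flat_function.
Context (R : realType).

(** The powers of 1 / t make the family closed under derivation, up to linear combinations. *)
Definition flat (k : nat) (t : R) : R :=
  if 0 < t then t^-1 ^+ k * expR (- t^-1) else 0.

Lemma flat_gt0 k t : 0 < t -> 0 < flat k t.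
Proof. by move=> t0; rewrite /flat t0 mulr_gt0 ?expR_gt0// exprn_gt0// invr_gt0. Qed.

Lemma flat_eq0 k t : t <= 0 -> flat k t = 0.
Proof. by move=> t0; rewrite /flat ltNge t0. Qed.

Lemma flat_ge0 k t : 0 <= flat k t.
Proof. by case: (ltP 0 t) => t0; [exact/ltW/flat_gt0|rewrite flat_eq0]. Qed.

Lemma flat_le k t : flat k t <= k`!%:R.
Proof.
rewrite /flat; case: ifPn => // t0; have u0 : 0 < t^-1 by rewrite invr_gt0.
move: (t^-1) u0 => u u0; rewrite expRN ler_pdivrMr ?expR_gt0//.
have f0 : 0 < k`!%:R :> R by rewrite ltr0n fact_gt0.
rewrite mulrC -ler_pdivrMr//; case: k f0 => [|k] f0.
  by rewrite expr0 fact0 divr1; apply: le_trans (expR_ge1Dx u); rewrite lerDl ltW.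
by apply: le_trans (expR_ge1Dxn k (ltW u0)); rewrite lerDr.
Qed.

Lemma flatS k t : t * flat k.+1 t = flat k t.
Proof.
rewrite /flat; case: ifPn => [t0|]; last by rewrite mulr0.
by rewrite exprS !mulrA divff ?mul1r// gt_eqF.
Qed.

(** At 0 the difference quotient is flat (k + 1) at h, that is h times flat (k + 2), and [flat_le]
    bounds the last factor by a factorial. *)
Lemma is_derive_flat k t : is_derive t (1 : R) (flat k) (flat k.+2 t - k%:R * flat k.+1 t).
Proof.
case: (ltgtP t 0) => [t0|t0|->].
- rewrite !flat_eq0 ?ltW// mulr0 subr0.
  apply: (@near_eq_is_derive _ _ _ (cst 0)).
  by near=> s; rewrite flat_eq0//; apply/ltW; near: s; exact: lt_nbhsl.
- apply: (@near_eq_is_derive _ _ _ ((fun s : R => s^-1) ^+ k * (expR \o (fun s : R => - s^-1)))).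
    by apply: filterS (lt_nbhsr t0) => s s0; rewrite /flat s0 !fctE.
  have tn0 : t != 0 by rewrite gt_eqF.
  have dV : is_derive t (1 : R) (fun s : R => s^-1) (- t ^- 2).
    by apply: is_derive_eq (is_deriveV tn0 (is_derive_id _ _)) _; rewrite [_ *: _]mulr1.
  apply: is_derive_eq; rewrite /flat t0 !fctE -![_ *: _]/(_ * _) -exprVn.
  move: (t^-1) (expR _) => u e; case: k => [|k]/=; rewrite ?expr0 ?mul0r ?exprS; ring.
- rewrite !flat_eq0// mulr0 subr0.
  have hq : (fun h : R => h^-1 *: ((flat k \o shift 0) (h *: (1 : R)) - flat k 0)) @ 0^' --> (0 : R).
    apply/cvgr0Pnorm_le => e e0; have C0 : 0 < e / (k.+2)`!%:R by rewrite divr_gt0// ltr0n fact_gt0.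
    near=> h; have h0 : h != 0 by near: h; exact: nbhs_dnbhs_neq.
    rewrite /= [h *: (1 : R)]mulr1 addr0 [flat k 0]flat_eq0// subr0 -flatS [_ *: _]mulrA mulVf// mul1r.
    rewrite -flatS normrM (ger0_norm (flat_ge0 _ _)).
    apply: (@le_trans _ _ (e / (k.+2)`!%:R * (k.+2)`!%:R)).
      apply: ler_pM => //; [exact: flat_ge0| |exact: flat_le].
      by apply/ltW; near: h; exact: dnbhs0_lt.
    by rewrite divfK// gt_eqF// ltr0n fact_gt0.
  by apply: DeriveDef; [exact: cvgP hq|exact: cvg_lim hq].
Unshelve. all: by end_near. Qed.

End flat_function.

Section bump.
Context (R : realType) (n : nat) (c : R).
Implicit Types f g : 'rV[R]_n -> R.

Let Q (x : 'rV[R]_n) : R := c - dotp x x.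

(** A class of differentiable functions that contains the bump and is stable under partial
    derivatives: smoothness then follows by induction on the list of derivatives. *)
Inductive bump_ring : ('rV[R]_n -> R) -> Prop :=
| bump_cst a : bump_ring (cst a)
| bump_coord i : bump_ring (fun x => x 0 i)
| bump_add f g : bump_ring f -> bump_ring g -> bump_ring (f + g)
| bump_mul f g : bump_ring f -> bump_ring g -> bump_ring (f * g)
| bump_flat k : bump_ring (flat k \o Q).

Let differentiable_Q x : differentiable Q x.
Proof.
have -> : Q = cst c - \sum_(i < n) (fun y : 'rV[R]_n => y 0 i : R) ^+ 2.
  by apply/funext => y; rewrite !fctE fct_sumE; congr (_ - _); apply: eq_bigr => i _; rewrite fctE expr2.
apply: differentiableB => //; apply: differentiable_sum => i.
by apply: differentiableX; exact: differentiable_coord.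
Qed.

Let derive_coord (x v : 'rV[R]_n) i : is_derive x v (fun y => y 0 i : R) (v 0 i).
Proof. exact: (is_derive_coord (g := id)). Qed.

Let derive_Q x v : is_derive x v Q (- 2 * dotp x v).
Proof.
have -> : Q = cst c - \sum_(i < n) (fun y : 'rV[R]_n => y 0 i : R) ^+ 2.
  by apply/funext => y; rewrite !fctE fct_sumE; congr (_ - _); apply: eq_bigr => i _; rewrite fctE expr2.
have ds : is_derive x v (\sum_(i < n) (fun y : 'rV[R]_n => y 0 i : R) ^+ 2) (\sum_(i < n) 2 * x 0 i * v 0 i).
  apply: is_derive_sum => i; apply: is_derive_eq (is_deriveX 2 (derive_coord x v i)) _.
  by rewrite -[_ *: _]/(_ * _) expr1.
apply: is_derive_eq (is_deriveB _ ds) _.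
by rewrite sub0r mulNr /dotp mulr_sumr; congr (- _); apply: eq_bigr => i _; rewrite mulrA.
Qed.

Lemma bump_ring_differentiable f : bump_ring f -> forall x, differentiable f x.
Proof.
elim=> [a|i|f1 g1 _ IHf _ IHg|f1 g1 _ IHf _ IHg|k] x.
- exact: differentiable_cst.
- exact: differentiable_coord.
- exact: differentiableD.
- exact: differentiableM.
- apply: differentiable_comp => //; apply/derivable1_diffP.
  have h := is_derive_flat k (Q x); exact: ex_derive.
Qed.

Lemma bump_ring_derive f i : bump_ring f -> bump_ring ('D_(delta_mx 0 i) f).
Proof.
have dif := bump_ring_differentiable.
elim=> [a|j|f1 g1 hf IHf hg IHg|f1 g1 hf IHf hg IHg|k].
- have -> : 'D_(delta_mx 0 i) (cst a : 'rV[R]_n -> R) = cst 0.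
    by apply/funext => x; exact: derive_val.
  exact: bump_cst.
- have -> : 'D_(delta_mx 0 i) (fun x : 'rV[R]_n => x 0 j : R) = cst ((delta_mx 0 i : 'rV[R]_n) 0 j).
    by apply/funext => x; exact: derive_val.
  exact: bump_cst.
- have -> : 'D_(delta_mx 0 i) (f1 + g1) = 'D_(delta_mx 0 i) f1 + 'D_(delta_mx 0 i) g1.
    by apply/funext => x; rewrite deriveD//; apply: diff_derivable; exact: dif.
  exact: bump_add.
- have -> : 'D_(delta_mx 0 i) (f1 * g1) = f1 * 'D_(delta_mx 0 i) g1 + g1 * 'D_(delta_mx 0 i) f1.
    by apply/funext => x; rewrite deriveM//; apply: diff_derivable; exact: dif.
  by apply: bump_add; exact: bump_mul.
- have -> : 'D_(delta_mx 0 i) (flat k \o Q) =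
      (flat k.+2 \o Q + cst (- k%:R) * (flat k.+1 \o Q)) * (cst (- 2) * (fun x => x 0 i)).
    apply/funext => x; rewrite deriveE; last exact/dif/bump_flat.
    have dk := is_derive_flat k (Q x).
    have ddk : derivable (flat k) (Q x) 1 by exact: ex_derive.
    rewrite diff_comp//; last exact/derivable1_diffP.
    rewrite /= -(deriveE (delta_mx 0 i) (differentiable_Q x)) diff1E; last exact/derivable1_diffP.
    rewrite derive1E (derive_val (is_derive := derive_Q x (delta_mx 0 i))) (derive_val (is_derive := dk)).
    have -> : dotp x (delta_mx 0 i) = x 0 i.
      rewrite /dotp (bigD1 i)//= mxE !eqxx mulr1 big1 ?addr0// => j ji.
      by rewrite mxE (negbTE ji) andbF mulr0.
    by rewrite !fctE -[LHS]/(_ * _) [LHS]mulrC [in RHS]mulNr.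
  apply: bump_mul; first apply: bump_add; first exact: bump_flat.
    by apply: bump_mul; [exact: bump_cst|exact: bump_flat].
  by apply: bump_mul; [exact: bump_cst|exact: bump_coord].
Qed.

Lemma test_function_bump : test_function (flat 0 \o Q).
Proof.
split.
  have h s : bump_ring (iter_partial s (flat 0 \o Q)).
    by elim: s => [|i s IH] /=; [exact: bump_flat|exact: bump_ring_derive].
  by move=> s x; exact: bump_ring_differentiable.
have cQ : continuous Q by move=> x; exact: differentiable_continuous.
have sub : closure [set x | (flat 0 \o Q) x != 0] `<=` [set x | 0 <= Q x].
  have cl : closed [set x | 0 <= Q x].
    have := @preimage_closed _ _ Q [set y | 0 <= y] (fun x _ => cQ x) (@closed_ge _ 0).
    exact.
  rewrite [X in _ `<=` X]((closure_id _).1 cl); apply: closure_subset => x /=.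
  by apply: contraNT; rewrite -ltNge => /ltW/flat_eq0 ->.
apply: bounded_closed_compact; last exact: closed_closure.
(* In the sup norm, x_j^2 <= c gives |x_j| <= 1 + c. *)
exists (1 + c); split; first exact: num_real.
move=> M cM x /sub/=; rewrite subr_ge0 => xc.
have c0 : 0 <= c := le_trans (dotp_ge0 x) xc.
rewrite -[`|x|]/(mx_norm x) mx_normrE; apply/bigmax_leP; split; first by lra.
move=> [k j] _ /=; rewrite (ord1 k).
have xj : x 0 j ^+ 2 <= c.
  apply: le_trans xc; rewrite /dotp (bigD1 j)//= -expr2 lerDl.
  by apply: sumr_ge0 => l _; rewrite -expr2 sqr_ge0.
by rewrite ler_norml; apply/andP; split; nra.
Qed.

End bump.

Section box.
Context (R : realType).

(** Unlike Euclidean balls, boxes split as products under [cons_rV], which gives their positive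
    measure by induction. *)
Definition box n (a : 'rV[R]_n) (r : R) : set 'rV[R]_n := [set x | forall i, ball (a 0 i) r (x 0 i)].

Lemma measurable_box n (a : 'rV[R]_n) r : measurable (box a r).
Proof.
have -> : box a r = \bigcap_(i in [set: 'I_n]) ((fun x : 'rV[R]_n => x 0 i) @^-1` ball (a 0 i) r).
  by apply/seteqP; split => [x h i _|x h i]; [exact: h|exact: (h i I)].
apply: fin_bigcap_measurable => // i _.
rewrite -[X in measurable X]setTI; apply: (measurable_coord_mx 0 i) => //; exact: measurable_ball.
Qed.

Lemma lebesgue_box_gt0 n (a : 'rV[R]_n) r : 0 < r -> (0 < @lebesgue_rV R n (box a r))%E.
Proof.
move=> r0; elim: n a => [|n IH] a.
  by rewrite /= diracE mem_set ?lte_fin// => -[].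
pose a' : 'rV[R]_n := \row_j a 0 (lift ord0 j).
have E : @cons_rV R n @^-1` box a r = ball (a 0 ord0) r `*` box a' r.
  apply/seteqP; split => [[t x] h|[t x] [/= ht hx] i].
    split => [|j] /=; first by have := h ord0; rewrite cons_rV0.
    by have := h (lift ord0 j); rewrite cons_rVS mxE.
  case: (unliftP ord0 i) => [j ->|->]; last by rewrite cons_rV0.
  by have := hx j; rewrite cons_rVS mxE.
have b0 : (0 < lebesgue_measure (ball (a 0%R ord0) r))%E.
  by rewrite lebesgue_measure_ball ?lte_fin ?pmulrn_lgt0// ltW.
rewrite /= /cons_lebesgue /pushforward E product_measure1E//.
- apply: mule_gt0; [exact: b0|exact: IH].
- exact: measurable_ball.
- exact: measurable_box.
Qed.

End box.

Section variance_dvar.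
Local Open Scope ereal_scope.
Context d (T : measurableType d) (R : realType) (mu : probability T R).

(** Bridge to the variance in [poincare_inequality]: integrating (a - f y)^2 in y gives the variance
    plus (a - m)^2, then a = f x is integrated. *)
Lemma variance_dvar (f : T -> R) (B : R) : measurable_fun setT f ->
  (forall x, (`|f x| <= B)%R) -> dvar mu f = 'V_mu[f] + 'V_mu[f].
Proof.
move=> mf fB; have B0 : (0 <= B)%R by apply: le_trans (fB point).
have f2 : f \in Lfun mu 2%:E.
  apply/andP; split; first by rewrite inE.
  rewrite inE/= /finite_norm unlock; apply: poweR_lty.
  have -> : \int[mu]_x (`|(EFin \o f) x| `^ 2) = \int[mu]_x ((f x) ^+ 2)%:E.
    by apply: eq_integral => x _; rewrite /= -[2%R]/(2%:R)%R powR_mulrn// real_normK ?num_real.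
  rewrite -ge0_fin_numE; last by apply: integral_ge0 => x _; rewrite lee_fin sqr_ge0.
  apply: (@integral_bounded_fin _ _ _ mu _ (B ^+ 2)%R); first exact: measurable_funX.
  move=> x; rewrite sqr_ge0/= -real_normK ?num_real//.
  by rewrite lerXn2r ?nnegrE.
have f1 : f \in Lfun mu 1 by exact: (Lfun_subset12 (fin_num_measure mu _ measurableT) f2).
pose m := fine 'E_mu[f].
have VE : 'V_mu[f] = \int[mu]_x ((f x - m) ^+ 2)%:E.
  by rewrite /variance covariance.unlock -/m expectation.unlock; apply: eq_integral => x _.
have Vfin := variance_fin_num f2.
have key a : \int[mu]_y ((a - f y) ^+ 2)%:E = 'V_mu[f] + ((a - m) ^+ 2)%:E.
  have fa2 : (f \- cst a)%R \in Lfun mu 2%:E by rewrite rpredB ?lee1n//= => _; rewrite Lfun_cst.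
  have := varianceE fa2; rewrite varianceB_cst_r// expectationB ?Lfun_cst// expectation_cst.
  have -> : 'E_mu[((f \- cst a) ^+ 2)%R] = \int[mu]_y ((a - f y) ^+ 2)%:E.
    rewrite unlock; apply: eq_integral => y _; congr EFin.
    by rewrite fctE/= -[LHS]sqrrN opprB.
  have -> : 'E_mu[f] = m%:E by rewrite fineK// expectation_fin_num.
  by move=> ->; rewrite -EFinB -EFin_expe -[(a - m)%R]opprB sqrrN subeK.
rewrite /dvar (fubini_tonelli1 _ (measurable_dvar mf)); last first.
  by move=> z; rewrite lee_fin sqr_ge0.
transitivity (\int[mu]_x (cst 'V_mu[f] x + ((f x - m) ^+ 2)%:E)).
  by apply: eq_integral => x _; rewrite /fubini_F/= key.
have mfm : measurable_fun setT (fun x => ((f x - m) ^+ 2)%:E).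
  apply/measurable_EFinP; apply: (@measurable_funX _ _ _ _ _ 2).
  exact: (measurable_funB mf (measurable_cst m)).
rewrite integral_add.
- by rewrite -VE integral_cst//= probability_setT mule1.
- exact: measurable_cst.
- exact: mfm.
- by move=> x; exact: variance_ge0.
- by move=> x; rewrite lee_fin sqr_ge0.
Qed.

End variance_dvar.

Section nondegenerate.
Local Open Scope ereal_scope.
Context (R : realType) (n : nat) (V : 'rV[R]_n -> R) (mu : probability 'rV[R]_n R).
Hypothesis mV : measurable_fun setT V.
Hypothesis muE : forall A, measurable A ->
  mu A = \int[@lebesgue_rV R n]_(x in A) (expR (- V x))%:E.

Let mu_box_gt0 (a : 'rV[R]_n) : 0 < mu (box a 1).
Proof.
have mb := measurable_box a 1; rewrite muE//; apply: integral_gt0 => //.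
- apply: measurable_funTS; apply/measurable_EFinP; apply: measurableT_comp; first exact: measurable_expR.
  exact: measurableT_comp mV.
- by move=> x _; rewrite lte_fin expR_gt0.
- exact: lebesgue_box_gt0.
Qed.

(** Keeps the Poincare constant away from 0. The bump is positive on the unit box about the origin,
    where |x|^2 < n, and zero on the one about (2, ..., 2), where |x|^2 >= n; both have positive
    measure. *)
Lemma exists_test_function_dvar_gt0 : (0 < n)%N ->
  exists2 f : 'rV[R]_n -> R, test_function f & 0 < dvar mu f.
Proof.
move=> n0; pose f := (flat 0 \o (fun x : 'rV[R]_n => n%:R - dotp x x))%R.
have tf : test_function f := test_function_bump n n%:R%R.
exists f => //; have mf : measurable_fun setT f.
  by apply: continuous_measurable_rV; exact: (smooth_continuous (s := [::]) tf.1).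
pose A : set 'rV[R]_n := box 0%R 1; pose B : set 'rV[R]_n := box (const_mx 2%R) 1.
have i0 : 'I_n := Ordinal n0.
have inA x : A x -> (0 < f x)%R.
  move=> hx; apply: flat_gt0; rewrite subr_gt0.
  have -> : n%:R = (\sum_(i < n) 1 : R)%R by rewrite sumr_const card_ord.
  rewrite /dotp; apply: ltr_sum => [|i _].
    by apply/hasP; exists i0; rewrite // mem_index_enum.
  have := hx i; rewrite /ball/= mxE sub0r normrN -expr2 ltr_norml => /andP[h1 h2]; nra.
have inB x : B x -> f x = 0%R.
  move=> hx; apply: flat_eq0; rewrite subr_le0.
  have -> : n%:R = (\sum_(i < n) 1 : R)%R by rewrite sumr_const card_ord.
  rewrite /dotp; apply: ler_sum => i _.
  have := hx i; rewrite /ball/= mxE -expr2 ltr_norml => /andP[h1 h2]; nra.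
have mA : measurable A := measurable_box _ _; have mB : measurable B := measurable_box _ _.
have mAB : measurable (A `*` B) by exact: measurableX.
apply: (@lt_le_trans _ _ (\int[(mu \x mu)]_(z in A `*` B) ((f z.1 - f z.2) ^+ 2)%:E)).
  apply: integral_gt0 => //.
  - by apply: measurable_funTS; exact: measurable_dvar.
  - by move=> z [/inA f1 /inB ->]; rewrite subr0 lte_fin exprn_gt0.
  - have := mule_gt0 (mu_box_gt0 0%R) (mu_box_gt0 (const_mx 2%R)).
    by rewrite -(product_measure1E mu mu mA mB).
apply: ge0_subset_integral => //; first exact: measurable_dvar.
by move=> z _; rewrite lee_fin sqr_ge0.
Qed.

End nondegenerate.

(** * The Poincare constant *)

Section best_direction.
Local Open Scope ereal_scope.
Context (R : realType) (n : nat) (V : 'rV[R]_n -> R) (mu : probability 'rV[R]_n R).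
Hypothesis pV : potential V.
Hypothesis muE : forall A, measurable A ->
  mu A = \int[@lebesgue_rV R n]_(x in A) (expR (- V x))%:E.

Lemma dvar_linear_le (s : 'rV[R]_n) : dvar mu (fun x => dotp x s) <= (2 * dotp s s)%:E.
Proof.
apply: le_trans (poincare_mu pV muE (gradient_pair_linear s)) _.
by rewrite integral_cst//= probability_setT mule1.
Qed.

Let q (s : 'rV[R]_n) : R := fine (dvar mu (fun x => dotp x s)).

Let qE s : dvar mu (fun x => dotp x s) = (q s)%:E.
Proof.
rewrite /q fineK// ge0_fin_numE; last exact: dvar_ge0.
exact: le_lt_trans (dvar_linear_le s) (ltry _).
Qed.

Let q_ge0 s : (0 <= q s)%R. Proof. by rewrite -lee_fin -qE dvar_ge0. Qed.

(** From (a + b)^2 <= (1 + r) a^2 + (1 + 1 / r) b^2, with q (s - t) <= 2 r^2 by the Poincare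
    inequality for linear functions. It gives the continuity of [q] without a covariance matrix. *)
Let q_perturb (s t : 'rV[R]_n) (r : R) : (0 < r)%R -> (dotp (s - t) (s - t) <= r ^+ 2)%R ->
  (q s <= (1 + r) * q t + 2 * r ^+ 2 + 2 * r)%R.
Proof.
move=> r0 hr; rewrite -lee_fin -qE.
have ml u : measurable_fun setT (fun x : 'rV[R]_n => dotp x u).
  by apply: measurable_dotp; [exact: measurable_id|exact: measurable_cst].
have md u := measurable_dvar (ml u).
have i0 : (0 <= 1 + r^-1)%R by rewrite addr_ge0// invr_ge0 ltW.
apply: (@le_trans _ _ ((1 + r)%:E * (q t)%:E + (1 + r^-1)%:E * (q (s - t))%:E)).
  rewrite -!qE /dvar -integral_scalel; [|by rewrite addr_ge0// ltW|exact: md|by move=> z; rewrite lee_fin sqr_ge0].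
  rewrite -integral_scalel; [|exact: i0|exact: md|by move=> z; rewrite lee_fin sqr_ge0].
  rewrite -integral_add.
  - apply: integral_le.
    + exact: md.
    + by apply: emeasurable_funD; apply: measurable_funeM; exact: md.
    + by move=> z; rewrite lee_fin sqr_ge0.
    move=> z; rewrite -!EFinM -EFinD lee_fin.
    have -> : (dotp z.1 s - dotp z.2 s = (dotp z.1 t - dotp z.2 t) + (dotp z.1 (s - t) - dotp z.2 (s - t)))%R.
      by rewrite !dotpE; ring.
    move: (_ - _)%R (_ - _)%R => b a.
    have -> : ((1 + r) * a ^+ 2 + (1 + r^-1) * b ^+ 2 = (a + b) ^+ 2 + r^-1 * (r * a - b) ^+ 2)%R.
      by field; rewrite gt_eqF.
    by rewrite lerDl; apply: mulr_ge0; [rewrite invr_ge0 ltW|exact: sqr_ge0].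
  - by apply: measurable_funeM; exact: md.
  - by apply: measurable_funeM; exact: md.
  - by move=> z; apply: mule_ge0; rewrite lee_fin ?sqr_ge0// addr_ge0// ltW.
  - by move=> z; apply: mule_ge0; rewrite lee_fin ?sqr_ge0.
rewrite -!EFinM -EFinD lee_fin -addrA lerD2l.
have h : (q (s - t) <= 2 * r ^+ 2)%R.
  by rewrite -lee_fin -qE; apply: le_trans (dvar_linear_le _) _; rewrite lee_fin ler_pM2l.
apply: (@le_trans _ _ ((1 + r^-1) * (2 * r ^+ 2))%R); first by rewrite ler_wpM2l.
by rewrite le_eqVlt; apply/orP; left; apply/eqP; field; rewrite gt_eqF.
Qed.

Let continuous_dist (t : 'rV[R]_n) : continuous (fun s : 'rV[R]_n => dotp (s - t) (s - t)).
Proof.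
have -> : (fun s : 'rV[R]_n => dotp (s - t) (s - t)) =
    (\sum_(i < n) ((fun s : 'rV[R]_n => s 0%R i) - cst (t 0%R i)) ^+ 2)%R.
  by apply/funext => s; rewrite fct_sumE; apply: eq_bigr => i _; rewrite !fctE !mxE expr2.
move=> s; apply: differentiable_continuous; apply: differentiable_sum => i.
by apply: differentiableX; apply: differentiableB; [exact: differentiable_coord|exact: differentiable_cst].
Qed.

Let q_continuous : continuous q.
Proof.
move=> t; have [_ H] := @cvgrPdist_le _ _ _ (nbhs t) _ q (q t); apply: H => e e0.
(* For r <= 1 the two uses of [q_perturb] bound the differences by r (q t + 4) and r (2 q t + 8). *)
pose C := (3 * q t + 8)%R.
have C0 : (0 < C)%R by rewrite /C; have := q_ge0 t; lra.
pose r := Num.min 1%R (e / C)%R.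
have r0 : (0 < r)%R by rewrite lt_min ltr01 divr_gt0.
have r1 : (r <= 1)%R by rewrite ge_min lexx.
have rC : (r * C <= e)%R by rewrite -ler_pdivlMr// ge_min lexx orbT.
have h : \forall s \near t, (dotp (s - t) (s - t) < r ^+ 2)%R.
  have [H _] := @cvgrPdist_lt _ _ _ (nbhs t) _ (fun s : 'rV[R]_n => dotp (s - t) (s - t)) (dotp (t - t) (t - t)).
  apply: filterS (H (@continuous_dist t t) (r ^+ 2)%R (exprn_gt0 _ r0)) => s; rewrite subrr dotp0l.
  by rewrite sub0r normrN ger0_norm// dotp_ge0.
near=> s; have st : (dotp (s - t) (s - t) < r ^+ 2)%R by near: s.
have ts : (dotp (t - s) (t - s) <= r ^+ 2)%R.
  by rewrite -opprB dotpNl dotpNr opprK ltW.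
have h1 := q_perturb r0 (ltW st); have h2 := q_perturb r0 ts.
have h3 := q_ge0 s; have h4 := q_ge0 t; move: rC h1 h2; rewrite /C ler_norml => *.
by apply/andP; split; nra.
Unshelve. all: by end_near. Qed.

(** The maximiser over the compact sphere dominates at once the directions obtained for all the
    constants c < C_P(mu). *)
Lemma exists_best_direction : (0 < n)%N ->
  exists2 s : 'rV[R]_n, dotp s s = 1%R &
    forall t, dotp t t = 1%R -> dvar mu (fun x => dotp x t) <= dvar mu (fun x => dotp x s).
Proof.
move=> n0; pose S := [set s : 'rV[R]_n | dotp s s = 1%R].
have cN : continuous (fun s : 'rV[R]_n => dotp s s).
  have E : (fun s : 'rV[R]_n => dotp (s - 0) (s - 0))%R = (fun s => dotp s s).
    by apply/funext => s; rewrite subr0.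
  by rewrite -E; exact: continuous_dist.
have clS : closed S.
  have := @preimage_closed _ _ (fun s : 'rV[R]_n => dotp s s) [set y | y = 1%R] (fun x _ => cN x) (@closed_eq _ 1%R).
  exact.
have bS : bounded_set S.
  exists 1%R; split; first exact: num_real.
  move=> M M1 x; rewrite /S/= => x1.
  rewrite -[`|x|%R]/(mx_norm x) mx_normrE; apply/bigmax_leP; split; first by lra.
  move=> [k j] _ /=; rewrite (ord1 k).
  have xj : (x 0 j ^+ 2 <= 1)%R.
    rewrite -x1 /dotp (bigD1 j)//= -expr2 lerDl.
    by apply: sumr_ge0 => l _; rewrite -expr2 sqr_ge0.
  by rewrite ler_norml; apply/andP; split; nra.
have S0 : S !=set0.
  pose i : 'I_n := Ordinal n0; exists (delta_mx 0%R i); rewrite /S/= /dotp (bigD1 i)//= mxE !eqxx mulr1.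
  by rewrite big1 ?addr0// => j ji; rewrite mxE (negbTE ji) andbF mulr0.
have [s Ss hs] := EVT_max_rV S0 (bounded_closed_compact bS clS) (continuous_subspaceT q_continuous).
exists s; first by move: Ss; rewrite inE.
by move=> t t1; rewrite !qE lee_fin; apply: hs; rewrite inE.
Qed.

End best_direction.

Section poincare_constant.
Local Open Scope ereal_scope.
Context (R : realType) (n : nat) (V : 'rV[R]_n -> R) (mu : probability 'rV[R]_n R).
Hypothesis pV : potential V.
Hypothesis muE : forall A, measurable A ->
  mu A = \int[@lebesgue_rV R n]_(x in A) (expR (- V x))%:E.
Hypothesis n0 : (0 < n)%N.

Let energy (f : 'rV[R]_n -> R) : R := fine (\int[mu]_x (enorm (gradient f x) ^+ 2)%:E).

Let energyE f : test_function f ->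
  \int[mu]_x (enorm (gradient f x) ^+ 2)%:E = (energy f)%:E /\
  \int[mu]_x (dotp (gradient f x) (gradient f x))%:E = (energy f)%:E.
Proof.
move=> /gradient_pair_test[_ mG _ [L L0 GL]].
have E : \int[mu]_x (enorm (gradient f x) ^+ 2)%:E = \int[mu]_x (dotp (gradient f x) (gradient f x))%:E.
  by apply: eq_integral => x _; rewrite sqr_enorm.
rewrite /energy E fineK//; apply: (@integral_bounded_fin _ _ _ mu _ L).
  exact: measurable_dotp.
by move=> x; rewrite dotp_ge0/=; exact: GL.
Qed.

Let energy_ge0 f : (0 <= energy f)%R.
Proof. by apply: fine_ge0; apply: integral_ge0 => x _; rewrite lee_fin sqr_ge0. Qed.

Let dvar_test f : test_function f -> exists2 v : R, 'V_mu[f] = v%:E & dvar mu f = (2 * v)%:E.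
Proof.
move=> tf; have [B B0 hB] := test_function_bounded [::] tf.
have mf : measurable_fun setT f by case: (gradient_pair_test tf).
have dE := variance_dvar mu mf hB; have := poincare_mu pV muE (gradient_pair_test tf).
rewrite (energyE tf).2 dE -EFinM; have := variance_ge0 mu f.
case: ('V_mu[f]) => [v| |]// _ _; exists v => //.
by rewrite -EFinD mulr_natl mulr2n.
Qed.

Lemma poincare_inequality1 : poincare_inequality mu 1.
Proof.
move=> f tf; rewrite (energyE tf).1 mul1e; have [v -> dE] := dvar_test tf.
have := poincare_mu pV muE (gradient_pair_test tf); rewrite dE (energyE tf).2 -EFinM !lee_fin; lra.
Qed.

(** Makes [fine] and the inverse in the final bound meaningful. Positivity: admissible constants
    arbitrarily near 0 would contradict a test function of positive variance and finite energy. *)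
Lemma poincare_constant_fin : exists2 k : R, poincare_constant mu = k%:E & (0 < k <= 1)%R.
Proof.
have le1 : poincare_constant mu <= 1.
  by apply: ereal_inf_lbound; exists 1%R => //; split => //; exact: poincare_inequality1.
have ge0 : 0 <= poincare_constant mu.
  by apply: le_ereal_inf_tmp => _ [c [c0 _] <-]; rewrite lee_fin.
have [k kE] : exists k, poincare_constant mu = k%:E.
  by case: (poincare_constant mu) le1 ge0 => [k| |]//; exists k.
exists k => //; move: le1 ge0; rewrite kE !lee_fin => k1 k0; rewrite k1 andbT lt0r k0 andbT.
apply/eqP => k00; have mV : measurable_fun setT V by case: pV.
have [f tf] := exists_test_function_dvar_gt0 mV muE n0.
have [v vE ->] := dvar_test tf; rewrite lte_fin => v0.
(* The 1 added to the energy guards against division by zero. *)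
have e0 : (0 < v / (energy f + 1))%R.
  by apply: divr_gt0; [lra|have := energy_ge0 f; lra].
have : poincare_constant mu < (v / (energy f + 1))%:E by rewrite kE k00 lte_fin.
move=> /ereal_inf_lt[_ [c [c0 hc] <-]]; rewrite lte_fin ltr_pdivlMr; last by have := energy_ge0 f; lra.
have := hc f tf; rewrite vE (energyE tf).1 -EFinM lee_fin; lra.
Qed.

(** Any c < C_P(mu) is violated by some test function, whose doubled variance then exceeds 2 c times
    its energy: the input of [stability]. The best direction does not depend on c, so c may tend to
    C_P(mu). *)
Lemma exists_almost_isotropic_direction (k : R) : poincare_constant mu = k%:E ->
  exists2 s : 'rV[R]_n, dotp s s = 1%R & (2 - 80 * (1 - k))%:E <= dvar mu (fun x => dotp x s).
Proof.
move=> kE; have [k' k'E /andP[k0 k1]] := poincare_constant_fin.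
have kk : k' = k by apply: EFin_inj; rewrite -k'E.
rewrite {}kk {k' k'E} in k0 k1 *.
have [s s1 hs] := exists_best_direction pV muE n0.
(* Up to 15/16 the left-hand side is negative; beyond it [stability] applies, its range being 1 - c
   <= 1/16. *)
exists s => //; have [k16|k16] := leP k (15 / 16)%R.
  by apply: le_trans (dvar_ge0 mu _); rewrite lee_fin; lra.
have hc (c : R) : (15 / 16 < c)%R -> (c < k)%R -> (2 - 80 * (1 - c))%:E <= dvar mu (fun x => dotp x s).
  move=> c16 ck; have : ~ poincare_inequality mu c.
    move=> hc; have : poincare_constant mu <= c%:E by apply: ereal_inf_lbound; exists c => //; split => //; lra.
    by rewrite kE lee_fin leNgt ck.
  move=> /existsNP[f /not_implyP[tf /negP]]; rewrite -ltNge (energyE tf).1.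
  have [v -> dE] := dvar_test tf; rewrite -EFinM lte_fin => hv.
  have c0 : (0 <= c * energy f)%R by apply: mulr_ge0; [lra|exact: energy_ge0].
  have [t t1 ht] : exists2 t : 'rV[R]_n, dotp t t = 1%R & (2 - 80 * (1 - c))%:E <= dvar mu (fun x => dotp x t).
    apply: (stability pV muE (gradient_pair_test tf)).
    - lra.
    - lra.
    - by rewrite dE lte_fin; lra.
    - by rewrite dE (energyE tf).2 -EFinM lee_fin; lra.
  exact: le_trans ht (hs t t1).
move: hc; case: (dvar mu _) (dvar_ge0 mu (fun x => dotp x s)) => [w| |]// w0 hc; last by rewrite leey.
rewrite lee_fin leNgt; apply/negP => wk.
(* If the value [w] fell short, any c between 1 - (2 - w) / 80 and k would contradict [hc]; the
   maximum also keeps c above 15/16. *)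
pose c := Num.max ((15 / 16 + k) / 2)%R ((k + (1 - (2 - w) / 80)) / 2)%R.
have c1 : (15 / 16 < c)%R by rewrite /c lt_max; apply/orP; left; lra.
have c2 : (c < k)%R by rewrite /c gt_max; apply/andP; split; lra.
have c3 : ((k + (1 - (2 - w) / 80)) / 2 <= c)%R by rewrite /c le_max lexx orbT.
have := hc c c1 c2; rewrite lee_fin; clearbody c; lra.
Qed.

End poincare_constant.

Theorem corollary1p3 (R : realType) :
  exists C : R,
    forall (n : nat) (V : 'rV[R]_n -> R) (mu : probability 'rV[R]_n R),
      (0 < n)%N ->
      (forall A, measurable A ->
        mu A = (\int[@lebesgue_rV R n]_(x in A) (expR (- V x))%:E)%E) ->
      twice_differentiable V ->
      (forall x, loewner_le 1%:M (hessian V x)) ->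
      exists sigma p : 'rV[R]_n,
        [/\ enorm sigma = 1,
            (p <= sigma)%MS
          & (wasserstein1 mu
               (prod_direct_sum (gaussian_line p sigma) (orth_marginal sigma mu))
             <= (C * Num.sqrt ((fine (poincare_constant mu))^-1 - 1))%:E)%E].
Proof.
(* 240 = 3 * 80, where 3 comes from [wasserstein_bound] and 80 from [stability]; and 1 - k <= 1 / k
   - 1 for 0 < k <= 1. *)
exists (Num.sqrt 240) => -[//|n] V mu n0 muE dV hV.
have pV := potential_of_hessian dV hV.
have [k kE /andP[k0 k1]] := poincare_constant_fin pV muE n0.
have [s s1 hs] := exists_almost_isotropic_direction pV muE n0 kE.
have e0 : 0 <= 80 * (1 - k) by lra.
have [p ps W] := wasserstein_bound pV muE s1 e0 hs.
exists s, p; split => //; first by rewrite /enorm s1 sqrtr1.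
rewrite kE/=; apply: le_trans W _; rewrite lee_fin -sqrtrM; last by lra.
have kV : 0 < k^-1 by rewrite invr_gt0.
have kk : k * k^-1 = 1 by rewrite divff// gt_eqF.
rewrite ler_wsqrtr//; nra.
Qed.
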